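(* Let $N,m\ge 1$ be integers, $T>0$, and consider, for $k=1,\dots,N$, the nonlocal system $\partial_t\rho^k+\partial_xF_k(\rho^k,\omega\ast\boldsymbol\rho)=S_k(\boldsymbol\rho,\omega\ast\boldsymbol\rho)$, $\boldsymbol\rho(0,\cdot)=\boldsymbol\rho_0$. Assume there are $\rho_M>\rho_m\ge 0$ such that for every $k\in\{1,\dots,N\}$: (flux) $F_k(\rho_m,\boldsymbol R)=0$ for all $\boldsymbol R\in\mathbb R^m$; $F_k$ is Lipschitz on $[\rho_m,\rho_M]^{m+1}$ with Lipschitz constant $L_F$; and $F_k(\rho^k,\boldsymbol R)=\rho^kV_k(\boldsymbol R)$ with $V_k$ Lipschitz on $[\rho_m,\rho_M]^m$; (source) $S_k(\boldsymbol\rho_m,\boldsymbol R)=0$ for all $\boldsymbol R\in\mathbb R^m$, where $\boldsymbol\rho_m=(\rho_m,\dots,\rho_m)^T$; $S_k$ is Lipschitz on $[\rho_m,\rho_M]^{N+m}$ with Lipschitz constant $L_S$; and $\partial_{\rho^j}S_k(\boldsymbol\rho,\boldsymbol R)=\text{const.}$ for $j=1,\dots,N$, i.e. $S_k$ is a linear function in each $\rho^j$; (initial data) $\boldsymbol\rho_0\in L^\infty(\mathbb R;[\rho_m,\rho_M)^N)$; (kernels) for $\ell=1,\dots,m$: $\omega^{\ell,k}\in L^1\cap BV(\mathbb R;\mathbb R_+)$, $0\in\operatorname{supp}(\omega^{\ell,k})$ and $\int_{\mathbb R}\omega^{\ell,k}(x)\,dx=1$. Let $\boldsymbol\rho_\Delta$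 be the sequence of approximate solutions generated by the non-staggered Nessyahu-Tadmor (NT) scheme with the modified slopes (all defined in the context), where the step sizes satisfy, with $\lambda=\Delta t/\Delta x$, the CFL condition $\lambda L_F\le\frac{\sqrt2-1}{2}$. Then, as $\Delta x,\Delta t\to 0$, there exist a sufficiently small time $T^*\in(0,T]$ and a function $\boldsymbol\rho\in L^\infty((0,T^* )\times\mathbb R)$ such that, up to a subsequence, $\boldsymbol\rho_\Delta\to\boldsymbol\rho$ weakly-$*$ in $L^\infty((0,T^* )\times\mathbb R)$. Moreover, $\boldsymbol\rho$ is a weak solution of the nonlocal system (on the time interval $(0,T^* )$).
   Context: **System.** $\boldsymbol\rho=(\rho^1,\dots,\rho^N)$, $F_k:\mathbb R\times\mathbb R^m\to\mathbb R$, $S_k:\mathbb R^N\times\mathbb R^m\to\mathbb R$. The nonlocal term $\boldsymbol R=\omega\ast\boldsymbol\rho\in\mathbb R^m$ has components $R^\ell(t,x)=\sum_{k=1}^N\int_{\mathbb R}\omega^{\ell,k}(y-x)\rho^k(t,y)\,dy$, $\ell=1,\dots,m$. **Weak solution on $(0,T)$.** $\boldsymbol\rho\in L^\infty((0,T)\times\mathbb R;\mathbb R^N)$ is a weak solution with initial datum $\boldsymbol\rho_0$ if for $k=1,\dots,N$ and all $\phi\in C_0^1((-42,T)\times\mathbb R;\mathbb R)$, $$\int_{\mathbb R}\rho_0^k\phi(0,x)dx+\int_0^T\!\!\int_{\mathbb R}\rho^k\phi_t\,dxdt+\int_0^T\!\!\int_{\mathbb R}F_k(\rho^k,\omega\ast\boldsymbol\rho)\phi_x\,dxdt+\int_0^T\!\!\int_{\mathbb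 R}S_k(\boldsymbol\rho,\omega\ast\boldsymbol\rho)\phi\,dxdt=0.$$ **Grid.** $\Delta x,\Delta t>0$, $\lambda=\Delta t/\Delta x$, $x_j=j\Delta x$, $x_{j\pm1/2}=(j\pm\frac12)\Delta x$ ($j\in\mathbb Z$), $t^n=n\Delta t$. If $\omega^{\ell,k}$ has compact support, write it $[\eta_1^{\ell,k},\eta_2^{\ell,k}]$ with $\eta_1^{\ell,k}\le0\le\eta_2^{\ell,k}$, $\eta_1^{\ell,k}\ne\eta_2^{\ell,k}$, and assume $N_1^{\ell,k}=|\eta_1^{\ell,k}|/\Delta x$, $N_2^{\ell,k}=\eta_2^{\ell,k}/\Delta x$ are nonnegative integers. If the support is unbounded on a side, the corresponding boundary term below is absent and the sum extends to infinity on that side. **minmod.** $\mathrm{mm}$ of several real arguments is the argument of smallest absolute value if all arguments are nonzero and have the same sign, and $0$ otherwise. **NT scheme.** Initially $\rho_j^{k,0}=\frac1{\Delta x}\int_{x_{j-1/2}}^{x_{j+1/2}}\rho_0^k(x)dx$. Given $\boldsymbol\rho_j^n=(\rho_j^{1,n},\dots,\rho_j^{N,n})$: 1. Slopes $s_j^{k,n}$ (see below). 2. $R_j^{\ell,n}=\sum_kR_j^{\ell,k,n}$ with (indices $\ell,k$ suppressed on $N_1,N_2,\omega$) $$R_j^{\ell,k,n}=\tfrac{\Delta x}{2}\big(\rho^{k,n}_{j-N_1}+\tfrac{\Delta x}{4}s^{k,n}_{j-N_1}\big)\omega\big(\tfrac{\Delta x}{4}-N_1\Delta x\big)+\Delta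 x\sum_{l=-N_1}^{N_2-2}\rho^{k,n}_{j+l+1}\,\omega((l+1)\Delta x)+\tfrac{\Delta x}{2}\big(\rho^{k,n}_{j+N_2}-\tfrac{\Delta x}{4}s^{k,n}_{j+N_2}\big)\omega\big(N_2\Delta x-\tfrac{\Delta x}{4}\big).$$ 3. Flux slopes $\sigma_j^{k}=\sigma^k(\boldsymbol\rho_j^n,\boldsymbol R_j^n)$ (see below), and with $Q_j^k=S_k(\boldsymbol\rho_j^n,\boldsymbol R_j^n)-\sigma_j^k$, $$R_{t,j}^{\ell,k,n}=\tfrac{\Delta x}{2}Q^k_{j-N_1}\omega\big(\tfrac{\Delta x}{4}-N_1\Delta x\big)+\Delta x\sum_{l=-N_1}^{N_2-2}Q^k_{j+l+1}\,\omega((l+1)\Delta x)+\tfrac{\Delta x}{2}Q^k_{j+N_2}\,\omega\big(N_2\Delta x-\tfrac{\Delta x}{4}\big).$$ 4. Half step: $\rho_j^{k,n+1/2}=\rho_j^{k,n}+\frac{\Delta t}{2}Q_j^k$; $R_j^{\ell,n+1/2}=\sum_k\big(R_j^{\ell,k,n}+\frac{\Delta t}{2}R_{t,j}^{\ell,k,n}\big)$. 5. Staggered values: $$\rho_{j+1/2}^{k,n+1}=\tfrac12(\rho_j^{k,n}+\rho_{j+1}^{k,n})+\tfrac{\Delta x}{8}(s_j^{k,n}-s_{j+1}^{k,n})-\lambda\big[F_k(\rho_{j+1}^{k,n+1/2},\boldsymbol R_{j+1}^{n+1/2})-F_k(\rho_j^{k,n+1/2},\boldsymbol R_j^{n+1/2})\big]+\tfrac{\Delta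 t}{2}\big[S_k(\boldsymbol\rho_{j+1}^{n+1/2},\boldsymbol R_{j+1}^{n+1/2})+S_k(\boldsymbol\rho_j^{n+1/2},\boldsymbol R_j^{n+1/2})\big].$$ 6. Projection, with staggered slopes $s_{j+1/2}^{k,n+1}$ (see below): $\rho_j^{k,n+1}=\frac12(\rho_{j-1/2}^{k,n+1}+\rho_{j+1/2}^{k,n+1})-\frac{\Delta x}{8}(s_{j+1/2}^{k,n+1}-s_{j-1/2}^{k,n+1})$. **Modified slopes.** With fixed constants $C>0$, $\delta\in(0,1)$ and $F_j^k=F_k(\rho_j^{k,n},\boldsymbol R_j^n)$: $$\Delta x\,s_j^{k,n}=\mathrm{mm}\big(\rho_{j+1}^{k,n}-\rho_j^{k,n},\ \rho_j^{k,n}-\rho_{j-1}^{k,n},\ \mathrm{sign}(\rho_j^{k,n}-\rho_{j-1}^{k,n})C\Delta x^\delta\big),$$ $$\Delta x\,\sigma_j^k=\mathrm{mm}\big(F_j^k-F_{j-1}^k,\ F_{j+1}^k-F_j^k,\ \mathrm{sign}(F_j^k-F_{j-1}^k)C\Delta x^\delta\big),$$ $$\Delta x\,s_{j+1/2}^{k,n+1}=\mathrm{mm}\big(\rho_{j+3/2}^{k,n+1}-\rho_{j+1/2}^{k,n+1},\ \rho_{j+1/2}^{k,n+1}-\rho_{j-1/2}^{k,n+1},\ \mathrm{sign}(\rho_{j+1/2}^{k,n+1}-\rho_{j-1/2}^{k,n+1})C\Delta x^\delta\big).$$ **Approximate solution.** $\rho_\Delta^k(t,x)=\sum_{j\in\mathbb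 Z}\sum_{n=0}^{n^*}(\rho_j^{k,n}+s_j^{k,n}(x-x_j))\chi_{[x_{j-1/2},x_{j+1/2})}(x)\chi_{[t^n,t^{n+1})}(t)$, where $n^*$ is a time index up to which the approximate values stay in the range where the Lipschitz assumptions on $F_k,S_k$ hold (small time horizon).
   Formalization: F_k (with constant L_F), V_k and S_k are assumed Lipschitz for R in [ρ_m−ε, Nρ_M+ε]^m for some ε>0, not only [ρ_m,ρ_M]^m, since ω∗ρ leaves the printed box (e.g. N=2); λ=Δt/Δx may vary along the sequence but is bounded below by a positive constant (as when λ is fixed). *)

(* Defs.v *)
From HB Require Import structures.
From mathcomp Require Import all_boot all_order all_algebra.
From mathcomp Require Import all_classical all_reals all_analysis.

Set Implicit Arguments.
Unset Strict Implicit.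
Unset Printing Implicit Defensive.

Import Order.TTheory GRing.Theory Num.Theory.
Import numFieldNormedType.Exports.

Local Open Scope classical_set_scope.
Local Open Scope ring_scope.

Section Box.
Context {R : realType}.

Definition in_box (a b : R) (n : nat) (v : 'rV[R]_n) : Prop :=
  forall i, a <= v 0 i <= b.

Definition dist1 (n : nat) (u v : 'rV[R]_n) : R := \sum_i `|u 0 i - v 0 i|.

(* The Lipschitz constants refer to the 1-norm of the full argument: a function
   that is L-Lipschitz for any other p-norm is L-Lipschitz in this sense.
   The densities range over [rm, rM], the nonlocal terms over [a, b]. The two
   ranges differ: a component of w * rho is a sum of N averages of densities, so
   it fills [N rm, N rM], and its discretisation leaves that interval by O(dx)
   because the quadrature weights do not add up to exactly 1. *)
Definition flux_lipschitz (m : nat) (L rm rM a b : R)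
    (f : R -> 'rV[R]_m -> R) : Prop :=
  forall (r r' : R) (q q' : 'rV[R]_m),
    rm <= r <= rM -> rm <= r' <= rM -> in_box a b q -> in_box a b q' ->
    `|f r q - f r' q'| <= L * (`|r - r'| + dist1 q q').

Definition speed_lipschitz (m : nat) (L a b : R) (v : 'rV[R]_m -> R) : Prop :=
  forall q q' : 'rV[R]_m, in_box a b q -> in_box a b q' ->
    `|v q - v q'| <= L * dist1 q q'.

Definition source_lipschitz (N m : nat) (L rm rM a b : R)
    (s : 'rV[R]_N -> 'rV[R]_m -> R) : Prop :=
  forall (r r' : 'rV[R]_N) (q q' : 'rV[R]_m),
    in_box rm rM r -> in_box rm rM r' -> in_box a b q -> in_box a b q' ->
    `|s r q - s r' q'| <= L * (dist1 r r' + dist1 q q').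

(* The gradient of s in its first argument does not depend on that argument; it
   may depend on q. *)
Definition linear_in_density (N m : nat) (s : 'rV[R]_N -> 'rV[R]_m -> R) : Prop :=
  forall (j : 'I_N) (q : 'rV[R]_m), exists c : R, forall r : 'rV[R]_N,
    is_derive (0 : R) (1 : R) (fun h : R => s (r + h *: delta_mx 0 j) q) c.

End Box.

Section Kernel.
Context {R : realType}.
Implicit Types (w : R -> R) (dx : R).

(* w is the representative that the scheme evaluates pointwise. *)
Definition supp w : set R := closure [set x | w x != 0].

Definition BV_line w : Prop :=
  exists M : R, forall a b : R, a <= b -> (total_variation a b w <= M%:E)%E.

Definition is_kernel w : Prop :=
  [/\ (forall x, 0 <= w x),
      (@lebesgue_measure R).-integrable setT (EFin \o w),
      BV_line w, supp w 0 &
      \int[@lebesgue_measure R]_x w x = 1].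

Definition left_bounded w : bool := `[< has_lbound (supp w) >].
Definition right_bounded w : bool := `[< has_ubound (supp w) >].

(* [eta1 w, eta2 w] is the convex hull of a compact support; each end is only
   used when the support is bounded on that side. *)
Definition eta1 w : R := inf (supp w).
Definition eta2 w : R := sup (supp w).

Definition grid_fits dx w : Prop :=
  (left_bounded w -> `|eta1 w| / dx \is a Num.nat) /\
  (right_bounded w -> eta2 w / dx \is a Num.nat).

Definition N1 dx w : int := Num.floor (`|eta1 w| / dx).
Definition N2 dx w : int := Num.floor (eta2 w / dx).

End Kernel.

Section Scheme.
Context {R : realType} {N m : nat}.
Variables (F : 'I_N -> R -> 'rV[R]_m -> R).
Variables (S : 'I_N -> 'rV[R]_N -> 'rV[R]_m -> R).
Variables (w : 'I_m -> 'I_N -> R -> R).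
Variables (C delta : R).
Variables (dx dt : R).

Definition minmod3 (a b c : R) : R :=
  if [&& 0 < a, 0 < b & 0 < c] then Num.min a (Num.min b c)
  else if [&& a < 0, b < 0 & c < 0] then Num.max a (Num.max b c)
  else 0.

(* Used for cell values, for flux values and, with u i standing for the value
   at x_(i+1/2), for staggered values. *)
Definition slope (u : int -> R) (j : int) : R :=
  minmod3 (u (j + 1) - u j) (u j - u (j - 1))
          (Num.sg (u j - u (j - 1)) * (C * dx `^ delta)) / dx.

(* Limit of the partial sums over [-n, n]. *)
Definition zsum (u : int -> R) : R :=
  limn (fun n : nat => \sum_(0 <= i < n.*2.+1) u (i%:Z - n%:Z)).

(* The quadrature rule shared by R_j and R_(t,j): the summation index q is
   l + 1, ul and ur are the cell values in the left and right boundary terms. *)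
Definition quadrature (om : R -> R) (ul u ur : int -> R) (j : int) : R :=
  (if left_bounded om then
     dx / 2 * ul (j - N1 dx om) * om (dx / 4 - (N1 dx om)%:~R * dx)
   else 0)
  + dx * zsum (fun q : int =>
      if (left_bounded om ==> (- N1 dx om + 1 <= q)) &&
         (right_bounded om ==> (q <= N2 dx om - 1))
      then u (j + q) * om (q%:~R * dx) else 0)
  + (if right_bounded om then
       dx / 2 * ur (j + N2 dx om) * om ((N2 dx om)%:~R * dx - dx / 4)
     else 0).

Definition vec (n : nat) (u : 'I_n -> int -> R) (j : int) : 'rV[R]_n :=
  \row_k u k j.

Section Step.
Variable rho : 'I_N -> int -> R.

Definition Rlk (l : 'I_m) (k : 'I_N) : int -> R :=
  quadrature (w l k)
    (fun j => rho k j + dx / 4 * slope (rho k) j)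
    (rho k)
    (fun j => rho k j - dx / 4 * slope (rho k) j).

Definition Rn (l : 'I_m) (j : int) : R := \sum_k Rlk l k j.

Definition flux_slope (k : 'I_N) : int -> R :=
  slope (fun j => F k (rho k j) (vec Rn j)).

Definition Q (k : 'I_N) (j : int) : R :=
  S k (vec rho j) (vec Rn j) - flux_slope k j.

Definition Rtlk (l : 'I_m) (k : 'I_N) : int -> R :=
  quadrature (w l k) (Q k) (Q k) (Q k).

Definition rho_half (k : 'I_N) (j : int) : R := rho k j + dt / 2 * Q k j.

Definition R_half (l : 'I_m) (j : int) : R :=
  \sum_k (Rlk l k j + dt / 2 * Rtlk l k j).

(* rho_stag k j is the value at x_(j+1/2). *)
Definition rho_stag (k : 'I_N) (j : int) : R :=
  (rho k j + rho k (j + 1)) / 2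
  + dx / 8 * (slope (rho k) j - slope (rho k) (j + 1))
  - dt / dx * (F k (rho_half k (j + 1)) (vec R_half (j + 1))
               - F k (rho_half k j) (vec R_half j))
  + dt / 2 * (S k (vec rho_half (j + 1)) (vec R_half (j + 1))
              + S k (vec rho_half j) (vec R_half j)).

Definition NT_step (k : 'I_N) (j : int) : R :=
  (rho_stag k (j - 1) + rho_stag k j) / 2
  - dx / 8 * (slope (rho_stag k) j - slope (rho_stag k) (j - 1)).

End Step.

Variable rho0 : 'I_N -> R -> R.

Definition cell (j : int) : set R :=
  `[(j%:~R - 2^-1) * dx, (j%:~R + 2^-1) * dx[.

Definition rho_init (k : 'I_N) (j : int) : R :=
  dx^-1 * \int[@lebesgue_measure R]_(x in cell j) rho0 k x.

Definition NT (n : nat) : 'I_N -> int -> R := iter n NT_step rho_init.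

(* F k and S k are affine in the densities, so only the nonlocal terms can leave
   the range on which F k and S k are controlled. *)
Definition R_in_range (a b : R) (n : nat) : Prop :=
  forall j : int,
    in_box a b (vec (Rn (NT n)) j) /\ in_box a b (vec (R_half (NT n)) j).

Definition rho_Delta (nstar : nat) (k : 'I_N) (p : R * R) : R :=
  \sum_(j \in [set: int]) \sum_(0 <= n < nstar.+1)
    (NT n k j + slope (NT n k) j * (p.2 - j%:~R * dx))
    * \1_(cell j) p.2 * \1_(`[n%:R * dt, n.+1%:R * dt[%classic) p.1.

End Scheme.

Section WeakSolution.
Context {R : realType}.

Definition mu2 : {measure set (measurableTypeR R * measurableTypeR R) -> \bar R} :=
  [the measure _ _ of (@lebesgue_measure R \x @lebesgue_measure R)%E].

Definition strip (T : R) : set (R * R) := `]0, T[%classic `*` setT.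

Definition Linfty (T : R) (u : R * R -> R) : Prop :=
  measurable_fun (strip T) u /\
  exists M : R, {ae mu2, forall p, strip T p -> `|u p| <= M}.

Definition weak_star_cvg (T : R) (un : nat -> R * R -> R) (u : R * R -> R) : Prop :=
  forall g : R * R -> R, mu2.-integrable (strip T) (EFin \o g) ->
    (fun i => \int[mu2]_(p in strip T) (un i p * g p)) @ \oo -->
    \int[mu2]_(p in strip T) (u p * g p).

Definition dt_ (phi : R * R -> R) (p : R * R) : R :=
  derive1 (fun t : R => phi (t, p.2)) p.1.

Definition dx_ (phi : R * R -> R) (p : R * R) : R :=
  derive1 (fun x : R => phi (p.1, x)) p.2.

Definition C1_compact (T : R) (phi : R * R -> R) : Prop :=
  [/\ (forall p : R * R, derivable (fun t : R => phi (t, p.2)) p.1 1 /\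
                         derivable (fun x : R => phi (p.1, x)) p.2 1),
      continuous (dt_ phi), continuous (dx_ phi),
      compact (closure [set p | phi p != 0]) &
      closure [set p | phi p != 0] `<=` [set p | -42%:R < p.1 < T]].

Context {N m : nat}.
Variables (F : 'I_N -> R -> 'rV[R]_m -> R).
Variables (S : 'I_N -> 'rV[R]_N -> 'rV[R]_m -> R).
Variables (w : 'I_m -> 'I_N -> R -> R).

Definition nonlocal (rho : 'I_N -> R * R -> R) (p : R * R) : 'rV[R]_m :=
  \row_l \sum_k \int[@lebesgue_measure R]_y (w l k (y - p.2) * rho k (p.1, y)).

(* Integrability of the two nonlinear terms is required explicitly because the
   library integral is total. *)
Definition weak_solution (T : R) (rho0 : 'I_N -> R -> R)
    (rho : 'I_N -> R * R -> R) : Prop :=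
  (forall k, Linfty T (rho k)) /\
  forall (k : 'I_N) (phi : R * R -> R), C1_compact T phi ->
    let flux p := F k (rho k p) (nonlocal rho p) in
    let source p := S k (\row_i rho i p) (nonlocal rho p) in
    [/\ mu2.-integrable (strip T) (fun p => (flux p * dx_ phi p)%:E),
        mu2.-integrable (strip T) (fun p => (source p * phi p)%:E) &
        \int[@lebesgue_measure R]_x (rho0 k x * phi (0, x))
        + \int[mu2]_(p in strip T) (rho k p * dt_ phi p)
        + \int[mu2]_(p in strip T) (flux p * dx_ phi p)
        + \int[mu2]_(p in strip T) (source p * phi p) = 0].

End WeakSolution.

(* Main.v *)
(** The CFL condition makes the staggered update nearly monotone: with
    [a = lambda * LF] the new value differs from the average of its two
    neighbours by at most [(1/4 + a + a^2)] times their difference plus [K * dt],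
    and [a <= (sqrt 2 - 1) / 2] is exactly [1/4 + a + a^2 <= 1/2]. Hence one step
    widens the range of the densities by at most [K * dt], and over a short time
    the nonlocal terms stay in the region where the coefficients are Lipschitz.

    Tested against the indicator of an interval, one step changes the mass by
    [O(dt)]. A diagonal argument over rational times and intervals therefore gives
    a subsequence that converges weakly in [x] at every time [t]; the limit masses
    have a density that is jointly measurable in [(t, x)]. Since the nonlocal terms
    are convolutions, they converge pointwise. Flux and source are affine in the
    densities with coefficients that are Lipschitz functions of the nonlocal terms,
    so each product is one of a weakly and a strongly convergent sequence, and the
    discrete weak formulation passes to the limit. *)

Require Import Defs.
From HB Require Import structures.
From mathcomp Require Import all_boot all_order all_algebra.
From mathcomp Require Import all_classical all_reals all_analysis.
From mathcomp Require Import measurable_realfun zify ring lra.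

Set Implicit Arguments.
Unset Strict Implicit.
Unset Printing Implicit Defensive.

Import Order.TTheory GRing.Theory Num.Theory.
Import numFieldNormedType.Exports.

Local Open Scope classical_set_scope.
Local Open Scope ring_scope.

(** * Integrals of real functions *)

(** No bound on the variation of the approximations is derived, so products of densities could not
    be passed to the limit; linearity in the densities takes the place of strong compactness. Weak-*
    convergence in [(t, x)] alone would not suffice either: convolution with a kernel in [x] smooths
    in [x] only, so pointwise convergence of the nonlocal terms needs weak convergence in [x] at
    each fixed time. This is why masses of intervals are followed in time. Two features of the
    scheme enter. The cap [C * dx ^ delta] makes [dx] times a slope vanish uniformly, so slope
    terms, reconstruction and the shift of the half step all disappear in the limit. The lower bound
    [lam0 <= dt / dx] turns averaging errors of order [dx] per step into errors of order [dt], which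
    can be summed. The margin [eps] is spent as follows: a quarter on the quadrature error, a
    quarter on the widening [eta] of the range of the densities, and half on the passage to the half
    step. The time [Tstar] is chosen so that the range widens by at most [eta] until then. *)

Section RealIntegral.
Context d (X : measurableType d) (R : realType).
Variables (nu : {measure set X -> \bar R}) (D : set X).
Hypothesis mD : measurable D.
Implicit Types (f g u : X -> R).

Definition Rintegrable (f : X -> R) := nu.-integrable D (EFin \o f).

Lemma Rintegrable_measurable f : Rintegrable f -> measurable_fun D f.
Proof. by move=> /(measurable_int nu) /measurable_EFinP. Qed.

Lemma Rintegrable_le f g : measurable_fun D f ->
  (forall x, D x -> `|f x| <= g x) -> Rintegrable g -> Rintegrable f.
Proof.
move=> mf fg; apply: le_integrable => //; first exact/measurable_EFinP.
by move=> x Dx /=; rewrite lee_fin (le_trans (fg _ Dx))// ler_norm.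
Qed.

Lemma RintegrableM (B : R) u g : measurable_fun D u ->
  (forall x, D x -> `|u x| <= B) -> Rintegrable g ->
  Rintegrable (fun x => u x * g x).
Proof.
move=> mu uB ig; apply: (@Rintegrable_le _ (fun x => B * `|g x|)).
- by apply: measurable_funM => //; exact: Rintegrable_measurable.
- by move=> x Dx; rewrite normrM ler_wpM2r// uB.
- have := integrable_norm ig; move/(integrableZl mD B).
  by apply: eq_integrable => // x _ /=; rewrite EFinM.
Qed.

Lemma Rintegrable_norm f : Rintegrable f -> Rintegrable (fun x => `|f x|).
Proof. exact: integrable_norm. Qed.

Lemma RintegrableZ c f : Rintegrable f -> Rintegrable (fun x => c * f x).
Proof.
by move/(integrableZl mD c); apply: eq_integrable.
Qed.

Lemma RintegrableD f g : Rintegrable f -> Rintegrable g ->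
  Rintegrable (fun x => f x + g x).
Proof.
by move=> fi gi; have := integrableD mD fi gi; apply: eq_integrable.
Qed.

Lemma RintegrableB f g : Rintegrable f -> Rintegrable g ->
  Rintegrable (fun x => f x - g x).
Proof.
by move=> fi gi; have := integrableB mD fi gi; apply: eq_integrable.
Qed.

Lemma Rintegrable_sum I (s : seq I) (h : I -> X -> R) :
  (forall i, Rintegrable (h i)) -> Rintegrable (fun x => \sum_(i <- s) h i x).
Proof.
move=> hi; have := @integrable_sum _ _ _ nu D mD I s xpredT (fun i => EFin \o h i).
move/(_ (fun i _ => hi i)); apply: eq_integrable => // x _ /=.
by rewrite sumEFin.
Qed.

Lemma Rintegral_sum I (s : seq I) (h : I -> X -> R) :
  (forall i, Rintegrable (h i)) ->
  \int[nu]_(x in D) (\sum_(i <- s) h i x) =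
  \sum_(i <- s) \int[nu]_(x in D) h i x.
Proof.
move=> hi; elim: s => [|a s ih].
  under eq_Rintegral do rewrite big_nil.
  by rewrite big_nil Rintegral_cst// mul0r.
under eq_Rintegral do rewrite big_cons.
by rewrite big_cons RintegralD// ?ih//; [exact: hi|exact: Rintegrable_sum].
Qed.

Lemma Rintegral_norm_le f g : Rintegrable f -> Rintegrable g ->
  (forall x, D x -> `|f x| <= g x) ->
  `|\int[nu]_(x in D) f x| <= \int[nu]_(x in D) g x.
Proof.
move=> fi gi fg; apply: le_trans (le_normr_Rintegral mD fi) _.
by apply: le_Rintegral => //; exact: Rintegrable_norm.
Qed.

Lemma EFin_Rintegral f : Rintegrable f ->
  (\int[nu]_(x in D) f x)%:E = (\int[nu]_(x in D) (f x)%:E)%E.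
Proof. by move=> fi; rewrite /Rintegral fineK//; exact: integrable_fin_num. Qed.

(** Convergence and domination are only asked almost everywhere: sections on the strip and averages
    of the initial data behave well only outside a null set. *)
Lemma Rintegral_dominated_cvg (u : nat -> X -> R) (f g : X -> R) :
  (forall n, measurable_fun D (u n)) -> measurable_fun D f ->
  {ae nu, forall x, D x -> u^~ x @ \oo --> f x} -> Rintegrable g ->
  {ae nu, forall x, D x -> forall n, `|u n x| <= g x} ->
  (fun n => \int[nu]_(x in D) u n x) @ \oo --> \int[nu]_(x in D) f x.
Proof.
move=> mu mf uf ig ug.
have [||||fi _ cv] := @dominated_convergence _ _ _ nu D mD (fun n => EFin \o u n)
   (EFin \o f) (EFin \o g) _ _ _ ig.
- by move=> n; exact/measurable_EFinP.
- exact/measurable_EFinP.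
- by apply: filterS uf => x ufx Dx; apply: cvg_EFin; [exact: nearW|exact: ufx].
- by apply: filterS ug => x ugx n Dx /=; rewrite lee_fin ugx.
have fi' : Rintegrable f by [].
move: cv; rewrite -(EFin_Rintegral fi') => /fine_cvgP[_].
exact: cvg_trans.
Qed.

End RealIntegral.

Notation L1 f := (Rintegrable (@lebesgue_measure _) setT f).

Section LebesgueLine.
Context {R : realType}.
Local Notation mu := (@lebesgue_measure R).
Implicit Types (f g u : R -> R) (A : set R).

Let mshift (h : R) : measurable_fun [set: measurableTypeR R]
  (fun x : measurableTypeR R => (x + h : measurableTypeR R)).
Proof. by apply: measurable_funD => //; exact: measurable_cst. Qed.

(** The pushforward under the shift agrees with Lebesgue measure on half-open intervals, and such a
    measure is unique. *)
Lemma lebesgue_measure_shift (h : R) A : measurable A ->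
  mu A = mu ((fun x => x + h) @^-1` A).
Proof.
move=> mA.
pose nu := measure_function_pushforward__canonical__measure_function_Measure
  mu (mshift h).
suff /(_ A mA) : forall B, measurable B -> mu B = nu B by [].
apply: lebesgue_measure_unique => _ [[a b] _ <-] /=.
rewrite /pushforward.
have -> : (fun x => x + h) @^-1` [set` `]a, b]] = [set` `]a - h, b - h]].
  by apply/seteqP; split => x /=; rewrite !in_itv/= ltrBlDr lerBrDr.
rewrite !lebesgue_measure_itv/= !lte_fin ltrD2r.
by case: ifP => // _; rewrite -!EFinB; congr EFin; ring.
Qed.

Lemma Rintegrable_shift f h : L1 f -> L1 (fun x => f (x + h)).
Proof.
move=> /integrableP[mf fi]; apply/integrableP; split.
  exact: (measurableT_comp mf (mshift h)).
rewrite -(@ge0_integral_pushforward _ _ _ _ R _ (mshift h) mu setT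
  (fun y => `|(f y)%:E|)%E)//; last first.
  exact: measurableT_comp.
rewrite (@eq_measure_integral _ _ _ setT mu)// => A mA _.
by rewrite /= /pushforward -lebesgue_measure_shift.
Qed.

Lemma Rintegral_shift f h : L1 f ->
  \int[mu]_x f (x + h) = \int[mu]_x f x.
Proof.
move=> fi; rewrite /Rintegral; congr fine.
have /integrableP[mf _] := fi.
have := @integral_pushforward _ _ _ _ R _ (mshift h) mu setT (EFin \o f) mf.
rewrite preimage_setT => /(_ (Rintegrable_shift h fi) measurableT) /= <-.
apply: eq_measure_integral => A mA _.
by rewrite /= /pushforward -lebesgue_measure_shift.
Qed.

Lemma L1_measurable f : L1 f -> measurable_fun setT f.
Proof. exact: Rintegrable_measurable. Qed.

Lemma L1_le f g : measurable_fun setT f -> (forall x, `|f x| <= g x) ->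
  L1 g -> L1 f.
Proof. by move=> mf fg; apply: Rintegrable_le => // x _; exact: fg. Qed.

Lemma L1_M (B : R) u g : measurable_fun setT u -> (forall x, `|u x| <= B) ->
  L1 g -> L1 (fun x => u x * g x).
Proof. by move=> mu_ uB; apply: (@RintegrableM _ _ _ _ _ _ B). Qed.

Lemma L1_norm f : L1 f -> L1 (fun x => `|f x|).
Proof. exact: Rintegrable_norm. Qed.

Lemma L1_Z c f : L1 f -> L1 (fun x => c * f x).
Proof. exact: RintegrableZ. Qed.

Lemma L1_D f g : L1 f -> L1 g -> L1 (fun x => f x + g x).
Proof. exact: RintegrableD. Qed.

Lemma L1_B f g : L1 f -> L1 g -> L1 (fun x => f x - g x).
Proof. exact: RintegrableB. Qed.

Lemma L1_norm_le f g : L1 f -> L1 g -> (forall x, `|f x| <= g x) ->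
  `|\int[mu]_x f x| <= \int[mu]_x g x.
Proof. by move=> fi gi fg; apply: Rintegral_norm_le. Qed.

Lemma L1_dominated_cvg (u : nat -> R -> R) f g :
  (forall n, measurable_fun setT (u n)) -> measurable_fun setT f ->
  (forall x, u^~ x @ \oo --> f x) -> L1 g ->
  (forall n x, `|u n x| <= g x) ->
  (fun n => \int[mu]_x u n x) @ \oo --> \int[mu]_x f x.
Proof.
move=> mu_ mf uf gi ug.
apply: (@Rintegral_dominated_cvg _ _ _ mu setT measurableT u f g) => //.
  by apply: aeW => x _; exact: uf.
by apply: aeW => x _ n; exact: ug.
Qed.

Lemma Rintegrable_itv (a b : R) : L1 (\1_`]a, b] : R -> R).
Proof. exact: integrable_indic_itv. Qed.

Lemma Rintegral_indic_bnd (b0 b1 : bool) (a b : R) : a <= b ->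
  \int[mu]_x (\1_[set` Interval (BSide b0 a) (BSide b1 b)] : R -> R) x = b - a.
Proof.
move=> ab; rewrite /Rintegral integral_indic// setIT.
transitivity (fine (mu [set` Interval (BSide b0 a) (BSide b1 b)])) => //.
rewrite lebesgue_measure_itv/= lte_fin.
case: ltP => // ba; rewrite /= (@le_anti _ _ a b) ?subrr// ab.
by rewrite (le_trans ba).
Qed.

Lemma Rintegral_indic_itv (a b : R) : a <= b ->
  \int[mu]_x (\1_`]a, b] : R -> R) x = b - a.
Proof. exact: Rintegral_indic_bnd. Qed.

End LebesgueLine.

(** * Weak limits of bounded functions on the line *)

Section WeakNull.
Context {R : realType}.
Local Notation mu := (@lebesgue_measure R).
Variables (v : nat -> R -> R) (B : R).
Hypothesis mv : forall n, measurable_fun setT (v n).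
Hypothesis vB : forall n x, `|v n x| <= B.
Implicit Types (g : R -> R) (A : set R).

(** [v] stands for the difference between an approximation and its limit, so 0 is the only limit to
    be considered. *)
Definition weakly_null g := (fun n => \int[mu]_x (v n x * g x)) @ \oo --> (0 : R).

Let vi n g : L1 g -> L1 (fun x => v n x * g x).
Proof. move=> gi; apply: (@RintegrableM _ _ _ _ _ _ B) => //; exact: mv. Qed.

Lemma weakly_nullD g1 g2 : L1 g1 -> L1 g2 -> weakly_null g1 -> weakly_null g2 ->
  weakly_null (fun x => g1 x + g2 x).
Proof.
move=> i1 i2 z1 z2; rewrite /weakly_null.
under eq_fun => n.
  under eq_Rintegral do rewrite mulrDr.
  rewrite RintegralD; [|by []|exact: vi|exact: vi].
  over.
by rewrite -[0]addr0; exact: cvgD.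
Qed.

Lemma weakly_nullZ c g : L1 g -> weakly_null g -> weakly_null (fun x => c * g x).
Proof.
move=> i1 z1; rewrite /weakly_null.
under eq_fun => n.
  under eq_Rintegral do rewrite mulrCA.
  rewrite RintegralZl; [|by []|exact: vi].
  over.
by rewrite -(mulr0 c); apply: cvgM => //; exact: cvg_cst.
Qed.

(** The bound [B] makes the integral against [v n] continuous in L1, uniformly in [n]; good test
    functions therefore form a closed set. The [B + 1] in the tolerance covers [B = 0]. *)
Lemma weakly_null_approx g : L1 g ->
  (forall e, 0 < e -> exists2 g', L1 g' /\ weakly_null g' &
     \int[mu]_x `|g x - g' x| <= e) -> weakly_null g.
Proof.
move=> gi ap; apply/cvgrPdist_le => e e0.
have B0 : 0 <= B by rewrite (le_trans _ (vB 0 0)).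
have B1 : 0 < 2 * (B + 1) by rewrite mulr_gt0// ltr_wpDl.
have [g' [g'i zg'] gg'] := ap (e / (2 * (B + 1))) (divr_gt0 e0 B1).
move/cvgrPdist_le: zg' => /(_ (e / 2)); rewrite divr_gt0// => /(_ isT).
apply: filterS => n; rewrite !sub0r !normrN => h.
have -> : \int[mu]_x (v n x * g x) =
   \int[mu]_x (v n x * g' x) + \int[mu]_x (v n x * (g x - g' x)).
  rewrite -RintegralD//; [|exact: vi|exact/vi/RintegrableB].
  by apply: eq_Rintegral => x _; ring.
have gg'i : L1 (fun x => g x - g' x) by exact: RintegrableB.
rewrite (le_trans (ler_normD _ _))// (splitr e) lerD//.
apply: le_trans (_ : B * (e / (2 * (B + 1))) <= _); last first.
  have -> : B * (e / (2 * (B + 1))) = e / 2 * (B / (B + 1)).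
    by field; rewrite gt_eqF// ltr_wpDl.
  rewrite ler_piMr ?divr_ge0 ?(ltW e0)//.
  by rewrite ler_pdivrMr ?ltr_wpDl// mul1r lerDl.
apply: le_trans (_ : B * \int[mu]_x `|g x - g' x| <= _); last first.
  by rewrite ler_wpM2l.
rewrite -RintegralZl//; last exact: Rintegrable_norm.
apply: Rintegral_norm_le => //; first exact: vi.
- exact/RintegrableZ/Rintegrable_norm.
- by move=> x _; rewrite normrM ler_wpM2r.
Qed.

Hypothesis v_itv : forall a b, a <= b -> weakly_null (\1_`]a, b] : R -> R).

Let wsubi A (M : nat) : measurable A -> L1 (\1_(A `&` `]- M%:R, M%:R]) : R -> R).
Proof.
move=> mA; apply: (Rintegrable_le _ _ _ (Rintegrable_itv (- M%:R) M%:R)) => //.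
  by apply: measurable_indic; exact: measurableI.
move=> x _; rewrite ger0_norm//; rewrite !indicE ler_nat in_setI.
by case: (x \in A).
Qed.

(** For a fixed bounded window the sets [A] with this property form a Dynkin system, complements
    being taken inside the window. It contains the open rays, which are stable under intersection
    and generate the Borel sets. *)
Let weakly_null_bounded A (M : nat) : measurable A ->
  weakly_null (\1_(A `&` `]- M%:R, M%:R]) : R -> R).
Proof.
move=> mA; have NM : (- M%:R <= M%:R :> R) by rewrite ge0_cp.
have mG := RGenOInfty.measurableE R.
pose P (A : set R) := weakly_null (\1_(A `&` `]- M%:R, M%:R]) : R -> R).
move: A mA; suff h : forall A, <<s @RGenOInfty.G R >> A -> P A.
  by move=> A mA; apply: h; exact: (eq_ind _ (fun F => F A) mA _ mG).
apply: (@dynkin_induction _ (measurableTypeR R) (@RGenOInfty.G R) P) => //; rewrite /P.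
- move=> _ _ [x ->] [y ->]; exists (Num.max x y).
  by apply/seteqP; split => z /=; rewrite !in_itv/= !andbT gt_max => /andP.
- by rewrite setTI; apply: v_itv; rewrite ge0_cp ?ler0n.
- move=> _ [x ->].
  have [xM|Mx] := leP x M%:R; last first.
    rewrite (_ : _ `&` _ = set0) ?indic0; last first.
      apply/seteqP; split => z //=; rewrite !in_itv/= andbT => -[xz /andP[_ zM]].
      by have := lt_le_trans (lt_trans Mx xz) zM; rewrite ltxx.
    rewrite /weakly_null; under eq_fun => n.
      under eq_Rintegral do rewrite mulr0.
      rewrite Rintegral_cst// mul0r; over.
    exact: cvg_cst.
  rewrite (_ : _ `&` _ = [set` `]Num.max x (- M%:R), M%:R]]).
    by apply: v_itv; rewrite ge_max xM NM.
  apply/seteqP; split => z /=; rewrite !in_itv/= gt_max andbT.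
    by move=> [-> /andP[-> ->]].
  by move=> /andP[/andP[-> ->] ->].
- move=> S mS zS.
  rewrite (_ : \1__ = fun x => \1_`]- M%:R, M%:R] x + (-1) * \1_(S `&` `]- M%:R, M%:R]) x).
    apply: weakly_nullD => //; [exact: Rintegrable_itv| |exact: v_itv|].
      exact/RintegrableZ/wsubi.
    by apply: weakly_nullZ => //; exact: wsubi.
  apply/funext => x; rewrite !indicE !in_setI in_setC.
  by case: (x \in S); case: (_ \in _) => /=; ring.
- move=> S mS tS zS.
  pose U n := \bigcup_(k in `I_n) S k.
  have mU n : measurable (U n) by apply: bigcup_measurable.
  have mUU : measurable (\bigcup_k S k) by apply: bigcupT_measurable.
  have zU n : weakly_null (\1_(U n `&` `]- M%:R, M%:R]) : R -> R).
    elim: n => [|n ih].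
      rewrite /U (_ : `I_0 = set0); last by apply/seteqP; split.
      rewrite bigcup_set0 set0I indic0 /weakly_null; under eq_fun => n.
        under eq_Rintegral do rewrite mulr0.
        rewrite Rintegral_cst// mul0r; over.
      exact: cvg_cst.
    rewrite (_ : \1__ = fun x => \1_(U n `&` `]- M%:R, M%:R]) x +
                             \1_(S n `&` `]- M%:R, M%:R]) x).
      by apply: weakly_nullD; [exact: (wsubi _ (mU n))|exact: (wsubi _ (mS n))|exact: ih|exact: zS].
    have -> : U n.+1 = U n `|` S n.
      by rewrite /U IIS bigcup_setU bigcup_set1.
    apply/funext => x; rewrite !indicE !in_setI in_setU.
    have : x \in U n -> x \in S n -> False.
      rewrite !inE => -[k /= kn Skx] Snx.
      move/trivIsetP: tS => /(_ k n Logic.I Logic.I).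
      rewrite (ltn_eqF kn) => /(_ isT) /seteqP[+ _] => /(_ x); exact.
    case: (x \in U n); case: (x \in S n); case: (_ \in _) => //= h; try ring.
    by have := h isT isT.
  (* The finite subunions are good by additivity, and they approximate the union in L1 by dominated
     convergence on the window. *)
  apply: weakly_null_approx => [|e e0]; first exact: (wsubi _ mUU).
  pose u n (x : R) := `|\1_(\bigcup_k S k `&` `]- M%:R, M%:R]) x -
             \1_(U n `&` `]- M%:R, M%:R]) x| : R.
  have : (fun n => \int[mu]_x u n x) @ \oo --> \int[mu]_x (cst 0 x : R).
    apply: (@Rintegral_dominated_cvg _ _ _ mu setT measurableT u (cst 0)
      (\1_`]- M%:R, M%:R])) => //; rewrite /u.
    + move=> n; apply: measurableT_comp => //; apply: measurable_funB.
        by apply: measurable_indic; exact: measurableI.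
      by apply: measurable_indic; exact: measurableI.
    + apply: aeW => x _; have [[k _ Skx]|nS] := pselect ((\bigcup_k S k) x).
        apply: cvg_near_cst; exists k.+1 => // n /= kn.
        rewrite !indicE !in_setI (_ : x \in \bigcup_k S k); last first.
          by rewrite inE; exists k.
        rewrite (_ : x \in U n); last by rewrite inE; exists k.
        by rewrite subrr normr0.
      apply: cvg_near_cst; apply: nearW => n.
      rewrite !indicE !in_setI (_ : x \in \bigcup_k S k = false); last first.
        by apply/negbTE/negP; rewrite inE.
      rewrite (_ : x \in U n = false); last first.
        by apply/negbTE/negP; rewrite inE => -[k _ Skx]; apply: nS; exists k.
      by rewrite subrr normr0.
    + exact: Rintegrable_itv.
    + apply: aeW => x _ n; rewrite !indicE !in_setI.
      by do 3 case: (_ \in _); rewrite /= ?subr0 ?sub0r ?subrr ?normrN ?normr1 ?normr0.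
  rewrite Rintegral_cst// mul0r => /cvgrPdist_le /(_ e e0)[n _ /(_ n (leqnn n))].
  rewrite sub0r normrN => h.
  exists (\1_(U n `&` `]- M%:R, M%:R])); first by split; [exact: (wsubi _ (mU n))|exact: zU].
  exact: le_trans (ler_norm _) h.
Qed.

Let wind (M : nat) : R -> R := \1_`]- M%:R, M%:R].

Let weakly_null_trunc g : L1 g ->
  (forall M, weakly_null (fun x => g x * wind M x)) -> weakly_null g.
Proof.
move=> gi h.
have wi M : L1 (fun x => g x * wind M x).
  apply: L1_le (L1_norm gi).
    by apply: measurable_funM; [exact: (L1_measurable gi)|exact: measurable_indic].
  move=> x; rewrite normrM ler_piMr// /wind indicE.
  by case: (_ \in _); rewrite ?normr1 ?normr0.
apply: weakly_null_approx => // e e0.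
pose u (M : nat) (x : R) := `|g x - g x * wind M x| : R.
have : (fun n => \int[mu]_x u n x) @ \oo --> \int[mu]_x (cst 0 x : R).
  apply: (@L1_dominated_cvg _ u (cst 0) (fun x => `|g x|)) => //; rewrite /u.
  - move=> n; apply: measurableT_comp => //.
    apply: measurable_funB; first exact: (L1_measurable gi).
    exact: (L1_measurable (wi n)).
  - move=> x; apply: cvg_near_cst.
    exists (Num.bound x) => // n /= xn.
    have xn' : `|x| < n%:R.
      apply: lt_le_trans (truncnS_gt `|x|) _.
      by rewrite ler_nat.
    have : wind n x = 1.
      rewrite /wind indicE mem_set//= in_itv/=.
      by move: xn'; rewrite ltr_norml => /andP[-> /ltW ->].
    by move=> ->; rewrite mulr1 subrr normr0.
  - exact: L1_norm.
  - move=> n x; rewrite normr_id /wind indicE.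
    by case: (_ \in _); rewrite ?mulr1 ?mulr0 ?subrr ?subr0 ?normr0.
rewrite Rintegral_cst// mul0r => /cvgrPdist_le /(_ e e0)[n _ /(_ n (leqnn n))].
rewrite sub0r normrN => hn; exists (fun x => g x * wind n x); first by split.
exact: le_trans (ler_norm _) hn.
Qed.

Lemma weakly_null_sum (s : seq R) (h : R -> R -> R) : (forall y, L1 (h y)) ->
  (forall y, weakly_null (h y)) -> weakly_null (fun x => \sum_(y <- s) h y x).
Proof.
move=> hi hz; elim: s => [|y s ih].
  rewrite /weakly_null; under eq_fun => n.
    under eq_Rintegral do rewrite big_nil mulr0.
    rewrite Rintegral_cst// mul0r; over.
  exact: cvg_cst.
rewrite (_ : (fun x => _) = fun x => h y x + \sum_(y <- s) h y x); last first.
  by apply/funext => x; rewrite big_cons.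
apply: weakly_nullD => //; exact: Rintegrable_sum.
Qed.

Import HBSimple.

(** Simple functions are dense in L1. They are first truncated to bounded windows, because the level
    set of the value 0 has infinite measure and sets are only treated inside a window. *)
Theorem weakly_null_L1 g : L1 g -> weakly_null g.
Proof.
move=> gi.
have [h [hi _ hg]] := approximation_sfun_integrable measurableT gi.
apply: weakly_null_approx => // e e0.
have hiR n : L1 (h n) by exact: hi.
have hgi n : L1 (fun x => `|g x - h n x|) by apply/L1_norm/L1_B.
have : (fun n => \int[mu]_x `|g x - h n x|) @ \oo --> 0.
  by have /fine_cvgP[_] := hg; exact: cvg_trans.
move=> /cvgrPdist_le /(_ e e0)[n _ /(_ n (leqnn n))].
rewrite sub0r normrN => hn; exists (h n); last exact: le_trans (ler_norm _) hn.
split => //; apply: weakly_null_trunc => // M.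
pose s := finmap.enum_fset (fset_set (range (h n))).
have -> : (fun x => h n x * wind M x) =
  fun x => \sum_(y <- s) (y * \1_(h n @^-1` [set y] `&` `]- M%:R, M%:R]) x).
  apply/funext => x; rewrite fimfunE fsbig_finite//= mulr_suml.
  apply: eq_bigr => y _; rewrite -mulrA; congr (_ * _).
  by rewrite /wind !indicE in_setI -natrM mulnb.
have mh y : measurable (h n @^-1` [set y]) by exact: measurable_funPTI.
apply: weakly_null_sum => y; first exact: (L1_Z _ (wsubi _ (mh y))).
by apply: weakly_nullZ; [exact: (wsubi _ (mh y))|exact: (weakly_null_bounded _ (mh y))].
Qed.

End WeakNull.

Section Diagonal.
Context {R : realType}.

(** The sequences [a i] lie in the product of the segments [[- M p, M p]], which is compact by
    Tychonoff, and so have a cluster point [L]. The subsequence follows [L] within [1 / (n + 1)] on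
    the coordinates up to [n]. *)
Lemma diagonal_subsequence (a : nat -> nat -> R) (M : nat -> R) :
  (forall i p, `|a i p| <= M p) ->
  exists2 sub, increasing_seq sub & forall p, cvgn (fun i => a (sub i) p).
Proof.
move=> aM.
pose T := prod_topology (fun _ : nat => R).
pose K : set T := [set f | forall p, (`[- M p, M p]%classic : set R) (f p)].
have cK : compact K.
  apply: (@tychonoff nat (fun _ => R) (fun p => `[- M p, M p]%classic)) => p.
  exact: segment_compact.
pose F : set_system T := (fun i => (a i : T)) @ \oo.
have FF : ProperFilter F by exact: fmap_proper_filter.
have FK : F K by exists 0%N => // i _ p /=; rewrite in_itv/= -ler_norml.
have [L [_ LF]] := cK F FF FK.
have FL : Filter (nbhs (L : T)) by exact: nbhs_filter.
have H n n0 : exists i, (n0 <= i)%N /\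
    forall p, (p <= n)%N -> `|a i p - L p| < n.+1%:R^-1.
  have nbL : nbhs L [set f : T | forall p, (p <= n)%N -> `|f p - L p| < n.+1%:R^-1].
    have hL : \forall f \near nbhs L, forall p : 'I_n.+1, `|(f : T) p - L p| < n.+1%:R^-1.
      apply: (@filter_forall T 'I_n.+1
        (fun p f => `|(f : T) p - L p| < n.+1%:R^-1) (nbhs L) _) => p.
      have pL : (fun f : T => (f p : R)) @ nbhs L --> (L p : R).
        exact: (@proj_continuous nat (fun _ => R) p L).
      have n0' : 0 < n.+1%:R^-1 :> R by rewrite invr_gt0.
      have hp := (@cvgrPdist_lt _ _ _ (nbhs L) _ _ _).1 pL _ n0'.
      apply: (@filterS T (nbhs L) FL _ _ _ (hp FL)) => f /=.
      by rewrite distrC.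
    apply: (@filterS T (nbhs L) FL _ _ _ hL) => f h p pn; exact: (h (Ordinal (pn : (p < n.+1)%N))).
  have Fn0 : F [set f | exists2 i, (n0 <= i)%N & f = a i].
    by exists n0 => // i /= ni; exists i.
  have [f [[i n0i ->] h]] := LF _ _ Fn0 nbL.
  by exists i.
have [g hg] := choice (fun q : nat * nat => H q.1 q.2).
(* Each search starts beyond the previous index, which makes [sub] strictly increasing. *)
pose sub := fix sub n := if n is n'.+1 then g (n, (sub n').+1) else g (0%N, 0%N).
have subE n : exists n0, sub n = g (n, n0).
  by case: n => [|n]; [exists 0%N|exists (sub n).+1].
exists sub.
  apply/increasing_seqP => n; rewrite ltEnat /=.
  by have [] := hg (n.+1, (sub n).+1).
move=> p; apply/cvg_ex; exists (L p); apply/cvgrPdist_lt => e e0.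
near=> n.
have [n0 ->] := subE n; rewrite distrC.
have [_ /= /(_ p) h] := hg (n, n0).
apply: lt_trans (h _) _.
  by near: n; exists p.
by near: n; exact: near_infty_natSinv_lt (PosNum e0).
Unshelve. all: by end_near. Qed.

End Diagonal.

Section IntervalsAndSequences.
Context {R : realType}.

Lemma indic_ocE (a b x : R) : (\1_`]a, b] : R -> R) x = ((a < x <= b)%R : bool)%:R.
Proof.
rewrite indicE; congr (_%:R); congr nat_of_bool.
by apply/idP/idP; rewrite inE/= in_itv.
Qed.

Lemma indic_oc_split (a b c x : R) : a <= b -> b <= c ->
  (\1_`]a, c] : R -> R) x =
  (\1_`]a, b] : R -> R) x + (\1_`]b, c] : R -> R) x.
Proof.
move=> ab bc; rewrite !indic_ocE.
have [xb|bx] := leP x b.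
  by rewrite (le_trans xb bc) /= addr0.
by rewrite (le_lt_trans ab bx) andbF /= add0r.
Qed.

Lemma seq_unique (x : nat -> R) (a b : R) : x @ \oo --> a -> x @ \oo --> b -> a = b.
Proof. by move=> xa xb; rewrite -(cvg_lim _ xa)// -(cvg_lim _ xb). Qed.

Lemma seq_norm_le (x : nat -> R) (l c : R) : x @ \oo --> l ->
  (forall n, `|x n| <= c) -> `|l| <= c.
Proof.
by move=> xl xc; apply: (cvgr_to_le (cvg_norm xl)); exact: nearW.
Qed.

Lemma lipschitz_continuous_line (f : R -> R) (K : R) :
  (forall x y, x <= y -> `|f y - f x| <= K * (y - x)) -> continuous f.
Proof.
move=> fK x; apply/cvgrPdist_le => e e0.
have K0 : 0 <= K.
  by have := le_trans (normr_ge0 _) (fK 0 1 ler01); rewrite subr0 mulr1.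
have K1 : 0 < K + 1 by rewrite ltr_wpDl.
near=> y.
have : `|x - y| <= e / (K + 1).
  by near: y; apply: cvgr_dist_le; [exact: cvg_id|exact: divr_gt0].
rewrite ler_pdivlMr// => h.
apply: le_trans h; rewrite mulrC mulrDl.
apply: le_trans (_ : K * `|x - y| <= _); last by rewrite lerDl mul1r.
have [xy|/ltW yx] := leP x y.
  by rewrite distrC (distrC x) (ger0_norm (_ : 0 <= y - x)) ?subr_ge0// fK.
by rewrite (ger0_norm (_ : 0 <= x - y)) ?subr_ge0// fK.
Unshelve. all: by end_near. Qed.

Lemma Rintegral_mul_indic (f : R -> R) (A : set R) :
  \int[@lebesgue_measure R]_x (f x * \1_A x) = \int[@lebesgue_measure R]_(x in A) f x.
Proof.
rewrite [RHS]Rintegral_mkcond; apply: eq_Rintegral => x _.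
by rewrite patchE indicE; case: ifPn; rewrite ?mulr1 ?mulr0.
Qed.

Lemma derivable_quotient_cvg (f : R -> R) (x : R) (h : nat -> R) :
  derivable f x 1 -> h @ \oo --> (0 : R) -> (forall n, h n != 0) ->
  (fun n => (h n)^-1 * (f (x + h n) - f x)) @ \oo --> derive1 f x.
Proof.
move=> df h0 hn0; rewrite derive1E.
have hc : h @ \oo --> (0 : R)^'.
  by move=> P /h0[k _ hk]; exists k => // n kn; exact: (hk n kn (hn0 n)).
have := cvg_comp _ _ hc df.
apply: cvg_trans; apply: near_eq_cvg; apply: nearW => n /=.
by rewrite [h n *: 1]mulr1 (addrC x).
Qed.

Lemma near_cvg_to (x y : nat -> R) (l : R) : (\forall n \near \oo, x n = y n) ->
  x @ \oo --> l -> y @ \oo --> l.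
Proof. by move=> xy; apply: cvg_trans; exact: near_eq_cvg. Qed.

Lemma cvg_natSinv : (fun n => n.+1%:R^-1 : R) @ \oo --> (0 : R).
Proof. exact: cvg_harmonic. Qed.

End IntervalsAndSequences.

(** * Densities of weak limits of bounded functions *)

Section WeakLimitDensity.
Context {R : realType}.
Local Notation mu := (@lebesgue_measure R).
Variables (u : nat -> R -> R) (B : R) (nu : R -> R -> R).
Hypothesis B0 : 0 < B.
Hypothesis mu_ : forall n, measurable_fun setT (u n).
Hypothesis uB : forall n x, `|u n x| <= B.
Hypothesis u_nu : forall a b, a <= b ->
  (fun n => \int[mu]_x (u n x * \1_`]a, b] x)) @ \oo --> nu a b.

Let ui n a b : L1 (fun x => u n x * \1_`]a, b] x).
Proof. by apply: (@L1_M _ B) => //; exact: Rintegrable_itv. Qed.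

(** The uniform bound survives in the limit. The whole construction of a density rests on it: masses
    are Lipschitz in the endpoints, with constant [B]. *)
Lemma weak_mass_bound a b : a <= b -> `|nu a b| <= B * (b - a).
Proof.
move=> ab; apply: (seq_norm_le (u_nu ab)) => n.
rewrite -Rintegral_indic_itv// -RintegralZl//; last exact: Rintegrable_itv.
apply: L1_norm_le; [exact: ui|exact/L1_Z/Rintegrable_itv|].
by move=> x; rewrite normrM (ger0_norm (_ : 0 <= \1__ x))// ler_wpM2r.
Qed.

Lemma weak_mass_add a b c : a <= b -> b <= c -> nu a c = nu a b + nu b c.
Proof.
move=> ab bc; apply: (seq_unique (u_nu (le_trans ab bc))).
rewrite (_ : (fun n => _) = fun n => \int[mu]_x (u n x * \1_`]a, b] x) +
  \int[mu]_x (u n x * \1_`]b, c] x)); first exact: (cvgD (u_nu ab) (u_nu bc)).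
apply/funext => n /=; rewrite -RintegralD//; [|exact: ui|exact: ui].
by apply: eq_Rintegral => x _; rewrite (indic_oc_split _ ab bc) mulrDr.
Qed.

Section Window.
Variables (c d : R).
Hypothesis cd : c <= d.

(** Clamping to [[c, d]] makes [U] a distribution function on the whole line that is constant
    outside the window. The term [B * (cl x - c)] compensates possibly negative masses, so that [U]
    is nondecreasing; it is subtracted again from the density. *)
Let cl (x : R) : R := Num.min (Num.max x c) d.
Let U (x : R) : R := nu c (cl x) + B * (cl x - c).
(* [U] and [U2] are both nondecreasing and add up to [2 * B * x], so the Stieltjes
   measure of [U] is dominated by Lebesgue measure. *)
Let U2 (x : R) : R := 2 * B * x - U x.

Let cl_ge x : c <= cl x.
Proof. by rewrite /cl le_min cd andbT le_max lexx orbT. Qed.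

Let cl_mono x y : x <= y -> cl x <= cl y.
Proof.
move=> xy; rewrite /cl le_min !ge_min lexx orbT andbT.
apply/orP; left; rewrite ge_max le_max xy/=.
by rewrite le_max lexx orbT.
Qed.

Let cl_lip x y : x <= y -> cl y - cl x <= y - x.
Proof.
move=> xy; rewrite /cl /Num.min /Num.max.
case: (ltP x c) => ?; case: (ltP y c) => ?; case: ltP => ?; case: ltP => ?; lra.
Qed.

Let UB x y : x <= y -> 0 <= U y - U x <= 2 * B * (y - x).
Proof.
move=> xy; rewrite /U (weak_mass_add (cl_ge x) (cl_mono xy)).
have := weak_mass_bound (cl_mono xy); have := cl_lip xy.
rewrite ler_norml => h /andP[h1 h2].
have h3 : B * (cl y - cl x) <= B * (y - x) by rewrite ler_pM2l.
by apply/andP; split; nra.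
Qed.

Let ndU : nondecreasing U.
Proof. by move=> x y /UB/andP[+ _]; rewrite subr_ge0. Qed.

Let ndU2 : nondecreasing U2.
Proof. by move=> x y /UB/andP[_]; rewrite /U2; lra. Qed.

Let rcU : right_continuous U.
Proof.
apply: right_continuousW; apply: (@lipschitz_continuous_line _ _ (2 * B)).
by move=> x y /UB/andP[h1 h2]; rewrite ger0_norm.
Qed.

Let rcU2 : right_continuous U2.
Proof.
apply: right_continuousW; apply: (@lipschitz_continuous_line _ _ (2 * B)).
by move=> x y /UB/andP[h1 h2]; rewrite /U2 ger0_norm; lra.
Qed.

Let cU : cumulative R R := HB.pack U (isCumulative.Build R _ R U ndU rcU).
Let cU2 : cumulative R R := HB.pack U2 (isCumulative.Build R _ R U2 ndU2 rcU2).

Let LS_oc (f : cumulative R R) (x y : R) : x <= y ->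
  lebesgue_stieltjes_measure f [set` `]x, y]] = (f y - f x)%:E.
Proof.
move=> xy; rewrite /lebesgue_stieltjes_measure/= /measure_extension/=.
rewrite measurable_mu_extE//; last exact: is_ocitv.
transitivity (wlength f [set` `]x, y]]) => //.
rewrite wlength_itv/= lte_fin; case: ltP => // yx.
by rewrite (@le_anti _ _ x y) ?subrr// xy.
Qed.

(** Divided by [2 * B], the sum of the Stieltjes measures of [U] and [U2] is Lebesgue measure,
    because it is so on half-open intervals. A Lebesgue null set is thus null for each of them. *)
Let LSdom : lebesgue_stieltjes_measure cU `<< mu.
Proof.
apply/null_content_dominatesP => A mA muA0.
have B2 : 0 <= (2 * B)^-1 by rewrite invr_ge0 mulr_ge0// ltW.
pose m : {measure set (measurableTypeR R) -> \bar R} :=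
  [the measure _ _ of mscale (NngNum B2)
   [the measure _ _ of measure_add (lebesgue_stieltjes_measure cU)
     (lebesgue_stieltjes_measure cU2)]].
have mE D : m D = ((2 * B)^-1%:E * (lebesgue_stieltjes_measure cU D +
    lebesgue_stieltjes_measure cU2 D))%E.
  by rewrite -(measure_addE (lebesgue_stieltjes_measure cU)).
have h : forall A, measurable A -> mu A = m A.
  apply: lebesgue_measure_unique => _ [[x y] _ <-] /=.
  rewrite mE.
  have [xy|yx] := leP x y; last by rewrite set_itv_ge ?measure0 ?adde0 ?mule0//= bnd_simp -leNgt ltW.
  rewrite !LS_oc//= lebesgue_measure_itv/= -EFinD -EFinM.
  rewrite lte_fin; have -> : (2 * B)^-1 * (U y - U x + (U2 y - U2 x)) = y - x.
    by rewrite /U2; field; rewrite gt_eqF.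
  by case: ltP => // yx; rewrite (@le_anti _ _ x y) ?subrr// xy.
have : m A = 0%E by rewrite -h.
rewrite mE => /eqP.
rewrite mule_eq0 => /orP[|/eqP h0].
  by rewrite eqe invr_eq0 mulf_eq0 pnatr_eq0/= gt_eqF.
apply/eqP; rewrite eq_le measure_ge0 andbT -h0.
by rewrite leeDl// measure_ge0.
Qed.

(** Radon-Nikodym, applied to the restriction to []c, d]], where the total mass is finite. *)
Let window_density : exists g : R -> R, L1 g /\
  forall x y, c <= x -> x <= y -> y <= d ->
    \int[mu]_(t in [set` `]x, y]]) g t = U y - U x.
Proof.
pose LS := lebesgue_stieltjes_measure cU.
pose W : set (measurableTypeR R) := [set` `]c, d]].
have mW : measurable W by exact: measurable_itv.
have Woo : (LS W < +oo)%E by rewrite /LS /W LS_oc ?ltry.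
pose nu' := mfrestr mW Woo.
have nu'mu : nu' `<< mu.
  apply/null_content_dominatesP => A mA A0.
  have /null_content_dominatesP := LSdom; move=> /(_ A mA A0) LA0.
  rewrite /nu' /mfrestr /mrestr; apply/eqP.
  rewrite eq_le measure_ge0 andbT.
  rewrite -LA0; apply: le_measure; rewrite ?inE//.
  exact: measurableI.
have [f [f0 ffin fi fnu]] := @radon_nikodym_sigma_finite _ _ _ mu nu' nu'mu.
exists (fine \o f); split.
  rewrite /Rintegrable; apply: eq_integrable fi => // x _.
  by rewrite /= fineK.
move=> x y cx xy yd.
rewrite /Rintegral (_ : (\int[mu]_(t in [set` `]x, y]]) ((fine \o f) t)%:E =
  nu' [set` `]x, y]])%E); last first.
  apply: etrans (esym (fnu _ (measurable_itv `]x, y]))).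
  by apply: eq_integral => t _; rewrite /= fineK.
rewrite /nu' /mfrestr /mrestr setIidl; first by rewrite /LS LS_oc.
move=> z; rewrite /W /= !in_itv/= => /andP[xz zy].
by rewrite (le_lt_trans cx xz) (le_trans zy yd).
Qed.

Let clE x : c <= x -> x <= d -> cl x = x.
Proof. by move=> cx xd; rewrite /cl max_l// min_l. Qed.

Let UE x y : c <= x -> x <= y -> y <= d -> U y - U x = nu x y + B * (y - x).
Proof.
move=> cx xy yd; rewrite /U !clE ?(le_trans cx xy)// ?(le_trans xy yd)//.
by rewrite (weak_mass_add cx xy); ring.
Qed.

(** The difference quotients of the masses with step [1 / (n + 1)] recover the density almost
    everywhere, by Lebesgue differentiation of the primitive of [g]. *)
Lemma weak_limit_window : exists g : R -> R, [/\ L1 g,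
  forall x y, c <= x -> x <= y -> y <= d ->
    \int[mu]_(t in [set` `]x, y]]) g t = nu x y + B * (y - x) &
  {ae mu, forall x, c < x < d ->
    (fun n => n.+1%:R * nu x (x + n.+1%:R^-1)) @ \oo --> g x - B}].
Proof.
have [g [gi gU]] := window_density; exists g; split => //.
  by move=> x y cx xy yd; rewrite gU// UE.
have gl : locally_integrable setT g.
  by apply: open_integrable_locally => //; exact: openT.
have := lebesgue_differentiation gl.
apply: filterS; first exact: (ae_filter_ringOfSetsType mu).
move=> x gx /andP[cx xd].
have gi' : mu.-integrable [set` Interval (BRight c) (BRight (x + 1))] (EFin \o g).
  by apply: integrableS gi => //; exact: measurable_itv.
have x1 : x < x + 1 by rewrite ltrDl.
have cx' : ((BRight c : itv_bound R) < BRight x)%O by rewrite bnd_simp.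
have [dF F'] := @FTC1_lebesgue_pt R g (BRight c) x (x + 1) x1 gi' cx' gx.
have inv_neq0 (n : nat) : n.+1%:R^-1 != 0 :> R by rewrite invr_eq0 pnatr_eq0.
have := derivable_quotient_cvg dF (@cvg_natSinv R) inv_neq0.
rewrite F' => qc.
have : (fun n => (n.+1%:R^-1)^-1 * (\int[mu]_(t in [set` `]c, (x + n.+1%:R^-1)]]) g t -
  \int[mu]_(t in [set` `]c, x]]) g t) - B) @ \oo --> g x - B.
  by apply: cvgB; [exact: qc|exact: cvg_cst].
(* Only for large [n] does [x + 1 / (n + 1)] stay in the window, where the mass is given by [g]. *)
apply: near_cvg_to; near=> n.
have hd : x + n.+1%:R^-1 <= d.
  rewrite -lerBrDl ltW//; near: n.
  have dx0 : 0 < d - x by rewrite subr_gt0.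
  exact: (near_infty_natSinv_lt (PosNum dx0)).
have hn : 0 <= n.+1%:R^-1 :> R by rewrite invr_ge0.
rewrite !gU ?lexx ?(ltW cx) ?(ltW xd)//; last first.
  by rewrite (le_trans (ltW cx))// lerDl.
have -> : U (x + n.+1%:R^-1) - U c - (U x - U c) = U (x + n.+1%:R^-1) - U x by ring.
rewrite UE ?(ltW cx)// ?lerDl//.
rewrite invrK.
have : n.+1%:R * n.+1%:R^-1 = 1 :> R by rewrite mulfV.
move: (n.+1%:R) => k kh.
transitivity (k * nu x (x + k^-1) + B * (k * k^-1) - B); first by ring.
by rewrite kh; ring.
Unshelve. all: by end_near. Qed.

End Window.

(* The density is any measurable function that agrees with the limit of the
   difference quotients of [nu] wherever it exists; this formula makes it jointly
   measurable when [nu] depends on a further parameter. *)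
Lemma weak_limit_density (D : R -> R) : measurable_fun setT D ->
  (forall x l, (fun n => n.+1%:R * nu x (x + n.+1%:R^-1)) @ \oo --> l -> D x = l) ->
  forall a b, a <= b -> \int[mu]_x (D x * \1_`]a, b] x) = nu a b.
Proof.
move=> mD DE a b ab.
(* The window reaches one unit beyond [b], so that every point of []a, b]], including [b], lies in
   its interior. *)
have ab1 : a <= b + 1 by rewrite (le_trans ab)// lerDl.
have [g [gi gnu gae]] := weak_limit_window ab1.
transitivity (\int[mu]_x ((g x - B) * \1_`]a, b] x)).
  rewrite /Rintegral; congr fine; apply: ae_eq_integral => //.
  - apply/measurable_EFinP; apply: measurable_funM; first exact: mD.
    by apply: measurable_indic; exact: measurable_itv.
  - apply/measurable_EFinP; apply: measurable_funM.
      by apply: measurable_funB; [exact: (L1_measurable gi)|exact: measurable_cst].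
    by apply: measurable_indic; exact: measurable_itv.
  - move: gae; apply: filterS; first exact: (ae_filter_ringOfSetsType mu).
    move=> x hx _; congr EFin.
    rewrite indic_ocE; case: (boolP (a < x <= b)) => [/andP[ax xb]|_]; last by rewrite !mulr0.
    congr (_ * _).
    have axb : a < x < b + 1 by rewrite ax (le_lt_trans xb)// ltrDl.
    exact: (DE x _ (hx axb)).
have -> : \int[mu]_x ((g x - B) * \1_`]a, b] x) =
  \int[mu]_x (g x * \1_`]a, b] x - B * \1_`]a, b] x).
  by apply: eq_Rintegral => x _; rewrite mulrBl.
have gii : L1 (fun x => g x * \1_`]a, b] x).
  apply: L1_le (L1_norm gi).
    by apply: measurable_funM; [exact: (L1_measurable gi)|exact: measurable_indic].
  move=> x; rewrite normrM ler_piMr// indicE.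
  by case: (_ \in _); rewrite ?normr1 ?normr0.
rewrite RintegralB//; last exact/L1_Z/Rintegrable_itv.
rewrite RintegralZl//; last exact: Rintegrable_itv.
rewrite Rintegral_indic_itv// Rintegral_mul_indic gnu//.
  by rewrite addrK.
by rewrite lerDl.
Qed.

End WeakLimitDensity.

Section Countable.
Context d (T : measurableType d) (R : realType) (I : countType).

(** The index map [g] will be a cell index, a time index or a pair of cell indices; every step
    function of the scheme is measurable for this reason. *)
Lemma measurable_countable_family (g : T -> I) (F : I -> T -> R) :
  (forall i, measurable (g @^-1` [set i])) ->
  (forall i, measurable_fun setT (F i)) ->
  measurable_fun setT (fun t => F (g t) t).
Proof.
move=> mg mF _ Y mY; rewrite setTI.
rewrite (_ : _ @^-1` Y = \bigcup_(i in [set: I]) (g @^-1` [set i] `&` F i @^-1` Y)).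
  apply: countable_bigcupT_measurable => // i; apply: measurableI => //.
  by rewrite -[X in measurable X]setTI; exact: mF.
apply/seteqP; split => t /=; first by move=> Yt; exists (g t).
by move=> [i _ [<-]].
Qed.

End Countable.

(** * Grid functions and the quadrature rule *)

Section PiecewiseConstant.
Context {R : realType}.
Local Notation mu := (@lebesgue_measure R).

(** Rounding to the nearest node; ties go up because cells are closed on the left. *)
Definition cell_idx (h : R) (x : R) : int := Num.floor (x / h + 2^-1).

Definition pc (h : R) (u : int -> R) (x : R) : R := u (cell_idx h x).

Variable h : R.
Hypothesis h0 : 0 < h.

Lemma cell_idxP (x : R) (j : int) :
  (cell_idx h x == j) = ((j%:~R - 2^-1) * h <= x < (j%:~R + 2^-1) * h).
Proof.
rewrite /cell_idx floor_eq; apply/idP/idP => /andP[h1 h2]; apply/andP; split.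
- by rewrite -ler_pdivlMr// lerBlDr.
- by rewrite -ltr_pdivrMr//; move: h2; rewrite intrD; lra.
- by rewrite -lerBlDr ler_pdivlMr.
- by move: h2; rewrite -ltr_pdivrMr// intrD; lra.
Qed.

Lemma cell_idx_bounds (x : R) :
  ((cell_idx h x)%:~R - 2^-1) * h <= x < ((cell_idx h x)%:~R + 2^-1) * h.
Proof. by rewrite -cell_idxP. Qed.

Lemma cell_preimage j : cell_idx h @^-1` [set j] = cell h j.
Proof.
by apply/seteqP; split => x; rewrite /cell /= in_itv/= -cell_idxP => /eqP.
Qed.

Lemma measurable_cell j : measurable (cell h j : set R).
Proof. exact: measurable_itv. Qed.

Lemma measurable_pc u : measurable_fun setT (pc h u).
Proof.
apply: (@measurable_countable_family _ _ R int (cell_idx h) (fun j _ => u j)) => // j.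
by rewrite cell_preimage; exact: measurable_cell.
Qed.

Lemma cell_idx_shift (x : R) (q : int) : cell_idx h (x + q%:~R * h) = cell_idx h x + q.
Proof.
rewrite /cell_idx -[RHS](_ : Num.floor (x / h + 2^-1 + q%:~R) = _); last first.
  by rewrite floorDrz ?intr_int// intrKfloor.
by congr Num.floor; rewrite mulrDl mulfK ?gt_eqF//; ring.
Qed.

Lemma pc_shift u (x : R) (q : int) : pc h u (x + q%:~R * h) = pc h (fun j => u (j + q)) x.
Proof. by rewrite /pc cell_idx_shift. Qed.

Lemma Rintegral_cell j : \int[mu]_x (\1_(cell h j) x : R) = h.
Proof.
rewrite /cell Rintegral_indic_bnd; first by field.
by rewrite ler_pM2r// lerD2l; lra.
Qed.

Lemma L1_cell j : L1 (\1_(cell h j) : R -> R).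
Proof. exact: integrable_indic_itv. Qed.

Lemma sum_window_delta n (a : int -> R) (j : int) :
  \sum_(0 <= i < n.*2.+1) a (i%:Z - n%:Z) * (j == i%:Z - n%:Z)%:R =
  a j * ((`|j| <= n)%N)%:R.
Proof.
have [jn|jn] := leqP `|j| n.
  have u : uniq (index_iota 0 n.*2.+1) by exact: iota_uniq.
  have m : absz (j + n%:Z)%R \in index_iota 0 n.*2.+1.
    by rewrite mem_index_iota; lia.
  rewrite (bigD1_seq _ m u)/=.
  rewrite (_ : (absz (j + n%:Z)%R)%:Z - n%:Z = j); last by lia.
  rewrite eqxx big1_seq ?addr0// => i /andP[ij _].
  rewrite (_ : (j == _) = false) ?mulr0//.
  by apply/negbTE; move: ij; apply: contraNneq => ->; apply/eqP; lia.
rewrite mulr0 big1_seq// => i /andP[_]; rewrite mem_index_iota => /andP[_ ij].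
rewrite (_ : (j == _) = false) ?mulr0//.
by apply/negbTE/eqP => je; move: jn; rewrite je; lia.
Qed.

Lemma pc_window n (a : int -> R) x :
  pc h a x * ((`|cell_idx h x| <= n)%N)%:R =
  \sum_(0 <= i < n.*2.+1) a (i%:Z - n%:Z) * \1_(cell h (i%:Z - n%:Z)) x.
Proof.
rewrite /pc -sum_window_delta; apply: eq_bigr => i _; congr (_ * _).
by rewrite indicE -cell_preimage; congr (_%:R); congr nat_of_bool;
  apply/idP/idP; rewrite inE/= => /eqP.
Qed.

(** Identifies the symmetric partial sums that define [zsum] with integrals over a growing block of
    cells. *)
Lemma Rintegral_pc_window n (a : int -> R) :
  \int[mu]_x (pc h a x * ((`|cell_idx h x| <= n)%N)%:R) =
  h * \sum_(0 <= i < n.*2.+1) a (i%:Z - n%:Z).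
Proof.
under eq_Rintegral do rewrite pc_window.
rewrite Rintegral_sum//; last by move=> i; exact/L1_Z/L1_cell.
rewrite mulr_sumr; apply: eq_bigr => i _.
rewrite RintegralZl//; last exact: L1_cell.
by rewrite Rintegral_cell mulrC.
Qed.

Lemma window_eventually x : \forall n \near \oo, (`|cell_idx h x| <= n)%N.
Proof. by exists `|cell_idx h x|%N. Qed.

Lemma measurable_window n :
  measurable_fun setT (fun x => ((`|cell_idx h x| <= n)%N)%:R : R).
Proof. exact: (measurable_pc (fun j => ((`|j| <= n)%N)%:R)). Qed.

Lemma pc_integral_cvg a : L1 (pc h a) ->
  (fun n : nat => h * \sum_(0 <= i < n.*2.+1) a (i%:Z - n%:Z)) @ \oo -->
  \int[mu]_x pc h a x.
Proof.
move=> ai; under eq_fun do rewrite -Rintegral_pc_window.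
apply: (@L1_dominated_cvg _
  (fun n x => pc h a x * ((`|cell_idx h x| <= n)%N)%:R) _ (fun x => `|pc h a x|)).
- by move=> n; apply: measurable_funM; [exact: measurable_pc|exact: measurable_window].
- exact: measurable_pc.
- move=> x; apply: cvg_near_cst; have := window_eventually x.
  by apply: filterS => n ->; rewrite mulr1.
- exact: L1_norm.
- move=> n x; rewrite normrM ler_piMr//.
  by case: (_ <= _)%N; rewrite ?normr1 ?normr0.
Qed.

Lemma zsum_pc a : L1 (pc h a) -> h * zsum a = \int[mu]_x pc h a x.
Proof.
move=> /pc_integral_cvg ac.
have : (fun n : nat => \sum_(0 <= i < n.*2.+1) a (i%:Z - n%:Z)) @ \oo -->
    h^-1 * \int[mu]_x pc h a x.
  apply: (@near_cvg_to _ (fun n : nat => h^-1 * (h * \sum_(0 <= i < n.*2.+1) a (i%:Z - n%:Z)))).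
    by apply: nearW => n; rewrite mulKf// gt_eqF.
  by apply: cvgM => //; exact: cvg_cst.
by move=> /cvg_lim; rewrite /zsum => -> //; rewrite mulrA mulfV ?mul1r// gt_eqF.
Qed.

(** Monotone convergence over growing blocks of cells gives integrability and the bound at once. For
    kernels, [c] is the variation near a cell, and the total variation bounds its symmetric sums. *)
Lemma L1_cells (f : R -> R) (c : int -> R) (C : R) :
  measurable_fun setT f -> (forall x, 0 <= f x) ->
  (forall x, f x <= pc h c x) ->
  (forall n : nat, \sum_(0 <= i < n.*2.+1) c (i%:Z - n%:Z) <= C) ->
  L1 f /\ \int[mu]_x f x <= h * C.
Proof.
move=> mf f0 fc cC.
pose g n x := f x * ((`|cell_idx h x| <= n)%N)%:R.
have mg n : measurable_fun setT (g n).
  by apply: measurable_funM => //; exact: measurable_window.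
have g0 n x : 0 <= g n x by rewrite mulr_ge0.
have pcwi n : L1 (fun x => pc h c x * ((`|cell_idx h x| <= n)%N)%:R).
  under [X in L1 X]eq_fun do rewrite pc_window.
  by apply: Rintegrable_sum => // i; exact/L1_Z/L1_cell.
have gi n : L1 (g n).
  apply: L1_le (pcwi n) => // x; rewrite ger0_norm//.
  by rewrite ler_wpM2r.
have gC n : (\int[mu]_x (g n x)%:E <= (h * C)%:E)%E.
  rewrite -(EFin_Rintegral measurableT (gi n)) lee_fin.
  apply: le_trans (_ : h * (\sum_(0 <= i < n.*2.+1) c (i%:Z - n%:Z)) <= _); last first.
    by rewrite ler_pM2l.
  rewrite -Rintegral_pc_window; apply: le_Rintegral => //; [exact: gi|exact: pcwi|move=> x _].
  by rewrite ler_wpM2r.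
have fC : (\int[mu]_x (f x)%:E <= (h * C)%:E)%E.
  have cv := @cvg_monotone_convergence _ _ R mu setT measurableT
    (fun n x => (g n x)%:E).
  have : (\int[mu]_x (g n x)%:E)%E @[n --> \oo] --> (\int[mu]_x (f x)%:E)%E.
    rewrite (_ : (\int[mu]_x (f x)%:E)%E = (\int[mu]_x limn (EFin \o g ^~ x))%E).
      apply: cv => //.
      - by move=> n; apply/measurable_EFinP; exact: mg.
      - by move=> n x _; rewrite lee_fin.
      - move=> x _ n k nk; rewrite lee_fin ler_wpM2l// ler_nat.
        by case: (leqP `|_| n) => // hn; rewrite (leq_trans hn nk).
    apply: eq_integral => x _; apply/esym/cvg_lim => //.
    apply: cvg_near_cst; have := window_eventually x.
    by apply: filterS => n hn; rewrite /= /g hn mulr1.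
  move=> fl; rewrite -(cvg_lim _ fl)//; apply: lime_le; last exact: nearW.
  by apply/cvg_ex; eexists; exact: fl.
have fi : L1 f.
  apply/integrableP; split; first exact/measurable_EFinP.
  under eq_integral => x _ do rewrite /= ger0_norm//.
  exact: le_lt_trans fC (ltry _).
by split => //; rewrite -lee_fin EFin_Rintegral.
Qed.

End PiecewiseConstant.

Lemma int_succ_sub (R : realType) (i n : nat) :
  (i.+1%:Z - n%:Z)%:~R = (i%:Z - n%:Z)%:~R + 1 :> R.
Proof. by rewrite (_ : i.+1%:Z - n%:Z = i%:Z - n%:Z + 1) ?intrD//; lia. Qed.

(** * Kernels of bounded variation *)

Section KernelBounds.
Context {R : realType}.
Local Notation mu := (@lebesgue_measure R).
Variables (w : R -> R) (M : R).
Hypothesis kw : is_kernel w.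
Hypothesis wM : forall a b : R, a <= b -> (total_variation a b w <= M%:E)%E.

Let tv a b := fine (total_variation a b w).

Let tvE a b : a <= b -> total_variation a b w = (tv a b)%:E.
Proof.
move=> ab; rewrite /tv fineK// ge0_fin_numE; last exact: total_variation_ge0.
exact: le_lt_trans (wM ab) (ltry _).
Qed.

Let tv_le a b : a <= b -> tv a b <= M.
Proof. by move=> ab; rewrite -lee_fin -tvE// wM. Qed.

Let tv_ge a b x y : a <= x -> x <= y -> y <= b -> `|w y - w x| <= tv a b.
Proof.
move=> ax xy yb; rewrite -lee_fin -tvE; last by rewrite (le_trans ax)// (le_trans xy).
rewrite (total_variationD _ ax (le_trans xy yb)) (total_variationD _ xy yb).
apply: le_trans (total_variation_ge _ xy) _.
rewrite addeCA leeDl// adde_ge0// total_variation_ge0//.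
Qed.

Let tvD a b c : a <= b -> b <= c -> tv a c = tv a b + tv b c.
Proof.
move=> ab bc; apply/EFin_inj.
by rewrite EFinD -!tvE// ?(le_trans ab)// (total_variationD _ ab bc).
Qed.

Let tv_sum (x : nat -> R) n : (forall i, x i <= x i.+1) ->
  x 0%N <= x n /\ \sum_(0 <= i < n) tv (x i) (x i.+1) = tv (x 0%N) (x n).
Proof.
move=> xx; elim: n => [|n [h0 h1]].
  by rewrite big_nil /tv total_variationxx.
by split; [exact: le_trans h0 _|rewrite big_nat_recr//= h1 -tvD].
Qed.

Lemma kernel_M_ge0 : 0 <= M.
Proof. by rewrite (le_trans _ (tv_le (lexx 0)))// -lee_fin -tvE// total_variation_ge0. Qed.

Lemma kernel_ge0 x : 0 <= w x. Proof. by case: kw. Qed.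

Lemma kernel_L1 : L1 w. Proof. by case: kw. Qed.

Lemma kernel_measurable : measurable_fun setT w.
Proof. exact: L1_measurable kernel_L1. Qed.

Lemma kernel_int1 : \int[mu]_x w x = 1. Proof. by case: kw. Qed.

Lemma kernel_osc x y : `|w y - w x| <= M.
Proof.
have [xy|/ltW yx] := leP x y.
  exact: le_trans (tv_ge (lexx x) xy (lexx y)) (tv_le xy).
by rewrite distrC; exact: le_trans (tv_ge (lexx y) yx (lexx x)) (tv_le yx).
Qed.

(* A value above M + 1 would force w > 1 everywhere, against a unit integral. *)
Lemma kernel_le x : w x <= M + 1.
Proof.
rewrite leNgt; apply/negP => xM.
have w1 y : 1 <= w y.
  by have := kernel_osc x y; rewrite ler_norml => /andP[h _]; lra.
have : \int[mu]_y (1 * (\1_`]0, 2] : R -> R) y) <= \int[mu]_y w y.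
  apply: le_Rintegral => //; [exact/L1_Z/Rintegrable_itv|exact: kernel_L1|].
  move=> y _; rewrite mul1r (le_trans _ (w1 y))// indic_ocE.
rewrite RintegralZl//; last exact: Rintegrable_itv.
by rewrite Rintegral_indic_itv// kernel_int1; lra.
Qed.

(** For [x] in cell [q], both [x] and [x + h] lie in the union of the cells [q] and [q + 1], so the
    variation there bounds the difference. Summing over [q] counts every cell twice, whence the
    2. *)
Let kernel_shift_pos h : 0 < h ->
  \int[mu]_x `|w (x + h) - w x| <= 2 * M * h.
Proof.
move=> h0.
pose c (q : int) := tv ((q%:~R - 2^-1) * h) ((q%:~R + 2^-1 + 1) * h).
have [_] : L1 (fun x => `|w (x + h) - w x|) /\
    \int[mu]_x `|w (x + h) - w x| <= h * (M + M).
  apply: (@L1_cells _ h h0 _ c) => //.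
  - apply: measurableT_comp => //; apply: measurable_funB.
      exact: L1_measurable (Rintegrable_shift h kernel_L1).
    exact: kernel_measurable.
  - move=> x; rewrite /pc /c; have := cell_idx_bounds h0 x.
    move: (cell_idx h x) => q /andP[h1 h2].
    apply: tv_ge => //; first by rewrite lerDl ltW.
    by rewrite mulrDl mul1r lerD2r ltW.
  - move=> n; pose x (i : nat) := ((i%:Z - n%:Z)%:~R - 2^-1) * h.
    have xS i : x i.+1 = ((i%:Z - n%:Z)%:~R + 2^-1) * h.
      by rewrite /x int_succ_sub; congr (_ * _); lra.
    have xx i : x i <= x i.+1.
      by rewrite xS /x ler_pM2r//; lra.
    rewrite (eq_bigr (fun i => tv (x i) (x i.+1) + tv (x i.+1) (x i.+2))).
      rewrite big_split/=; apply: lerD.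
        by have [h1 ->] := tv_sum n.*2.+1 xx; exact: tv_le.
      by have [h1 ->] := tv_sum n.*2.+1 (fun i => xx i.+1); exact: tv_le.
    move=> i _; rewrite /c -tvD//; congr tv; rewrite xS.
    by rewrite int_succ_sub; congr (_ * _); lra.
by move=> /le_trans; apply; rewrite le_eqVlt; apply/orP; left; apply/eqP; ring.
Qed.

Lemma kernel_shift_L1 h : L1 (fun x => `|w (x + h) - w x|).
Proof. by apply/L1_norm/L1_B; [exact: Rintegrable_shift kernel_L1|exact: kernel_L1]. Qed.

Lemma kernel_shift h : \int[mu]_x `|w (x + h) - w x| <= 2 * M * `|h|.
Proof.
have [h0|h0|<-] := ltgtP 0 h.
- by rewrite gtr0_norm// kernel_shift_pos.
- rewrite ltr0_norm//.
  have /kernel_shift_pos : 0 < - h by rewrite oppr_gt0.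
  apply: le_trans; rewrite le_eqVlt; apply/orP; left; apply/eqP.
  rewrite -(Rintegral_shift h (kernel_shift_L1 (- h))).
  by apply: eq_Rintegral => x _; rewrite addrK distrC.
- under eq_Rintegral do rewrite addr0 subrr normr0.
  by rewrite Rintegral_cst// mul0r normr0 mulr0.
Qed.

(** Within a cell the value at the node differs from [w x] by at most the variation over that cell;
    these variations add up to at most [M]. *)
Lemma kernel_riemann h : 0 < h ->
  L1 (fun x => `|pc h (fun q => w (q%:~R * h)) x - w x|) /\
  \int[mu]_x `|pc h (fun q => w (q%:~R * h)) x - w x| <= h * M.
Proof.
move=> h0.
pose c (q : int) := tv ((q%:~R - 2^-1) * h) ((q%:~R + 2^-1) * h).
apply: (@L1_cells _ h h0 _ c) => //.
- apply: measurableT_comp => //; apply: measurable_funB.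
    exact: measurable_pc.
  exact: kernel_measurable.
- move=> x; rewrite /pc /c; have := cell_idx_bounds h0 x.
  move: (cell_idx h x) => q /andP[h1 h2].
  have q1 : (q%:~R - 2^-1) * h <= q%:~R * h by rewrite ler_pM2r//; lra.
  have q2 : q%:~R * h <= (q%:~R + 2^-1) * h by rewrite ler_pM2r//; lra.
  have [qx|/ltW xq] := leP (q%:~R * h) x.
    by rewrite distrC; apply: tv_ge => //; exact: ltW.
  exact: tv_ge.
- move=> n; pose x (i : nat) := ((i%:Z - n%:Z)%:~R - 2^-1) * h.
  have xS i : x i.+1 = ((i%:Z - n%:Z)%:~R + 2^-1) * h.
    by rewrite /x int_succ_sub; congr (_ * _); lra.
  have xx i : x i <= x i.+1.
    by rewrite xS /x ler_pM2r//; lra.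
  rewrite (eq_bigr (fun i => tv (x i) (x i.+1))); last by move=> i _; rewrite xS.
  by have [h1 ->] := tv_sum n.*2.+1 xx; exact: tv_le.
Qed.

Lemma kernel_sampled_L1 h : 0 < h -> L1 (pc h (fun q => w (q%:~R * h))).
Proof.
move=> h0; have [i1 _] := kernel_riemann h0.
apply: L1_le (L1_D i1 kernel_L1); first exact: measurable_pc.
move=> x; rewrite -{1}(subrK (w x) (pc _ _ x)).
by rewrite (le_trans (ler_normD _ _))// lerD2l ger0_norm ?kernel_ge0.
Qed.

End KernelBounds.

(** * Quadrature of the nonlocal terms *)

Section Quadrature.
Context {R : realType}.
Local Notation mu := (@lebesgue_measure R).
Variables (w : R -> R) (M dx : R).
Hypothesis kw : is_kernel w.
Hypothesis wM : forall a b : R, a <= b -> (total_variation a b w <= M%:E)%E.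
Hypothesis dx0 : 0 < dx.
Implicit Types (u : int -> R) (j q : int).

(** The exact nonlocal term of the piecewise constant density at node [j], an intermediary between
    the quadrature rule and the convolution with the limit. *)
Definition kconv u j : R := \int[mu]_y (w y * pc dx (fun q => u (j + q)) y).

Let wi := kernel_L1 kw.
Let w0 := kernel_ge0 kw.
Let w1 := kernel_le kw wM.
Let M0 := kernel_M_ge0 wM.

Lemma L1_Mr (B : R) (f v : R -> R) : measurable_fun setT v ->
  (forall x, `|v x| <= B) -> L1 f -> L1 (fun x => f x * v x).
Proof.
move=> mv vB fi; rewrite (_ : (fun x => _) = fun x => v x * f x).
  exact: (L1_M mv vB).
by apply/funext => x; rewrite mulrC.
Qed.

(** A nonnegative kernel of mass 1 forms averages. *)
Lemma kconv_bounds u j lo hi : (forall i, lo <= u i <= hi) -> lo <= kconv u j <= hi.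
Proof.
move=> uB.
have ui : L1 (fun y => w y * pc dx (fun q => u (j + q)) y).
  apply: (@L1_Mr (`|lo| + `|hi|)) => //; first exact: measurable_pc.
  move=> x; rewrite /pc; have /andP[h1 h2] := uB (j + cell_idx dx x).
  have := ler_norm (- lo); have := ler_norm (- hi).
  by have := ler_norm lo; have := ler_norm hi; rewrite !normrN ler_norml; lra.
rewrite -[lo]mulr1 -[hi]mulr1 -(kernel_int1 kw).
rewrite -!RintegralZl//.
rewrite /kconv; apply/andP; split; apply: le_Rintegral => //; try exact: L1_Z.
- by move=> x _; rewrite mulrC ler_wpM2l// /pc; have /andP[] := uB (j + cell_idx dx x).
- by move=> x _; rewrite mulrC ler_wpM2r// /pc; have /andP[] := uB (j + cell_idx dx x).
Qed.

Lemma kconv_shiftE u j (B : R) : (forall i, `|u i| <= B) ->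
  kconv u j = \int[mu]_y (w (y - j%:~R * dx) * pc dx u y).
Proof.
move=> uB; rewrite /kconv.
have fi : L1 (fun y => w (y - j%:~R * dx) * pc dx u y).
  apply: (@L1_Mr B (fun y => w (y - j%:~R * dx))) => //.
  - exact: measurable_pc.
  - by move=> y; exact: uB.
  exact: (Rintegrable_shift (- (j%:~R * dx)) wi).
rewrite -(Rintegral_shift (j%:~R * dx) fi); apply: eq_Rintegral => y _.
rewrite addrK pc_shift//; congr (_ * _); congr pc.
by apply/funext => q; rewrite addrC.
Qed.

(** All regularity comes from the kernel: translating it costs [2 * M] times the distance in L1,
    while the density is merely bounded. *)
Lemma kconv_near u (B x y : R) : (forall i, `|u i| <= B) ->
  `|\int[mu]_z (w (z - x) * pc dx u z) - \int[mu]_z (w (z - y) * pc dx u z)|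
    <= 2 * M * B * `|x - y|.
Proof.
move=> uB.
have B0 : 0 <= B by exact: le_trans (uB 0).
have fi a : L1 (fun z => w (z - a) * pc dx u z).
  apply: (@L1_Mr B (fun z => w (z - a))) => //.
  - exact: measurable_pc.
  - by move=> z; exact: uB.
  exact: (Rintegrable_shift (- a) wi).
rewrite -RintegralB//; [|exact: fi|exact: fi].
have gi : L1 (fun z => `|w (z - x) - w (z - y)|).
  by apply/L1_norm/L1_B; exact: (Rintegrable_shift (- _) wi).
apply: le_trans (_ : \int[mu]_z (B * `|w (z - x) - w (z - y)|) <= _).
  apply: L1_norm_le; [exact: L1_B|exact: L1_Z|move=> z].
  by rewrite -mulrBl normrM mulrC ler_wpM2r//; exact: uB.
rewrite RintegralZl// (_ : 2 * M * B * _ = B * (2 * M * `|y - x|)); last first.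
  by rewrite distrC; ring.
rewrite ler_wpM2l//; apply: le_trans (kernel_shift kw wM (y - x)).
rewrite -(Rintegral_shift y gi) le_eqVlt; apply/orP; left; apply/eqP.
by apply: eq_Rintegral => z _; rewrite addrK addrA.
Qed.

Hypothesis fits : grid_fits dx w.

Let supp0 : supp w 0. Proof. by case: kw. Qed.

(** [grid_fits] makes the floor in [N1] exact, so the support ends precisely at a node and the
    kernel vanishes at all nodes further left. *)
Let left_end q : left_bounded w -> w (q%:~R * dx) != 0 -> - N1 dx w <= q.
Proof.
move=> lb wq; have [/(_ lb) fl _] := fits.
have hl : has_lbound (supp w) by move/asboolP: lb.
have e0 : eta1 w <= 0 by exact: ge_inf.
have eq : eta1 w <= q%:~R * dx by apply: ge_inf => //; exact: subset_closure.
have N1E : (N1 dx w)%:~R = `|eta1 w| / dx.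
  by rewrite /N1 floorK//; move: fl; rewrite natrEint => /andP[].
rewrite -(ler_int R) rmorphN/= N1E ler0_norm//.
by rewrite mulNr opprK ler_pdivrMr.
Qed.

Let right_end q : right_bounded w -> w (q%:~R * dx) != 0 -> q <= N2 dx w.
Proof.
move=> rb wq; have [_ /(_ rb) fr] := fits.
have hr : has_ubound (supp w) by move/asboolP: rb.
have eq : q%:~R * dx <= eta2 w by apply: ub_le_sup => //; exact: subset_closure.
have N2E : (N2 dx w)%:~R = eta2 w / dx.
  by rewrite /N2 floorK//; move: fr; rewrite natrEint => /andP[].
by rewrite -(ler_int R) N2E ler_pdivlMr.
Qed.

Section Values.
Variables (ul u ur : int -> R) (B : R).
Hypotheses (ulB : forall i, `|ul i| <= B) (uB : forall i, `|u i| <= B)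
  (urB : forall i, `|ur i| <= B).

Let B0 : 0 <= B. Proof. exact: le_trans (uB 0). Qed.

Let endB (x y : R) (b : bool) : `|x| <= B ->
  `|if b then dx / 2 * x * w y else 0| <= B * (M + 1) * dx / 2.
Proof.
move=> xB; have D0 : 0 <= B * (M + 1) * dx / 2.
  by rewrite divr_ge0// !mulr_ge0// ?addr_ge0// ltW.
case: b; last by rewrite normr0.
rewrite !normrM (ger0_norm (w0 _)) (ger0_norm (_ : 0 <= dx))//; last exact: ltW.
rewrite normfV (ger0_norm (_ : 0 <= 2 :> R))//.
rewrite (_ : B * (M + 1) * dx / 2 = dx / 2 * (B * (M + 1))); last by ring.
rewrite -mulrA ler_wpM2l// ?divr_ge0 ?(ltW dx0)//.
by apply: ler_pM.
Qed.

(** Each boundary term is at most [B * (M + 1) * dx / 2]. The inner sum is the integral of a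
    piecewise constant function: sampling the kernel costs [B * M * dx], and the two end nodes left
    out of the sum cost at most [B * (M + 1) * dx] each. The factor 4 absorbs the total. *)
Lemma quadrature_kconv j :
  `|quadrature dx w ul u ur j - kconv u j| <= 4 * (M + 1) * B * dx.
Proof.
rewrite /quadrature /kconv.
set tl := (if left_bounded w then _ else 0).
set tr := (if right_bounded w then _ else 0).
set a := (fun q : int => if _ then u (j + q) * w (q%:~R * dx) else 0).
have tlB : `|tl| <= B * (M + 1) * dx / 2 by exact: endB.
have trB : `|tr| <= B * (M + 1) * dx / 2 by exact: endB.
have wpci := kernel_sampled_L1 kw wM dx0.
have [ri rM] := kernel_riemann kw wM dx0.
have ai : L1 (pc dx a).
  apply: L1_le (L1_Z B wpci); first exact: measurable_pc.
  move=> y; rewrite /pc /a; case: ifP => _; last by rewrite normr0 mulr_ge0.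
  by rewrite normrM (ger0_norm (w0 _)) ler_wpM2r.
have ci : L1 (fun y => w y * pc dx (fun q => u (j + q)) y).
  apply: (@L1_Mr B) => //; first exact: measurable_pc.
  by move=> y; exact: uB.
rewrite zsum_pc//.
have dE : `|\int[mu]_y pc dx a y - \int[mu]_y (w y * pc dx (fun q => u (j + q)) y)|
    <= B * (dx * M) + B * (M + 1) * (dx + dx).
  rewrite -RintegralB//.
  pose g (y : R) := B * `|pc dx (fun q => w (q%:~R * dx)) y - w y| +
     (B * (M + 1)) * ((\1_(cell dx (- N1 dx w)) : R -> R) y
       + (\1_(cell dx (N2 dx w)) : R -> R) y).
  have c2i : L1 (fun y => (\1_(cell dx (- N1 dx w)) : R -> R) y
       + (\1_(cell dx (N2 dx w)) : R -> R) y).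
    by apply: L1_D; exact: L1_cell.
  apply: le_trans (_ : \int[mu]_y g y <= _); last first.
    rewrite RintegralD//; [|exact: L1_Z|exact: L1_Z].
    rewrite !RintegralZl// RintegralD//; [|exact: L1_cell|exact: L1_cell].
    by rewrite !Rintegral_cell// lerD2r ler_wpM2l.
  apply: L1_norm_le; [exact: L1_B|by apply: L1_D; exact: L1_Z|move=> y].
  rewrite /g !indicE -!cell_preimage//.
  set i1 : R := (_ \in cell_idx dx @^-1` [set - N1 dx w])%:R.
  set i2 : R := (_ \in cell_idx dx @^-1` [set N2 dx w])%:R.
  have C0 : 0 <= B * (M + 1) * (i1 + i2).
    by rewrite !mulr_ge0// ?addr_ge0// ler0n.
  rewrite /pc /a; move: (erefl (cell_idx dx y)); rewrite {1}/i1 {1}/i2.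
  move eq : (cell_idx dx y) => q _.
  have D1 : `|u (j + q) * w (q%:~R * dx) - w y * u (j + q)| <=
      B * `|w (q%:~R * dx) - w y|.
    by rewrite (mulrC (w y)) -mulrBr normrM ler_wpM2r.
  case: ifPn => [_|]; first by rewrite (le_trans D1)// lerDl.
  rewrite sub0r normrN => nmask.
  have [wq0|wq] := eqVneq (w (q%:~R * dx)) 0.
    apply: le_trans (_ : B * `|w (q%:~R * dx) - w y| <= _); last by rewrite lerDl.
    by rewrite wq0 sub0r normrN normrM mulrC ler_wpM2r.
  (* A node outside the summation range with nonzero kernel value can only be one of the two end
     nodes, and the cell indicators in [g] pay for these. *)
  have i12 : 1 <= i1 + i2.
    move: nmask; rewrite negb_and !negb_imply => /orP[/andP[lb]|/andP[rb]].
      rewrite -ltNge => qN; have qN' := left_end lb wq.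
      have -> : i1 = 1.
        by rewrite /i1 mem_set//= eq; apply/eqP; rewrite eq_le qN' -ltzD1 qN.
      by rewrite lerDl ler0n.
    rewrite -ltNge => qN; have qN' := right_end rb wq.
    have -> : i2 = 1.
      by rewrite /i2 mem_set//= eq; apply/eqP; rewrite eq_le qN' -ltzD1 -ltrBlDr qN.
    by rewrite lerDr ler0n.
  apply: le_trans (_ : B * (M + 1) <= _).
    rewrite normrM mulrC (ger0_norm (w0 _)); apply: ler_pM => //.
  apply: le_trans (_ : B * (M + 1) * (i1 + i2) <= _); last by rewrite lerDr mulr_ge0.
  by rewrite ler_peMr// mulr_ge0// addr_ge0.
move: dE tlB trB; rewrite !ler_norml => /andP[d1 d2] /andP[l1 l2] /andP[r1 r2].
have BM : 0 <= B * M * dx by rewrite !mulr_ge0// ltW.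
have Bd : 0 <= B * dx by rewrite mulr_ge0// ltW.
by apply/andP; split; nra.
Qed.

Lemma quadrature_bound j :
  `|quadrature dx w ul u ur j| <= B * (1 + 4 * (M + 1) * dx).
Proof.
have := quadrature_kconv j.
have /(_ j)/andP[] : forall j, - B <= kconv u j <= B.
  by move=> i; apply: kconv_bounds => k; rewrite -ler_norml.
by rewrite !ler_norml => h1 h2 /andP[h3 h4]; apply/andP; split; lra.
Qed.

(** Two quadrature errors with factor 4 each, plus 2 from translating the kernel by [dx], make the
    factor 10. *)
Lemma quadrature_diff j :
  `|quadrature dx w ul u ur (j + 1) - quadrature dx w ul u ur j|
    <= 10 * (M + 1) * B * dx.
Proof.
have h1 := quadrature_kconv (j + 1); have h2 := quadrature_kconv j.
have := kconv_near ((j + 1)%:~R * dx) (j%:~R * dx) uB.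
rewrite -!(kconv_shiftE _ uB) -mulrBl intrD addrAC subrr add0r mul1r.
rewrite (ger0_norm (_ : 0 <= dx)); last exact: ltW.
move: h1 h2; rewrite !ler_norml => /andP[h1 h2] /andP[h3 h4] /andP[h5 h6].
have Bd : 0 <= B * dx by rewrite mulr_ge0// ltW.
by apply/andP; split; nra.
Qed.

End Values.
End Quadrature.

(** * Limited slopes *)

Section Slope.
Context {R : realType}.
Implicit Types (a b c : R) (u : int -> R) (j : int).

Lemma minmod3_le a b c :
  [/\ `|minmod3 a b c| <= `|a|, `|minmod3 a b c| <= `|b| & `|minmod3 a b c| <= `|c|].
Proof.
rewrite /minmod3; case: ifP => [/and3P[a0 b0 c0]|_].
  have m0 : 0 < Num.min a (Num.min b c) by rewrite !lt_min a0 b0.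
  by rewrite !gtr0_norm//; split; rewrite !ge_min lexx ?orbT.
case: ifP => [/and3P[a0 b0 c0]|_]; last by rewrite normr0.
have m0 : Num.max a (Num.max b c) < 0 by rewrite !gt_max a0 b0.
by rewrite !ltr0_norm//; split; rewrite lerN2 !le_max lexx ?orbT.
Qed.

Variables (C delta dx : R).
Hypotheses (C0 : 0 <= C) (dx0 : 0 < dx).

(** The comparison with the two neighbouring jumps controls the range of the scheme; the cap makes
    the slope terms vanish as [dx] tends to 0. *)
Lemma slope_le u j :
  [/\ `|dx * slope C delta dx u j| <= `|u (j + 1) - u j|,
      `|dx * slope C delta dx u j| <= `|u j - u (j - 1)| &
      `|dx * slope C delta dx u j| <= C * dx `^ delta].
Proof.
rewrite /slope mulrC mulfVK ?gt_eqF//.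
set c := Num.sg _ * _.
have [h1 h2 h3] := minmod3_le (u (j + 1) - u j) (u j - u (j - 1)) c.
split => //; apply: le_trans h3 _.
rewrite /c normrM (ger0_norm (_ : 0 <= C * _)) ?mulr_ge0 ?powR_ge0//.
by rewrite ler_piMl ?mulr_ge0 ?powR_ge0// normr_sg; case: (_ != _).
Qed.

(** Serves for the flux slopes when [LF = 0], where the flux vanishes on the relevant range. *)
Lemma slope_eq0 u j : (forall i, u i = 0) -> slope C delta dx u j = 0.
Proof.
move=> u0; have [h _ _] := slope_le u j.
move: h; rewrite !u0 subrr normr0 normr_le0 mulf_eq0 gt_eqF//=.
by move/eqP.
Qed.

Lemma slope_bound u j B : (forall i, `|u i| <= B) -> `|dx * slope C delta dx u j| <= 2 * B.
Proof.
move=> uB; have [h _ _] := slope_le u j; apply: le_trans h _.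
by rewrite (le_trans (ler_normB _ _))//; have := uB (j + 1); have := uB j; lra.
Qed.

End Slope.

(** * Linearity in the density *)

Section Structure.
Context {R : realType} {N m : nat}.
Variables (rm rM a b LF LV LS : R).
Hypotheses (rm0 : 0 <= rm) (rmM : rm < rM) (arm : a <= rm) (rmb : rm <= b).
Implicit Types (q : 'rV[R]_m) (r : 'rV[R]_N).

Lemma dist1_refl (n : nat) (v : 'rV[R]_n) : dist1 v v = 0.
Proof. by rewrite /dist1 big1// => i _; rewrite subrr normr0. Qed.

Lemma dist1_ge0 (n : nat) (v v' : 'rV[R]_n) : 0 <= dist1 v v'.
Proof. by apply: sumr_ge0 => i _. Qed.

Lemma in_box_cst : in_box a b (const_mx rm : 'rV[R]_m).
Proof. by move=> i; rewrite mxE arm. Qed.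

Section Flux.
Variables (f : R -> 'rV[R]_m -> R) (v : 'rV[R]_m -> R).
Hypothesis fL : flux_lipschitz LF rm rM a b f.
Hypothesis fv : forall (r : R) q, f r q = r * v q.

(** This is the Lipschitz bound between [rM] and [rm] at the same [q], divided by [rM - rm]. As the
    flux is linear in the density, [LF] thus serves for all densities, not only for those in
    [[rm, rM]]. *)
Lemma speed_bound q : in_box a b q -> `|v q| <= LF.
Proof.
move=> qb; have := @fL rM rm q q; rewrite !lexx (ltW rmM) => /(_ isT isT qb qb).
rewrite !fv dist1_refl addr0 -mulrBl normrM gtr0_norm ?subr_gt0//.
by rewrite mulrC ler_pM2r// subr_gt0.
Qed.

Lemma flux_lip_ge0 : 0 <= LF.
Proof. exact: le_trans (speed_bound in_box_cst). Qed.
End Flux.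

Section Source.
Variable s : 'rV[R]_N -> 'rV[R]_m -> R.
Hypothesis s0 : forall q, s (const_mx rm) q = 0.
Hypothesis sL : source_lipschitz LS rm rM a b s.
Hypothesis slin : linear_in_density s.

(** The partial derivative in direction [j], written as a difference quotient across the whole range
    [[rm, rM]], at whose lower end [s] vanishes. In this form it inherits the Lipschitz bound of [s]
    in [q]. *)
Definition source_coef (j : 'I_N) q : R :=
  s (const_mx rm + (rM - rm) *: delta_mx 0 j) q / (rM - rm).

Let dir_affine (j : 'I_N) q : exists c : R, forall r h,
  s (r + h *: delta_mx 0 j) q = s r q + c * h.
Proof.
have [c hc] := slin j q; exists c => r h.
pose g (t : R) := s (r + t *: delta_mx 0 j) q - c * t.
have gE : g h = g 0.
  apply: is_derive_0_is_cst => t.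
  have dg : is_derive t (1 : R) (fun t => s (r + t *: delta_mx 0 j) q) c.
    have hct := hc (r + t *: delta_mx 0 j).
    (* [linear_in_density] gives the derivative at 0 only; taking [r + t *: delta_mx 0 j] as base
       point moves it to [t]. *)
    have e : (fun t : R => s (r + t *: delta_mx 0 j) q) =
      (fun h : R => s (r + t *: delta_mx 0 j + h *: delta_mx 0 j) q) \o (fun u : R => u - t).
      by apply/funext => u /=; rewrite -addrA -scalerDl subrKC.
    rewrite e; have ds : is_derive t (1 : R) (fun u : R => u - t) 1.
      by apply: is_derive_eq; rewrite subr0.
    have h0 : is_derive (t - t) (1 : R)
      (fun h : R => s (r + t *: delta_mx 0 j + h *: delta_mx 0 j) q) c by rewrite subrr.
    have := @is_derive1_comp R
      (fun h : R => s (r + t *: delta_mx 0 j + h *: delta_mx 0 j) q)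
      (fun u : R => u - t) t c 1 h0 ds.
    by rewrite mulr1.
  have dl : is_derive t (1 : R) (fun t : R => c * t) c.
    by apply: is_derive_eq; rewrite /GRing.scale/= mulr1.
  by have := is_deriveB dg dl; rewrite subrr.
by move: gE; rewrite /g scale0r addr0 mulr0 subr0 => <-; rewrite subrK.
Qed.

Let dr0 : rM - rm != 0. Proof. by rewrite subr_eq0 gt_eqF. Qed.

Let dir_coef (j : 'I_N) q r h :
  s (r + h *: delta_mx 0 j) q = s r q + source_coef j q * h.
Proof.
have [c hc] := dir_affine j q; rewrite hc /source_coef hc s0 add0r.
by rewrite mulfK.
Qed.

(** Starting from the constant vector [rm], where [s] vanishes, the coordinates are changed one
    after the other; each slope is independent of the base point. *)
Lemma source_affine r q : s r q = \sum_j source_coef j q * (r 0 j - rm).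
Proof.
have h (l : seq 'I_N) :
  s (const_mx rm + \sum_(j <- l) (r 0 j - rm) *: delta_mx 0 j) q =
  \sum_(j <- l) source_coef j q * (r 0 j - rm).
  elim: l => [|j l ih]; first by rewrite !big_nil addr0 s0.
  rewrite !big_cons addrCA addrC dir_coef ih addrC //.
rewrite -h; congr s; apply/rowP => i; rewrite mxE summxE mxE (bigD1 i)//= big1.
  by rewrite !mxE !eqxx mulr1 addr0 subrKC.
by move=> j ji; rewrite !mxE eq_sym (negbTE ji) andbF mulr0.
Qed.

Let in_box_bump (j : 'I_N) :
  in_box rm rM (const_mx rm + (rM - rm) *: delta_mx 0 j : 'rV[R]_N).
Proof.
move=> i; rewrite !mxE; set t : R := (_ && _)%:R.
have : t = 0 \/ t = 1 by rewrite /t; case: (_ && _); [right|left].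
by move: rmM => rmM' [->|->]; apply/andP; split; lra.
Qed.

Lemma source_coef_lip j q q' : in_box a b q -> in_box a b q' ->
  `|source_coef j q - source_coef j q'| <= LS / (rM - rm) * dist1 q q'.
Proof.
move=> qb qb'; have := sL (in_box_bump j) (in_box_bump j) qb qb'.
rewrite dist1_refl add0r /source_coef -mulrBl normrM normfV => h.
rewrite (gtr0_norm (_ : 0 < rM - rm)) ?subr_gt0//.
by rewrite mulrAC ler_pM2r ?invr_gt0 ?subr_gt0.
Qed.

Lemma source_coef_bound j q : in_box a b q -> `|source_coef j q| <= LS.
Proof.
move=> qb; have inc : in_box rm rM (const_mx rm : 'rV[R]_N).
  by move=> i; rewrite mxE lexx ltW.
have := sL (in_box_bump j) inc qb qb.
rewrite dist1_refl addr0 s0 subr0 /source_coef normrM normfV => h.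
rewrite (gtr0_norm (_ : 0 < rM - rm)) ?subr_gt0// ler_pdivrMr ?subr_gt0//.
apply: le_trans h _; rewrite le_eqVlt; apply/orP; left; apply/eqP; congr (_ * _).
rewrite /dist1 (bigD1 j)//= big1 ?addr0.
  by rewrite !mxE !eqxx mulr1 addrAC subrr add0r gtr0_norm// subr_gt0.
by move=> i ij; rewrite !mxE (negbTE ij) andbF mulr0 addr0 subrr normr0.
Qed.

End Source.
End Structure.

Lemma norm_sum_le (R : realType) (n : nat) (x : 'I_n -> R) (c : R) :
  (forall k, `|x k| <= c) -> `|\sum_k x k| <= n%:R * c.
Proof.
move=> xc; apply: le_trans (ler_norm_sum _ _ _) _.
apply: le_trans (ler_sum _ (fun k _ => xc k)) _.
by rewrite sumr_const card_ord mulr_natl.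
Qed.

Lemma sum_itv_le (R : realType) (n : nat) (x : 'I_n -> R) (lo hi : R) :
  (forall k, lo <= x k <= hi) -> n%:R * lo <= \sum_k x k <= n%:R * hi.
Proof.
move=> xc; apply/andP; split.
  rewrite mulr_natl -[X in _ *+ X]card_ord -sumr_const.
  by apply: ler_sum => k _; have /andP[] := xc k.
rewrite mulr_natl -[X in _ *+ X]card_ord -sumr_const.
by apply: ler_sum => k _; have /andP[] := xc k.
Qed.

Lemma dist1_vec_le (R : realType) (n : nat) (x y : 'I_n -> int -> R) (i j : int) (c : R) :
  (forall k, `|x k i - y k j| <= c) -> dist1 (vec x i) (vec y j) <= n%:R * c.
Proof.
move=> xc; rewrite /dist1.
apply: le_trans (ler_norm _) _; apply: norm_sum_le => k.
by rewrite !mxE normr_id.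
Qed.

(** * Growth of the range in one step *)

Section Step.
Context {R : realType} {N m : nat}.
Variables (F : 'I_N -> R -> 'rV[R]_m -> R) (V : 'I_N -> 'rV[R]_m -> R).
Variables (S : 'I_N -> 'rV[R]_N -> 'rV[R]_m -> R) (w : 'I_m -> 'I_N -> R -> R).
Variables (C delta rm rM eps LF LV LS M : R).
Hypotheses (hN : (1 <= N)%N) (rm0 : 0 <= rm) (rmM : rm < rM) (eps0 : 0 < eps).
Let a0 : R := rm - eps.
Let b0 : R := N%:R * rM + eps.
Hypothesis fL : forall k, flux_lipschitz LF rm rM a0 b0 (F k).
Hypothesis fv : forall k (r : R) q, F k r q = r * V k q.
Hypotheses (LV0 : 0 <= LV) (vL : forall k, speed_lipschitz LV a0 b0 (V k)).
Hypothesis s0 : forall k q, S k (const_mx rm) q = 0.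
Hypotheses (LS0 : 0 <= LS) (sL : forall k, source_lipschitz LS rm rM a0 b0 (S k)).
Hypothesis slin : forall k, linear_in_density (S k).
Hypothesis kw : forall l k, is_kernel (w l k).
Hypothesis wM : forall l k (a b : R), a <= b -> (total_variation a b (w l k) <= M%:E)%E.
Hypotheses (M0 : 0 <= M) (C0 : 0 <= C).
Variables (dx dt Lam eta : R).
Hypotheses (dx0 : 0 < dx) (dt0 : 0 < dt) (fits : forall l k, grid_fits dx (w l k)).
Hypothesis CFL : (dt / dx * LF) ^+ 2 + dt / dx * LF <= 4^-1.
(* If [LF = 0] the velocities vanish on the box, and [dt / dx] need not be bounded. *)
Hypotheses (Lam0 : 0 <= Lam) (hLam : LF = 0 \/ dt / dx <= Lam).
Hypotheses (eta0 : 0 <= eta) (eta1' : eta <= 1).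

Definition density_bound : R := rM + 1.
Local Notation B := density_bound.
(** The quadrature error with factor 4 and values up to [2 * B], because the slopes in the boundary
    terms may double them. *)
Definition quadrature_cst : R := 8 * (M + 1) * B.
Definition source_bound (b : R) : R := N%:R * (LS * (b + rm)).
(** Bounds [dt] times [Q]: the source part is of order [dt], and the flux slope contributes
    [dt / dx] times its cap. It tends to 0 with the step sizes, although [Q] itself may blow up. *)
Definition rate_bound : R := dt * source_bound B + Lam * (C * dx `^ delta).
Local Notation q0 := rate_bound.
(** Bounds the jump of the nonlocal terms between neighbouring nodes, divided by [dx]. The 20 is the
    factor 10 of [quadrature_diff] with values up to [2 * B]; the 5 belongs to [dt / 2] times the
    time derivative, where [dt * Q] is at most 1. *)
Definition nonlocal_lip : R := N%:R * (20 * (M + 1) * B + 5 * (M + 1)).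
Definition flux_cst (b : R) : R := b * (LV * (m%:R * nonlocal_lip)).
(** Collects the contributions of order [dt] to one staggered update: source and nonlocal variation
    of the flux, once through the half step, with [B], and once directly, with [B + 1]. *)
Definition growth_cst : R :=
  source_bound B + flux_cst B + flux_cst (B + 1) + source_bound (B + 1).
Local Notation K := growth_cst.

(** [small1] keeps the nonlocal terms at full steps within [eps / 2] of their range; [small3] leaves
    the other half of [eps] to the half step. *)
Hypothesis small1 : N%:R * (quadrature_cst * dx) + N%:R * eta <= eps / 2.
Hypothesis small2 : q0 <= 1.
Hypothesis small3 : N%:R * (q0 * (1 + 4 * (M + 1) * dx)) <= eps.

Let N0 : 1 <= N%:R :> R. Proof. by rewrite ler1n. Qed.
Let B1 : 1 <= B. Proof. by rewrite /density_bound; move: rm0 rmM; lra. Qed.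
Let B0 : 0 <= B. Proof. exact: le_trans B1. Qed.

Lemma box_rm_low : a0 <= rm. Proof. by rewrite /a0; move: eps0; lra. Qed.
Lemma box_rm_high : rm <= b0.
Proof.
rewrite /b0; have : rM <= N%:R * rM by rewrite ler_peMl//; move: rm0 rmM; lra.
by move: rmM eps0; lra.
Qed.

Let VB k q : in_box a0 b0 q -> `|V k q| <= LF.
Proof. by move=> qb; apply: (@speed_bound _ _ rm rM a0 b0 LF _ (F k)) => //. Qed.

Let LF0 : 0 <= LF.
Proof.
have q := @in_box_cst R m rm a0 b0 box_rm_low box_rm_high.
by case: N hN F V fL fv vL VB => // n _ F' V' _ _ _ VB'; exact: le_trans (VB' ord0 _ q).
Qed.

(** Only the difference of the densities carries [LF], the constant of the CFL condition; the rest
    is governed by the nonlocal terms, whose jumps are of order [dx]. *)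
Lemma flux_diff k (r r' Br : R) q q' : in_box a0 b0 q -> in_box a0 b0 q' ->
  `|r| <= Br -> `|F k r' q' - F k r q| <= LF * `|r' - r| + Br * (LV * dist1 q' q).
Proof.
move=> qb qb' rB; rewrite !fv.
have -> : r' * V k q' - r * V k q = (r' - r) * V k q' + r * (V k q' - V k q) by ring.
apply: le_trans (ler_normD _ _) _; rewrite !normrM; apply: lerD.
  by rewrite mulrC ler_wpM2r// VB.
by apply: ler_pM => //; exact: vL.
Qed.

Lemma flux_bound k (r Br : R) q : in_box a0 b0 q -> `|r| <= Br -> `|F k r q| <= Br * LF.
Proof. by move=> qb rB; rewrite fv normrM; apply: ler_pM => //; exact: VB. Qed.

Lemma source_le k (r : 'rV[R]_N) Br q : in_box a0 b0 q ->
  (forall i, `|r 0 i| <= Br) -> `|S k r q| <= source_bound Br.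
Proof.
move=> qb rB; rewrite (source_affine rmM (s0 k) (slin k)).
apply: norm_sum_le => j; rewrite normrM; apply: ler_pM => //.
  exact: (source_coef_bound rmM (s0 k) (sL k)).
apply: le_trans (ler_normB _ _) _; rewrite lerD//.
by rewrite ger0_norm.
Qed.

Let cM0 : 0 <= M + 1. Proof. by rewrite addr_ge0. Qed.

Let fluxc0 b : 0 <= b -> 0 <= flux_cst b.
Proof.
by move=> b0'; rewrite /flux_cst !mulr_ge0// /nonlocal_lip ?mulr_ge0// addr_ge0// !mulr_ge0.
Qed.
Let srcb0 b : 0 <= b -> 0 <= source_bound b.
Proof. by move=> b0'; rewrite /source_bound !mulr_ge0// addr_ge0. Qed.

Let B10 : 0 <= B + 1. Proof. by rewrite addr_ge0. Qed.

Section State.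
Variable rho : 'I_N -> int -> R.
Hypothesis rho_range : forall k j, rm - eta <= rho k j <= rM + eta.

Local Notation sl := (slope C delta dx).
Local Notation Rlk' := (Rlk w C delta dx rho).
Local Notation Rn' := (Rn w C delta dx rho).
Local Notation Q' := (Q F S w C delta dx rho).
Local Notation Rtlk' := (Rtlk F S w C delta dx rho).
Local Notation rh := (rho_half F S w C delta dx dt rho).
Local Notation Rh := (R_half F S w C delta dx dt rho).
Local Notation Fn k j := (F k (rho k j) (vec Rn' j)).
Local Notation Fh k j := (F k (rh k j) (vec Rh j)).
Local Notation Sh k j := (S k (vec rh j) (vec Rh j)).

Lemma state_bound k j : `|rho k j| <= B.
Proof.
have /andP[h1 h2] := rho_range k j; rewrite ler_norml /density_bound.
by apply/andP; split; move: rm0 rmM eta1' eta0; lra.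
Qed.
Let rB := state_bound.

Let sl4 k j : `|dx / 4 * sl (rho k) j| <= B.
Proof.
have := slope_bound delta C0 dx0 j (rB k).
by rewrite !ler_norml; lra.
Qed.

Let B2 : B <= 2 * B. Proof. by move: B0; lra. Qed.

Let ulB k j : `|rho k j + dx / 4 * sl (rho k) j| <= 2 * B.
Proof.
by rewrite (le_trans (ler_normD _ _))//; have := rB k j; have := sl4 k j; lra.
Qed.

Let urB k j : `|rho k j - dx / 4 * sl (rho k) j| <= 2 * B.
Proof.
by rewrite (le_trans (ler_normB _ _))//; have := rB k j; have := sl4 k j; lra.
Qed.

Let u2B k j : `|rho k j| <= 2 * B. Proof. exact: le_trans (rB k j) B2. Qed.

Lemma Rlk_conv l k j : `|Rlk' l k j - kconv (w l k) dx (rho k) j| <= quadrature_cst * dx.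
Proof.
apply: le_trans (quadrature_kconv (kw l k) (wM l k) dx0 (fits l k) (ulB k) (u2B k) (urB k) j) _.
by rewrite le_eqVlt /quadrature_cst; apply/orP; left; apply/eqP; ring.
Qed.

Let Rlk_diff l k j : `|Rlk' l k (j + 1) - Rlk' l k j| <= 20 * (M + 1) * B * dx.
Proof.
apply: le_trans (quadrature_diff (kw l k) (wM l k) dx0 (fits l k) (ulB k) (u2B k) (urB k) j) _.
by rewrite le_eqVlt; apply/orP; left; apply/eqP; ring.
Qed.

Let Rn_range l j : rm - eps / 2 <= Rn' l j <= N%:R * rM + eps / 2.
Proof.
have h k : rm - eta - quadrature_cst * dx <= Rlk' l k j <= rM + eta + quadrature_cst * dx.
  have := Rlk_conv l k j; have := kconv_bounds (kw l k) dx0 j (rho_range k).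
  by rewrite ler_norml => /andP[h1 h2] /andP[h3 h4]; apply/andP; split; lra.
have /andP[h1 h2] := sum_itv_le h; rewrite /Rn.
(* The sum of [N] averages is bounded below in terms of [N * rm], whereas the box starts at
   [rm - eps]; nonnegativity of [rm] closes the gap. *)
have rmN : rm <= N%:R * rm by rewrite ler_peMl.
by apply/andP; split; move: small1; lra.
Qed.

Lemma Rn_box j : in_box a0 b0 (vec Rn' j).
Proof.
move=> l; rewrite mxE /a0 /b0; have /andP[h1 h2] := Rn_range l j.
by apply/andP; split; move: eps0; lra.
Qed.

Let Rn_diff l j : `|Rn' l (j + 1) - Rn' l j| <= nonlocal_lip * dx.
Proof.
rewrite /Rn -sumrB /nonlocal_lip -mulrA; apply: norm_sum_le => k.
apply: le_trans (Rlk_diff l k j) _.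
by rewrite ler_wpM2r ?(ltW dx0)// lerDl mulr_ge0.
Qed.

Let flux_dist k j : `|Fn k (j + 1) - Fn k j| <=
  LF * `|rho k (j + 1) - rho k j| + flux_cst B * dx.
Proof.
apply: le_trans (flux_diff k _ (Rn_box j) (Rn_box (j + 1)) (rB k j)) _.
rewrite lerD2l /flux_cst -mulrA ler_wpM2l// -mulrA ler_wpM2l//.
by rewrite -mulrA; apply: dist1_vec_le => l; exact: Rn_diff.
Qed.

Local Notation sg k j := (flux_slope F w C delta dx rho k j).

Let lam0 : 0 <= dt / dx. Proof. by rewrite divr_ge0// ltW. Qed.

Let sigE k j : dt * `|sg k j| = dt / dx * `|dx * sg k j|.
Proof. by rewrite [`|dx * _|]normrM (gtr0_norm dx0) mulrA divfK// gt_eqF. Qed.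

(** [dt] times the slope is [dt / dx] times the scaled slope, to which the cap applies. If [LF = 0],
    the speed vanishes on the box and the flux slope with it, which replaces the missing bound on
    [dt / dx]. *)
Let sig_small k j : dt * `|sg k j| <= Lam * (C * dx `^ delta).
Proof.
rewrite sigE; case: hLam => [L0|hl].
  have -> : sg k j = 0.
    apply: slope_eq0 => // i; rewrite fv.
    have : `|V k (vec Rn' i)| <= 0 by rewrite -L0 VB//; exact: Rn_box.
    by rewrite normr_le0 => /eqP->; rewrite mulr0.
  by rewrite mulr0 normr0 mulr0 !mulr_ge0// powR_ge0.
by apply: ler_pM => //; have [_ _] := slope_le delta C0 dx0 (fun j => Fn k j) j.
Qed.

Let lamdx (x : R) : dt / dx * (x * dx) = dt * x.
Proof. by field; rewrite gt_eqF. Qed.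

(** The right difference at [j] used here and the left difference at [j + 1] used in [sig_right] are
    the same jump; this lets the jump be factored out when neighbouring half-step values are
    compared. *)
Let sig_left k j : dt * `|sg k j| <=
  dt / dx * LF * `|rho k (j + 1) - rho k j| + dt * flux_cst B.
Proof.
rewrite sigE; have [h _ _] := slope_le delta C0 dx0 (fun j => Fn k j) j.
apply: le_trans (ler_wpM2l lam0 (le_trans h (flux_dist k j))) _.
by rewrite mulrDr lamdx mulrA.
Qed.

Let sig_right k j : dt * `|sg k (j + 1)| <=
  dt / dx * LF * `|rho k (j + 1) - rho k j| + dt * flux_cst B.
Proof.
rewrite sigE; have [_ h _] := slope_le delta C0 dx0 (fun j => Fn k j) (j + 1).
move: h; rewrite addrK => h.
apply: le_trans (ler_wpM2l lam0 (le_trans h (flux_dist k j))) _.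
by rewrite mulrDr lamdx mulrA.
Qed.

Let Sn_bound k j : `|S k (vec rho j) (vec Rn' j)| <= source_bound B.
Proof. by apply: source_le; [exact: Rn_box|move=> i; rewrite mxE]. Qed.

Let Q_small k j : dt * `|Q' k j| <= q0.
Proof.
apply: le_trans (_ : dt * (`|S k (vec rho j) (vec Rn' j)| + `|sg k j|) <= _).
  by rewrite ler_pM2l// ler_normB.
by rewrite mulrDr lerD// ler_pM2l.
Qed.

Lemma rho_half_close k j : `|rh k j - rho k j| <= q0 / 2.
Proof.
rewrite /rho_half addrAC subrr add0r normrM (gtr0_norm (_ : 0 < dt / 2)) ?divr_gt0//.
by have := Q_small k j; lra.
Qed.

Lemma rho_half_bound k j : `|rh k j| <= B + 1.
Proof.
have := rho_half_close k j; have := rB k j; rewrite !ler_norml.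
by move: small2 => h /andP[h1 h2] /andP[h3 h4]; apply/andP; split; lra.
Qed.

(** The bound degenerates with [dt]; this is harmless because [Q] enters the nonlocal half step only
    through [dt / 2]. *)
Let QB k j : `|Q' k j| <= q0 / dt.
Proof. by rewrite ler_pdivlMr// mulrC Q_small. Qed.

Let Rt_bound l k j : `|dt / 2 * Rtlk' l k j| <= q0 * (1 + 4 * (M + 1) * dx) / 2.
Proof.
rewrite normrM (gtr0_norm (_ : 0 < dt / 2)) ?divr_gt0//.
have := quadrature_bound (kw l k) (wM l k) dx0 (fits l k) (QB k) (QB k) (QB k) j.
rewrite -(ler_pM2l (_ : 0 < dt / 2)) ?divr_gt0// => /le_trans; apply.
by rewrite le_eqVlt; apply/orP; left; apply/eqP; field; rewrite gt_eqF.
Qed.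

Let Rt_diff l k j : `|dt / 2 * Rtlk' l k (j + 1) - dt / 2 * Rtlk' l k j| <=
  5 * (M + 1) * dx.
Proof.
rewrite -mulrBr normrM (gtr0_norm (_ : 0 < dt / 2)) ?divr_gt0//.
have := quadrature_diff (kw l k) (wM l k) dx0 (fits l k) (QB k) (QB k) (QB k) j.
rewrite -(ler_pM2l (_ : 0 < dt / 2)) ?divr_gt0// => /le_trans; apply.
have -> : dt / 2 * (10 * (M + 1) * (q0 / dt) * dx) = q0 * (5 * (M + 1) * dx).
  by field; rewrite gt_eqF.
by rewrite ler_piMl// !mulr_ge0// ltW.
Qed.

Lemma R_half_close l j : `|Rh l j - Rn' l j| <=
  N%:R * (q0 * (1 + 4 * (M + 1) * dx) / 2).
Proof.
rewrite /R_half /Rn -sumrB; apply: norm_sum_le => k.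
by rewrite addrAC subrr add0r; exact: Rt_bound.
Qed.

Lemma R_half_box j : in_box a0 b0 (vec Rh j).
Proof.
move=> l; rewrite mxE /a0 /b0; have /andP[h1 h2] := Rn_range l j.
have := R_half_close l j; rewrite ler_norml => /andP[h3 h4].
by apply/andP; split; move: small3 eps0; lra.
Qed.

Let Rh_diff l j : `|Rh l (j + 1) - Rh l j| <= nonlocal_lip * dx.
Proof.
rewrite /R_half -sumrB /nonlocal_lip -mulrA; apply: norm_sum_le => k.
rewrite opprD addrACA; apply: le_trans (ler_normD _ _) _.
by rewrite mulrDl; apply: lerD; [exact: Rlk_diff|exact: Rt_diff].
Qed.

Lemma flux_half_bound k j : `|Fh k j| <= (B + 1) * LF.
Proof. by apply: flux_bound; [exact: R_half_box|exact: rho_half_bound]. Qed.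

Lemma source_half_bound k j : `|Sh k j| <= source_bound (B + 1).
Proof. by apply: source_le; [exact: R_half_box|move=> i; rewrite mxE rho_half_bound]. Qed.

Let fluxh_dist k j : `|Fh k (j + 1) - Fh k j| <=
  LF * `|rh k (j + 1) - rh k j| + flux_cst (B + 1) * dx.
Proof.
apply: le_trans (flux_diff k _ (R_half_box j) (R_half_box (j + 1)) (rho_half_bound k j)) _.
rewrite lerD2l /flux_cst -mulrA; apply: ler_wpM2l => //.
rewrite -mulrA; apply: ler_wpM2l => //.
by rewrite -mulrA; apply: dist1_vec_le => l; exact: Rh_diff.
Qed.

Let al := dt / dx * LF.
Let al0 : 0 <= al. Proof. by rewrite mulr_ge0. Qed.
Let al1 : al <= 1. Proof. by move: CFL; rewrite -/al => h; nra. Qed.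

Lemma growth_cst_ge0 : 0 <= K.
Proof.
rewrite /growth_cst; apply: addr_ge0; last exact: srcb0.
apply: addr_ge0; last exact: fluxc0.
by apply: addr_ge0; [exact: srcb0|exact: fluxc0].
Qed.

(** Each of the two flux slopes enters with weight [dt / 2] and contributes half of [al] times the
    jump, together the factor [1 + al]. Multiplied by [al] in the flux of the full step, it makes
    the stability condition quadratic in [al]. *)
Let rh_diff k j : `|rh k (j + 1) - rh k j| <=
  (1 + al) * `|rho k (j + 1) - rho k j| + dt * (source_bound B + flux_cst B).
Proof.
rewrite /rho_half /Q.
set D := rho k (j + 1) - rho k j.
set s1 := S k _ _; set s2 := S k _ _.
have h1 : `|s1| <= source_bound B by exact: Sn_bound.
have h2 : `|s2| <= source_bound B by exact: Sn_bound.
have g1 := sig_right k j; have g2 := sig_left k j.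
move: (sg k (j + 1)) (sg k j) g1 g2 => x1 x2 g1 g2.
have -> : rho k (j + 1) + dt / 2 * (s1 - x1) - (rho k j + dt / 2 * (s2 - x2)) =
  D + dt / 2 * s1 - dt / 2 * s2 - dt / 2 * x1 + dt / 2 * x2.
  by rewrite /D; ring.
apply: le_trans (ler_normD _ _) _.
apply: le_trans (lerD (ler_normB _ _) (lexx _)) _.
apply: le_trans (lerD (lerD (ler_normB _ _) (lexx _)) (lexx _)) _.
apply: le_trans (lerD (lerD (lerD (ler_normD _ _) (lexx _)) (lexx _)) (lexx _)) _.
rewrite !normrM !(gtr0_norm dt0) normfV (ger0_norm (_ : 0 <= 2 :> R))//.
have d1 : dt * `|s1| <= dt * source_bound B by rewrite ler_pM2l.
have d2 : dt * `|s2| <= dt * source_bound B by rewrite ler_pM2l.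
by move: g1 g2; rewrite -/al -/D; lra.
Qed.

Lemma stag_close k j :
  `|rho_stag F S w C delta dx dt rho k j - (rho k j + rho k (j + 1)) / 2| <=
  `|rho k (j + 1) - rho k j| / 2 + K * dt.
Proof.
rewrite /rho_stag.
set D := rho k (j + 1) - rho k j.
have -> : forall x y z t : R, x + y - z + t - x = y - z + t by move=> *; ring.
(* Two limited slopes, each at most the jump after scaling by [dx], with weight 1/8. *)
have hs : `|dx / 8 * (sl (rho k) j - sl (rho k) (j + 1))| <= `|D| / 4.
  have [h1 _ _] := slope_le delta C0 dx0 (rho k) j.
  have [_ h2 _] := slope_le delta C0 dx0 (rho k) (j + 1).
  rewrite addrK -/D in h2; rewrite -/D in h1.
  have -> : dx / 8 * (sl (rho k) j - sl (rho k) (j + 1)) =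
    (dx * sl (rho k) j) / 8 - (dx * sl (rho k) (j + 1)) / 8 by ring.
  apply: le_trans (ler_normB _ _) _; rewrite !(normrM _ 8^-1) (ger0_norm (_ : 0 <= 8^-1))//.
  by lra.
have hf : `|dt / dx * (Fh k (j + 1) - Fh k j)| <=
   al * ((1 + al) * `|D| + dt * (source_bound B + flux_cst B)) + dt * flux_cst (B + 1).
  rewrite normrM (ger0_norm lam0).
  apply: le_trans (ler_wpM2l lam0 (fluxh_dist k j)) _.
  rewrite mulrDr lamdx lerD2r mulrA -/al; apply: ler_wpM2l => //; exact: rh_diff.
have hS : `|dt / 2 * (Sh k (j + 1) + Sh k j)| <= dt * source_bound (B + 1).
  rewrite normrM (gtr0_norm (_ : 0 < dt / 2)) ?divr_gt0//.
  rewrite -mulrA ler_pM2l//.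
  have := ler_normD (Sh k (j + 1)) (Sh k j).
  by have := source_half_bound k (j + 1); have := source_half_bound k j; lra.
apply: le_trans (ler_normD _ _) _.
apply: le_trans (lerD (ler_normB _ _) (lexx _)) _.
apply: le_trans (lerD (lerD hs hf) hS) _.
have c1 : al * (1 + al) <= 4^-1 by move: CFL; rewrite -/al; lra.
have c2 : al * (1 + al) * `|D| <= 4^-1 * `|D| by rewrite ler_wpM2r.
have c3 : al * (dt * (source_bound B + flux_cst B)) <= dt * (source_bound B + flux_cst B).
  by rewrite ler_piMl// mulr_ge0 ?(ltW dt0)// addr_ge0 ?fluxc0 ?srcb0.
rewrite /growth_cst.
by rewrite mulrDr mulrA; lra.
Qed.

(** A point within half the gap of the midpoint lies between [x] and [y]; the excess [e] adds to
    both ends. *)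
Lemma avg_itv (x y z lo hi e : R) : `|z - (x + y) / 2| <= `|y - x| / 2 + e ->
  lo <= x <= hi -> lo <= y <= hi -> lo - e <= z <= hi + e.
Proof.
move=> h /andP[x1 x2] /andP[y1 y2]; move: h; rewrite ler_norml => /andP[z1 z2].
have [xy|/ltW yx] := leP x y.
  by move: z1 z2; rewrite ger0_norm ?subr_ge0//; lra.
by move: z1 z2; rewrite ler0_norm ?subr_le0//; lra.
Qed.

Lemma stag_range lo hi : (forall k j, lo <= rho k j <= hi) ->
  forall k j, lo - K * dt <= rho_stag F S w C delta dx dt rho k j <= hi + K * dt.
Proof. by move=> h k j; apply: avg_itv (stag_close k j) _ _. Qed.

(** Only the staggered update widens the range. The projection involves no flux: its slope
    correction is at most a quarter of the jump, so the new value lies between two staggered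
    values. *)
Lemma NT_step_range lo hi : (forall k j, lo <= rho k j <= hi) ->
  forall k j, lo - K * dt <= NT_step F S w C delta dx dt rho k j <= hi + K * dt.
Proof.
move=> h k j; have st := stag_range h k.
set u := rho_stag F S w C delta dx dt rho k.
suff hz : `|NT_step F S w C delta dx dt rho k j - (u (j - 1) + u j) / 2| <=
    `|u j - u (j - 1)| / 2 + 0.
  by have := avg_itv hz (st (j - 1)) (st j); rewrite subr0 addr0.
have [_ h1 _] := slope_le delta C0 dx0 u j.
have [h2 _ _] := slope_le delta C0 dx0 u (j - 1).
rewrite subrK in h2.
have -> : NT_step F S w C delta dx dt rho k j =
  (u (j - 1) + u j) / 2 - dx / 8 * (sl u j - sl u (j - 1)) by [].
move: (u j) (u (j - 1)) (sl u j) (sl u (j - 1)) h1 h2 => x y s1 s2 h1 h2.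
rewrite [X in `|X|](_ : _ = - (dx / 8 * (s1 - s2))); last by ring.
rewrite normrN addr0.
have -> : dx / 8 * (s1 - s2) =
  (dx * s1) / 8 - (dx * s2) / 8 by ring.
apply: le_trans (ler_normB _ _) _; rewrite !(normrM _ 8^-1) (ger0_norm (_ : 0 <= 8^-1))//.
by have := normr_ge0 (x - y); lra.
Qed.

End State.
End Step.

(** * Weak form of one step *)

Section CellPairing.
Context {R : realType}.
Local Notation mu := (@lebesgue_measure R).
Variable h : R.
Hypothesis h0 : 0 < h.
Implicit Types (u v : int -> R) (psi : R -> R).

Definition pairing u psi : R := \int[mu]_x (pc h u x * psi x).

Definition bounded_seq u := exists B : R, forall i, `|u i| <= B.

Lemma bounded_seqD u v : bounded_seq u -> bounded_seq v ->
  bounded_seq (fun j => u j + v j).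
Proof.
move=> [A uA] [B vB]; exists (A + B) => i.
by rewrite (le_trans (ler_normD _ _))// lerD.
Qed.

Lemma bounded_seqZ c u : bounded_seq u -> bounded_seq (fun j => c * u j).
Proof. by move=> [A uA]; exists (`|c| * A) => i; rewrite normrM ler_wpM2l. Qed.

Lemma bounded_seq_shift q u : bounded_seq u -> bounded_seq (fun j => u (j + q)).
Proof. by move=> [A uA]; exists A => i. Qed.

Lemma L1_pairing u psi : bounded_seq u -> L1 psi -> L1 (fun x => pc h u x * psi x).
Proof.
move=> [B uB] pi; apply: (@L1_M _ B) => //; first exact: measurable_pc.
by move=> x; exact: uB.
Qed.

Lemma pairing_le u psi B : (forall i, `|u i| <= B) -> L1 psi ->
  `|pairing u psi| <= B * \int[mu]_x `|psi x|.
Proof.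
move=> uB pi; rewrite -RintegralZl//; last exact: L1_norm.
apply: L1_norm_le; [by apply: L1_pairing => //; exists B|exact/L1_Z/L1_norm|].
by move=> x; rewrite normrM ler_wpM2r//; exact: uB.
Qed.

Lemma pairingD u v psi : bounded_seq u -> bounded_seq v -> L1 psi ->
  pairing (fun j => u j + v j) psi = pairing u psi + pairing v psi.
Proof.
move=> bu bv pi; rewrite /pairing -RintegralD//; [|exact: L1_pairing|exact: L1_pairing].
by apply: eq_Rintegral => x _; rewrite /pc mulrDl.
Qed.

Lemma pairingZ c u psi : bounded_seq u -> L1 psi ->
  pairing (fun j => c * u j) psi = c * pairing u psi.
Proof.
move=> bu pi; rewrite /pairing -RintegralZl//; last exact: L1_pairing.
by apply: eq_Rintegral => x _; rewrite /pc mulrA.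
Qed.

Lemma pairing_shift q u psi : bounded_seq u -> L1 psi ->
  pairing (fun j => u (j + q)) psi = pairing u (fun x => psi (x - q%:~R * h)).
Proof.
move=> bu pi; rewrite /pairing.
have fi : L1 (fun x => pc h u x * psi (x - q%:~R * h)).
  by apply: L1_pairing => //; exact: (Rintegrable_shift (- (q%:~R * h)) pi).
rewrite -(Rintegral_shift (q%:~R * h) fi); apply: eq_Rintegral => x _.
by rewrite addrK pc_shift.
Qed.

Lemma pairingDr u psi1 psi2 : bounded_seq u -> L1 psi1 -> L1 psi2 ->
  pairing u (fun x => psi1 x + psi2 x) = pairing u psi1 + pairing u psi2.
Proof.
move=> bu p1 p2; rewrite /pairing -RintegralD//; [|exact: L1_pairing|exact: L1_pairing].
by apply: eq_Rintegral => x _; rewrite mulrDr.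
Qed.

Lemma pairingBr u psi1 psi2 : bounded_seq u -> L1 psi1 -> L1 psi2 ->
  pairing u (fun x => psi1 x - psi2 x) = pairing u psi1 - pairing u psi2.
Proof.
move=> bu p1 p2; rewrite /pairing -RintegralB//; [|exact: L1_pairing|exact: L1_pairing].
by apply: eq_Rintegral => x _; rewrite mulrBr.
Qed.

Lemma pairingZr c u psi : bounded_seq u -> L1 psi ->
  pairing u (fun x => c * psi x) = c * pairing u psi.
Proof.
move=> bu pi; rewrite /pairing -RintegralZl//; last exact: L1_pairing.
by apply: eq_Rintegral => x _; rewrite mulrCA.
Qed.

Section Step.
Variables (lam dt : R) (r G H f g : int -> R).
Hypotheses (br : bounded_seq r) (bG : bounded_seq G) (bH : bounded_seq H)
  (bf : bounded_seq f) (bg : bounded_seq g).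

(* [G] and [H] stand for [dx] times the slopes of the cell values and of the
   staggered values, [f] and [g] for the half-step fluxes and sources. *)
Definition staggered (j : int) : R := (r j + r (j + 1)) / 2 + (G j - G (j + 1)) / 8
  - lam * (f (j + 1) - f j) + dt / 2 * (g (j + 1) + g j).

Definition projected (j : int) : R :=
  (staggered (j - 1) + staggered j) / 2 - (H j - H (j - 1)) / 8.

Let sp psi (x : R) := psi (x + h).
Let sm psi (x : R) := psi (x - h).

Local Ltac bdd := repeat first [ assumption | apply: bounded_seqD | apply: bounded_seqZ
  | apply: bounded_seq_shift ].

(** Summation by parts: index shifts pass to the test function. The two successive averages give the
    weights 1/4, 1/2, 1/4, and of the fluxes only those at [j - 1] and [j + 1] remain. *)
Lemma pairing_projected psi : L1 psi ->
  pairing projected psi =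
    (pairing r (sp psi) + 2 * pairing r psi + pairing r (sm psi)) / 4
    + (pairing G (sp psi) - pairing G (sm psi)) / 16
    - (pairing H psi - pairing H (sp psi)) / 8
    + lam / 2 * (pairing f (sp psi) - pairing f (sm psi))
    + dt / 4 * (pairing g (sp psi) + 2 * pairing g psi + pairing g (sm psi)).
Proof.
move=> pi.
have -> : projected = fun j =>
  4^-1 * r (j + (- 1)) + (2^-1 * r j + (4^-1 * r (j + 1) +
  (16^-1 * G (j + (- 1)) + ((- 16^-1) * G (j + 1) +
  ((- 8^-1) * H j + (8^-1 * H (j + (- 1)) +
  ((- (lam / 2)) * f (j + 1) + (lam / 2 * f (j + (- 1)) +
  (dt / 4 * g (j + (- 1)) + (dt / 2 * g j + dt / 4 * g (j + 1))))))))))).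
  apply/funext => j; rewrite /projected /staggered subrK.
  by field.
do 11 (rewrite pairingD; [|by bdd|by bdd|by []]).
rewrite !pairingZ//; try by bdd.
rewrite !pairing_shift//.
have e1 : (fun x => psi (x - (-1)%:~R * h)) = sp psi.
  by apply/funext => x; rewrite /sp mulN1r opprK.
have e2 : (fun x => psi (x - 1%:~R * h)) = sm psi.
  by apply/funext => x; rewrite /sm mul1r.
rewrite !e1 !e2.
by field.
Qed.

Lemma norm_pairing_diff_le u psi1 psi2 B c : (forall i, `|u i| <= B) ->
  L1 psi1 -> L1 psi2 -> \int[mu]_x `|psi1 x - psi2 x| <= c ->
  `|pairing u psi1 - pairing u psi2| <= B * c.
Proof.
move=> uB p1 p2 pc_; rewrite -pairingBr//; last by exists B.
apply: le_trans (pairing_le uB (L1_B p1 p2)) _.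
by rewrite ler_wpM2l// (le_trans _ (uB 0)).
Qed.

Variables (Br c Bf Bg : R).
Hypotheses (rB : forall i, `|r i| <= Br) (GB : forall i, `|G i| <= c)
  (HB : forall i, `|H i| <= c) (fB : forall i, `|f i| <= Bf) (gB : forall i, `|g i| <= Bg).
Hypotheses (lamE : lam = dt / h) (dt0 : 0 <= dt).

Let L1p psi : L1 psi -> L1 (sp psi). Proof. exact: Rintegrable_shift. Qed.
Let L1m psi : L1 psi -> L1 (sm psi). Proof. exact: (Rintegrable_shift (- h)). Qed.

(** The shifts of [psi] are measured in L1 only, so that indicators of intervals are admissible,
    with [K = 2]. The term of order [h] comes from averaging and slopes. *)
Lemma projected_variation psi K : L1 psi ->
  \int[mu]_x `|sp psi x - psi x| <= K * h ->
  \int[mu]_x `|sm psi x - psi x| <= K * h ->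
  `|pairing projected psi - pairing r psi| <=
    K * h * (Br / 2 + c / 4) + dt * (Bf * K + Bg * \int[mu]_x `|psi x|).
Proof.
move=> pi Kp Km; rewrite pairing_projected//.
have P1 u B : (forall i, `|u i| <= B) -> `|pairing u (sp psi) - pairing u psi| <= B * (K * h).
  by move=> uB; apply: norm_pairing_diff_le => //; exact: L1p.
have P2 u B : (forall i, `|u i| <= B) -> `|pairing u (sm psi) - pairing u psi| <= B * (K * h).
  by move=> uB; apply: norm_pairing_diff_le => //; exact: L1m.
have r1 := P1 _ _ rB; have r2 := P2 _ _ rB; have G1 := P1 _ _ GB; have G2 := P2 _ _ GB.
have H1 := P1 _ _ HB; have f1 := P1 _ _ fB; have f2 := P2 _ _ fB.
have g0 := pairing_le gB pi.
have g1 : `|pairing g (sp psi)| <= Bg * \int[mu]_x `|psi x|.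
  apply: le_trans (pairing_le gB (L1p pi)) _.
  by rewrite (Rintegral_shift h (L1_norm pi)).
have g2 : `|pairing g (sm psi)| <= Bg * \int[mu]_x `|psi x|.
  apply: le_trans (pairing_le gB (L1m pi)) _.
  by rewrite (Rintegral_shift (- h) (L1_norm pi)).
have lf : lam * (Bf * (K * h)) = dt * (Bf * K) by rewrite lamE; field; rewrite gt_eqF.
have lam0 : 0 <= lam by rewrite lamE divr_ge0// ltW.
have f3 : `|lam / 2 * (pairing f (sp psi) - pairing f (sm psi))| <= dt * (Bf * K).
  rewrite normrM (ger0_norm (_ : 0 <= lam / 2)) ?divr_ge0//.
  have : `|pairing f (sp psi) - pairing f (sm psi)| <= 2 * (Bf * (K * h)).
    by move: f1 f2; rewrite !ler_norml; lra.
  move=> /(ler_wpM2l (_ : 0 <= lam / 2)); rewrite divr_ge0// => /(_ isT).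
  by move=> /le_trans; apply; rewrite -lf; lra.
have g3 : `|dt / 4 * (pairing g (sp psi) + 2 * pairing g psi + pairing g (sm psi))| <=
    dt * (Bg * \int[mu]_x `|psi x|).
  rewrite normrM (ger0_norm (_ : 0 <= dt / 4)) ?divr_ge0//.
  have : `|pairing g (sp psi) + 2 * pairing g psi + pairing g (sm psi)| <=
      4 * (Bg * \int[mu]_x `|psi x|).
    by move: g0 g1 g2; rewrite !ler_norml; lra.
  move=> /(ler_wpM2l (_ : 0 <= dt / 4)); rewrite divr_ge0// => /(_ isT).
  by move=> /le_trans; apply; lra.
by move: r1 r2 G1 G2 H1 f3 g3; rewrite !ler_norml; lra.
Qed.

(** With [e] from the modulus of continuity of the derivative, a merely C1 test function has second
    differences of size [e * h], and centred differences equal to [2 * h * psi'] up to [2 * h * e].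
    The function [chi] is a common majorant that localises all errors. *)
Lemma projected_consistency psi psi' chi e L : L1 psi -> L1 psi' -> L1 chi ->
  (forall x, `|sp psi x - 2 * psi x + sm psi x| <= e * h * chi x) ->
  (forall x, `|sp psi x - psi x| <= L * h * chi x) ->
  (forall x, `|sp psi x - sm psi x| <= 2 * L * h * chi x) ->
  (forall x, `|sp psi x - sm psi x - 2 * h * psi' x| <= 2 * h * e * chi x) ->
  `|pairing projected psi - pairing r psi -
     dt * (pairing f psi' + pairing g psi)| <=
    \int[mu]_x chi x * (Br * e * h / 4 + c * L * h / 4 + dt * e * (Bf + Bg * h / 4)).
Proof.
move=> pi pi' ci h2 h1 h1' hd.
set I := \int[mu]_x chi x.
have P u B z (q : R) : (forall i, `|u i| <= B) -> L1 z -> (forall x, `|z x| <= q * chi x) ->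
    `|pairing u z| <= B * (q * I).
  move=> uB zi zq; apply: le_trans (pairing_le uB zi) _.
  rewrite ler_wpM2l//; first by rewrite (le_trans _ (uB 0)).
  rewrite /I -RintegralZl//; apply: le_Rintegral => //; [exact: L1_norm|exact: L1_Z].
have d2i : L1 (fun x => sp psi x - 2 * psi x + sm psi x).
  by apply: L1_D; [apply: L1_B; [exact: L1p|exact: L1_Z]|exact: L1m].
have d1i : L1 (fun x => sp psi x - psi x) by apply: L1_B => //; exact: L1p.
have d1i' : L1 (fun x => sp psi x - sm psi x) by apply: L1_B; [exact: L1p|exact: L1m].
have ddi : L1 (fun x => sp psi x - sm psi x - 2 * h * psi' x).
  by apply: L1_B => //; exact: L1_Z.
have E2 u : bounded_seq u -> pairing u (fun x => sp psi x - 2 * psi x + sm psi x) =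
    pairing u (sp psi) - 2 * pairing u psi + pairing u (sm psi).
  move=> bu; rewrite pairingDr//; [|by apply: L1_B; [exact: L1p|exact: L1_Z]|exact: L1m].
  by rewrite pairingBr//; [rewrite pairingZr|exact: L1p|exact: L1_Z].
have r1 := P _ _ _ _ rB d2i h2; rewrite E2// in r1.
have g1 := P _ _ _ _ gB d2i h2; rewrite E2// in g1.
have G1 := P _ _ _ _ GB d1i' h1'; rewrite pairingBr// in G1; [|exact: L1p|exact: L1m].
have H1 := P _ _ _ _ HB d1i h1; rewrite pairingBr// in H1; last exact: L1p.
have f1 := P _ _ _ _ fB ddi hd.
have Ef : pairing f (fun x => sp psi x - sm psi x - 2 * h * psi' x) =
    pairing f (sp psi) - pairing f (sm psi) - 2 * h * pairing f psi'.
  rewrite -(pairingZr _ bf pi') -(pairingBr bf (L1p pi) (L1m pi)).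
  by rewrite -(pairingBr bf d1i' (L1_Z (2 * h) pi')).
rewrite Ef in f1.
(* [dt / (2 * h)] is [lam / 2], the weight of the centred flux difference in [pairing_projected]. *)
have f2 : `|dt / (2 * h) * (pairing f (sp psi) - pairing f (sm psi) - 2 * h * pairing f psi')| <=
    dt * (Bf * e * I).
  rewrite normrM (ger0_norm (_ : 0 <= dt / (2 * h))); last first.
    by rewrite divr_ge0// mulr_ge0// ltW.
  have D0 : 0 <= dt / (2 * h) by rewrite divr_ge0// mulr_ge0// ltW.
  apply: le_trans (ler_wpM2l D0 f1) _.
  by rewrite le_eqVlt; apply/orP; left; apply/eqP; field; rewrite gt_eqF.
have g2 : `|dt / 4 * (pairing g (sp psi) - 2 * pairing g psi + pairing g (sm psi))| <=
    dt / 4 * (Bg * (e * h * I)).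
  by rewrite normrM (ger0_norm (_ : 0 <= dt / 4)) ?divr_ge0// ler_wpM2l// divr_ge0.
have f3 : dt / (2 * h) * (pairing f (sp psi) - pairing f (sm psi) - 2 * h * pairing f psi') =
  lam / 2 * (pairing f (sp psi) - pairing f (sm psi)) - dt * pairing f psi'.
  by rewrite lamE; field; rewrite gt_eqF.
rewrite f3 in f2.
rewrite pairing_projected//.
by move: r1 g2 G1 H1 f2; rewrite !ler_norml; lra.
Qed.

End Step.
End CellPairing.

(** * The strip and test functions *)

Section StripFubini.
Context {R : realType}.
Local Notation mu := (@lebesgue_measure R).
Variable T : R.

Let mstrip : measurable (strip T : set (measurableTypeR R * measurableTypeR R)).
Proof. by apply: measurableX => //; exact: measurable_itv. Qed.

Section Fubini.
Variable g : R * R -> R.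
Hypothesis gi : mu2.-integrable (strip T) (EFin \o g).

Let g' := (EFin \o g) \_ (strip T).

Let g'i : mu2.-integrable setT g'.
Proof. exact/(integrable_mkcond _ mstrip). Qed.

Let g'E t x : `]0, T[%classic t -> g' (t, x) = (g (t, x))%:E.
Proof. by move=> tT; rewrite /g' patchE mem_set. Qed.

Let g'0 t x : ~ `]0, T[%classic t -> g' (t, x) = 0%E.
Proof. by move=> tT; rewrite /g' patchE memNset// => -[]. Qed.

Let mt : measurable (`]0, T[%classic : set R). Proof. exact: measurable_itv. Qed.

Lemma strip_section_ae : {ae mu, forall t, `]0, T[%classic t -> L1 (fun x => g (t, x))}.
Proof.
have [A [mA A0 sA]] := @ae_integrable1 _ _ _ _ R mu mu g' g'i.
exists A; split => //; apply: subset_trans sA; apply: subsetC => t ht tT.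
move: ht => /=; rewrite (_ : (fun y => g' (t, y)) = EFin \o (fun x => g (t, x)))//.
by apply/funext => x; rewrite g'E.
Qed.

(** Where a section is not integrable, the inner real-valued integral may take a default value; it
    agrees with the extended one almost everywhere, which is enough. *)
Lemma strip_fubini :
  \int[mu2]_(p in strip T) g p = \int[mu]_(t in `]0, T[) \int[mu]_x g (t, x).
Proof.
rewrite /Rintegral; congr fine.
have e1 : (\int[mu2]_(p in strip T) (g p)%:E = \int[mu2]_p g' p)%E.
  by rewrite integral_mkcond.
rewrite e1 -(@integral12_prod_meas1 _ _ _ _ R mu mu g' g'i).
rewrite [RHS]integral_mkcond.
apply: ae_eq_integral => //.
- exact: (@measurable_fubini_F _ _ _ _ R mu mu g' g'i).
- apply/(measurable_restrictT _ mt)/measurable_EFinP.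
  apply: measurableT_comp => //.
  have := @measurable_fubini_F _ _ _ _ R mu mu g' g'i.
  move=> /(measurable_funS measurableT (subsetT `]0, T[%classic)).
  apply: eq_measurable_fun => t; rewrite inE => tT.
  by apply: eq_integral => x _; rewrite g'E.
- have := strip_section_ae; apply: filterS; first exact: (ae_filter_ringOfSetsType mu).
  move=> t ht _; rewrite patchE /fubini_F; case: ifPn => [|].
    rewrite inE => tT; rewrite EFin_Rintegral//; last exact: ht.
    by apply: eq_integral => x _; rewrite g'E.
  move=> /negP; rewrite inE => tT; rewrite integral0_eq// => x _.
  by rewrite g'0.
Qed.

End Fubini.

Lemma strip_section_integrable (g : R * R -> R) : mu2.-integrable (strip T) (EFin \o g) ->
  Rintegrable mu `]0, T[ (fun t => \int[mu]_x g (t, x)).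
Proof.
move=> gi; have g'i := (integrable_mkcond _ mstrip).1 gi.
have mt : measurable (`]0, T[%classic : set (measurableTypeR R)) by exact: measurable_itv.
have Fi := @integrable_fubini_F _ _ _ _ R mu mu _ g'i.
have Fi' := @integrableS _ _ R mu setT _ _ measurableT mt (@subsetT _ _) Fi.
have FE t : `]0, T[%classic t -> fubini_F mu ((EFin \o g) \_ (strip T)) t =
    (\int[mu]_x (g (t, x))%:E)%E.
  by move=> tT; apply: eq_integral => x _; rewrite patchE mem_set.
apply: le_integrable (Fi') => //.
- apply/measurable_EFinP; apply: measurableT_comp => //.
  apply: eq_measurable_fun (measurable_int _ Fi') => t; rewrite inE => tT.
  exact: (FE t tT).
- move=> t tT.
  apply: (@le_trans _ _ `|(\int[mu]_x (g (t, x))%:E)|%E); last first.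
    by rewrite -(FE t tT); exact: lexx.
  rewrite /= /Rintegral.
  by case: (\int[mu]_x (g (t, x))%:E)%E => [s| |] //=; rewrite normr0 leey.
Qed.

End StripFubini.

(** * Uniform continuity and measurability on the plane *)

Section UniformContinuity.
Context {R : realType}.
Implicit Types (f : R * R -> R) (A : set (R * R)).

Definition ucont f := forall e, 0 < e -> exists2 d, 0 < d &
  forall p q : R * R, `|p.1 - q.1| < d -> `|p.2 - q.2| < d -> `|f p - f q| <= e.

(** Compactness gives one [d] for all [p] in [A]. If only [q] lies in [A], the two points are
    exchanged; if neither does, both values are 0. *)
Lemma compact_support_ucont f A : continuous f -> compact A ->
  (forall p, ~ A p -> f p = 0) -> ucont f.
Proof.
move=> cf cA fA e e0.
pose P (d : R) (p : R * R) :=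
  forall q : R * R, `|p.1 - q.1| < d -> `|p.2 - q.2| < d -> `|f p - f q| <= e.
have nc : \forall d \near (0:R)^'+, A `<=` P d.
  apply: ((compact_near_coveringP A).1 cA) => p Ap.
  have e2 : 0 < e / 2 by rewrite divr_gt0.
  have := cf p; move/cvgrPdist_lt => /(_ _ e2) /nbhs_ballP[r /= r0 rb].
  have r2 : 0 < r / 2 by rewrite divr_gt0.
  exists (ball p (r / 2), [set d | 0 < d < r / 2]).
    split => /=; first by apply/nbhs_ballP; exists (r / 2).
    near=> d; apply/andP; split; near: d; first exact: nbhs_right_gt.
    exact: nbhs_right_lt.
  move=> [p' d] /= [[b1 b2] /andP[d0 dr]] q /= q1 q2.
  have fp : `|f p - f p'| < e / 2.
    apply: rb; split; rewrite /ball/= in b1 b2 *; rewrite /ball_/= in b1 b2 *.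
      by apply: lt_trans b1 _; lra.
    by apply: lt_trans b2 _; lra.
  have fq : `|f p - f q| < e / 2.
    apply: rb; split; rewrite /ball/= in b1 b2 *; rewrite /ball_/= in b1 b2 *.
      by move: (ler_distD p'.1 p.1 q.1); lra.
    by move: (ler_distD p'.2 p.2 q.2); lra.
  by move: (ler_distD (f p) (f p') (f q)); rewrite (distrC (f p') (f p)); lra.
have [d [d0 Ad]] : exists d : R, 0 < d /\ A `<=` P d.
  near (0:R)^'+ => d; exists d; split; last by near: d.
  by near: d; exact: nbhs_right_gt.
exists d => // p q pq1 pq2.
have [Ap|nAp] := pselect (A p); first exact: Ad.
have [Aq|nAq] := pselect (A q).
  by rewrite distrC; apply: (Ad q Aq); rewrite distrC.
by rewrite !fA// subrr normr0 ltW.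
Unshelve. all: by end_near. Qed.

Lemma compact_continuous_bounded f A : continuous f -> compact A ->
  exists2 L, 0 < L & forall p, A p -> `|f p| <= L.
Proof.
move=> cf cA; have cfA : compact (f @` A).
  by apply: continuous_compact => //; exact: continuous_subspaceT.
have [M [_ hM]] := @compact_bounded R R _ cfA.
exists (`|M| + 1); first by rewrite ltr_wpDl.
move=> p Ap; apply: (hM (`|M| + 1)); last by exists p.
by rewrite (le_lt_trans (ler_norm _))// ltrDl.
Qed.

Lemma grid_close (x : R) (n : nat) :
  `|(cell_idx n.+1%:R^-1 x)%:~R * n.+1%:R^-1 - x| <= n.+1%:R^-1.
Proof.
have n0 : 0 < n.+1%:R^-1 :> R by rewrite invr_gt0.
have /andP[h1 h2] := cell_idx_bounds n0 x.
rewrite mulrBl in h1; rewrite mulrDl in h2.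
by move: (n.+1%:R^-1) n0 h1 h2 => h n0 h1 h2; rewrite ler_norml; lra.
Qed.

Lemma measurable_grid (a : int -> int -> R) (h1 h2 : R) : 0 < h1 -> 0 < h2 ->
  measurable_fun [set: measurableTypeR R * measurableTypeR R]
    (fun p => a (cell_idx h1 p.1) (cell_idx h2 p.2)).
Proof.
move=> h10 h20.
apply: (@measurable_countable_family _ _ R (int * int)%type
  (fun p => (cell_idx h1 p.1, cell_idx h2 p.2)) (fun i _ => a i.1 i.2)) => // -[i j].
rewrite (_ : _ @^-1` _ = (cell h1 i : set R) `*` (cell h2 j : set R)).
  by apply: measurableX; exact: measurable_cell.
by rewrite -!cell_preimage//; apply/seteqP; split => -[x y] /=; [case|move=> [-> ->]].
Qed.

(** [f] is the limit of functions constant on grid rectangles, which yields measurability for the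
    product sigma-algebra directly. *)
Lemma ucont_measurable f : ucont f ->
  measurable_fun [set: measurableTypeR R * measurableTypeR R] f.
Proof.
move=> uf.
pose g (n : nat) (p : R * R) := f ((cell_idx n.+1%:R^-1 p.1)%:~R * n.+1%:R^-1,
  (cell_idx n.+1%:R^-1 p.2)%:~R * n.+1%:R^-1).
apply: (@measurable_fun_cvg _ _ _ setT g) => [n|p _].
  have n0 : 0 < n.+1%:R^-1 :> R by rewrite invr_gt0.
  exact: (measurable_grid (fun i j => f (i%:~R * n.+1%:R^-1, j%:~R * n.+1%:R^-1)) n0 n0).
apply/cvgrPdist_le => e e0.
have [d d0 fd] := uf e e0.
near=> n.
have nd : n.+1%:R^-1 < d by near: n; exact: (near_infty_natSinv_lt (PosNum d0)).
by rewrite distrC; apply: fd; apply: le_lt_trans nd; exact: grid_close.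
Unshelve. all: by end_near. Qed.

Lemma ucont_measurable_section f t : ucont f -> measurable_fun setT (fun x => f (t, x)).
Proof.
move=> /ucont_measurable mf.
exact: (measurableT_comp mf (pair1_measurable (t : measurableTypeR R))).
Qed.

End UniformContinuity.

Section TestFunction.
Context {R : realType}.
Variables (T : R) (phi : R * R -> R).
Hypothesis hphi : C1_compact T phi.

Let A := closure [set p | phi p != 0].

Let phi0 p : ~ A p -> \forall q \near p, phi q = 0.
Proof.
move=> nA; have oA : open (~` A) by rewrite openC; exact: closed_closure.
have := open_nbhs_nbhs (conj oA nA : open_nbhs p (~` A)).
apply: filterS => q nAq; apply/eqP/negPn/negP => h.
by apply: nAq; exact: subset_closure.
Qed.

Let near_pair1 (P : set (R * R)) (p : R * R) : nbhs p P -> \forall t \near p.1, P (t, p.2).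
Proof.
move=> /nbhs_ballP[r /= r0 h]; apply/nbhs_ballP; exists r => // t bt.
by apply: h; split => //=; exact: ballxx.
Qed.

Let near_pair2 (P : set (R * R)) (p : R * R) : nbhs p P -> \forall x \near p.2, P (p.1, x).
Proof.
move=> /nbhs_ballP[r /= r0 h]; apply/nbhs_ballP; exists r => // t bt.
by apply: h; split => //=; exact: ballxx.
Qed.

(** The complement of the closed support is open, so [phi] vanishes in a neighbourhood of [p] and
    its derivatives vanish at [p]. *)
Let out p : ~ A p -> [/\ phi p = 0, dt_ phi p = 0 & dx_ phi p = 0].
Proof.
move=> nA; have n0 := phi0 nA; split.
- exact: nbhs_singleton n0.
- rewrite /dt_ derive1E (@near_eq_derive _ _ _ _ (cst 0)).
    by rewrite derive_cst.
  exact: (near_pair1 n0).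
- rewrite /dx_ derive1E (@near_eq_derive _ _ _ _ (cst 0)).
    by rewrite derive_cst.
  exact: (near_pair2 n0).
Qed.

Let cA : compact A. Proof. by case: hphi. Qed.

Let ct : continuous (dt_ phi). Proof. by case: hphi. Qed.
Let cx : continuous (dx_ phi). Proof. by case: hphi. Qed.

Let dt_d p : is_derive p.1 (1 : R) (fun t => phi (t, p.2)) (dt_ phi p).
Proof.
case: hphi => /(_ p)[d1 _] _ _ _ _.
by rewrite /dt_ derive1E; exact: derivableP.
Qed.

Let dx_d p : is_derive p.2 (1 : R) (fun x => phi (p.1, x)) (dx_ phi p).
Proof.
case: hphi => /(_ p)[_ d2] _ _ _ _.
by rewrite /dx_ derive1E; exact: derivableP.
Qed.

Lemma test_MVT_t (a b x : R) : a <= b -> exists c, a <= c <= b /\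
  phi (b, x) - phi (a, x) = dt_ phi (c, x) * (b - a).
Proof.
move=> ab.
have [||c] := @MVT_segment R (fun t => phi (t, x)) (fun t => dt_ phi (t, x)) a b ab.
- by move=> t _; exact: (dt_d (t, x)).
- apply: derivable_within_continuous => t _.
  by have := dt_d (t, x) => /= h; exact: ex_derive.
- by rewrite in_itv/= => cab e; exists c.
Qed.

Lemma test_MVT_x (t a b : R) : a <= b -> exists c, a <= c <= b /\
  phi (t, b) - phi (t, a) = dx_ phi (t, c) * (b - a).
Proof.
move=> ab.
have [||c] := @MVT_segment R (fun x => phi (t, x)) (fun x => dx_ phi (t, x)) a b ab.
- by move=> x _; exact: (dx_d (t, x)).
- apply: derivable_within_continuous => x _.
  by have := dx_d (t, x) => /= h; exact: ex_derive.
- by rewrite in_itv/= => cab e; exists c.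
Qed.

Lemma test_ucont_dt : ucont (dt_ phi).
Proof. by apply: (compact_support_ucont ct cA) => p /out[]. Qed.

Lemma test_ucont_dx : ucont (dx_ phi).
Proof. by apply: (compact_support_ucont cx cA) => p /out[]. Qed.

Lemma test_bounds : exists XL : R * R, [/\ 0 < XL.1, 0 < XL.2,
  forall p : R * R, XL.1 <= `|p.2| \/ T <= p.1 ->
     [/\ phi p = 0, dt_ phi p = 0 & dx_ phi p = 0] &
  forall p, `|dt_ phi p| <= XL.2 /\ `|dx_ phi p| <= XL.2].
Proof.
have [X X0 hX] := @compact_continuous_bounded R snd A (fun p => @cvg_snd _ _ _ _ _) cA.
have [L1 L10 hL1] := compact_continuous_bounded ct cA.
have [L2 L20 hL2] := compact_continuous_bounded cx cA.
exists (X + 1, L1 + L2) => /=; split; [lra|lra| |].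
  move=> p hp; apply: out => Ap; case: hp.
    by have := hX p Ap; lra.
  by case: hphi => _ _ _ _ /(_ p Ap)/= /andP[_]; lra.
move=> p; have [Ap|/out[_ -> ->]] := pselect (A p); last by rewrite normr0; lra.
by have := hL1 p Ap; have := hL2 p Ap; lra.
Qed.

Lemma test_lipschitz L : (forall p, `|dt_ phi p| <= L /\ `|dx_ phi p| <= L) ->
  forall p q : R * R, `|phi p - phi q| <= L * `|p.1 - q.1| + L * `|p.2 - q.2|.
Proof.
move=> hL.
have lt a b x : `|phi (b, x) - phi (a, x)| <= L * `|b - a|.
  have [ab|/ltW ba] := leP a b.
    have [c [_ ->]] := test_MVT_t x ab.
    by rewrite normrM ler_wpM2r//; have [] := hL (c, x).
  have [c [_ e]] := test_MVT_t x ba.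
  by rewrite distrC e normrM distrC ler_wpM2r//; have [] := hL (c, x).
have lx t a b : `|phi (t, b) - phi (t, a)| <= L * `|b - a|.
  have [ab|/ltW ba] := leP a b.
    have [c [_ ->]] := test_MVT_x t ab.
    by rewrite normrM ler_wpM2r//; have [] := hL (t, c).
  have [c [_ e]] := test_MVT_x t ba.
  by rewrite distrC e normrM distrC ler_wpM2r//; have [] := hL (t, c).
move=> [t x] [s y] /=.
apply: le_trans (ler_distD (phi (s, x)) _ _) _.
by apply: lerD.
Qed.

Lemma test_ucont : ucont phi.
Proof.
have [[X L] /= [_ L0 _ hL]] := test_bounds.
move=> e e0; have d0 : 0 < e / (2 * L) by rewrite divr_gt0// mulr_gt0.
exists (e / (2 * L)) => // p q h1 h2.
apply: le_trans (test_lipschitz hL p q) _.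
have l1 : L * `|p.1 - q.1| <= L * (e / (2 * L)) by rewrite ler_pM2l// ltW.
have l2 : L * `|p.2 - q.2| <= L * (e / (2 * L)) by rewrite ler_pM2l// ltW.
have e2 : L * (e / (2 * L)) = e / 2 by field; rewrite gt_eqF.
by move: l1 l2; rewrite e2; lra.
Qed.

End TestFunction.

Section WeakStarStrip.
Context {R : realType}.
Local Notation mu := (@lebesgue_measure R).
Local Notation T2 := (measurableTypeR R * measurableTypeR R)%type.
Variables (T B : R) (u : nat -> R * R -> R) (r : R * R -> R).
Hypotheses (mu_ : forall i, measurable_fun [set: T2] (u i)) (mr : measurable_fun [set: T2] r).
Hypotheses (uB : forall i p, `|u i p| <= B) (rB : forall p, `|r p| <= B).
Hypothesis u_r : forall t g, L1 g ->
  (fun i => \int[mu]_x (u i (t, x) * g x)) @ \oo --> \int[mu]_x (r (t, x) * g x).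

Let mstrip : measurable (strip T : set T2).
Proof. by apply: measurableX => //; exact: measurable_itv. Qed.

Let bg (v g : R * R -> R) : measurable_fun [set: T2] v -> (forall p, `|v p| <= B) ->
  mu2.-integrable (strip T) (EFin \o g) ->
  mu2.-integrable (strip T) (EFin \o (fun p => v p * g p)).
Proof.
move=> mv vB gi; apply: (@RintegrableM _ _ _ _ _ mstrip B) => //.
exact: measurable_funS mv.
Qed.

(** For almost every [t] the section of [g] is a legitimate test function in [x]. The integral in
    [t] converges by domination, with majorant [B] times the L1 norm of the section. *)
Lemma weak_star_of_sections : weak_star_cvg T u r.
Proof.
move=> g gi; rewrite (strip_fubini (bg mr rB gi)).
have -> : (fun i => \int[mu2]_(p in strip T) (u i p * g p)) =
    (fun i => \int[mu]_(t in `]0, T[) \int[mu]_x (u i (t, x) * g (t, x))).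
  by apply/funext => i; rewrite (strip_fubini (bg (mu_ i) (uB i) gi)).
have mt : measurable (`]0, T[%classic : set (measurableTypeR R)) by exact: measurable_itv.
have mF (v : R * R -> R) (mv : measurable_fun [set: T2] v) (vB : forall p, `|v p| <= B) :
    measurable_fun (`]0, T[%classic : set (measurableTypeR R))
      (fun t => \int[mu]_x (v (t, x) * g (t, x))).
  exact: Rintegrable_measurable (strip_section_integrable (bg mv vB gi)).
have ni : mu2.-integrable (strip T) (EFin \o (fun p => `|g p|)) by exact: integrable_norm.
have Gi := strip_section_integrable ni.
have sec := strip_section_ae gi.
have dom (v : R * R -> R) (t : R) : (forall p, `|v p| <= B) -> measurable_fun [set: T2] v ->
    L1 (fun x => g (t, x)) ->
    `|\int[mu]_x (v (t, x) * g (t, x))| <= B * \int[mu]_x `|g (t, x)|.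
  move=> vB mv gt; rewrite -RintegralZl//; last exact: L1_norm.
  have mvt : measurable_fun setT (fun x => v (t, x)).
    exact: (measurableT_comp mv (pair1_measurable (t : measurableTypeR R))).
  apply: L1_norm_le; [exact: (L1_M mvt (fun x => vB (t, x)))|exact/L1_Z/L1_norm|].
  by move=> x; rewrite normrM ler_wpM2r.
apply: (@Rintegral_dominated_cvg _ _ R mu _ mt _ _
  (fun t => B * \int[mu]_x `|g (t, x)|)).
- by move=> i; exact: mF.
- exact: mF.
- apply: filterS sec; first exact: (ae_filter_ringOfSetsType mu).
  by move=> t ht tT; exact: u_r (ht tT).
- exact: (RintegrableZ mt B Gi).
- apply: filterS sec; first exact: (ae_filter_ringOfSetsType mu).
  by move=> t ht tT i; exact: dom (ht tT).
Qed.

End WeakStarStrip.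

(** * Weak compactness at every time *)

Section TimeIndex.
Context {R : realType}.
Implicit Types (h t : R) (n : nat).

(* Capping the index freezes the approximation after the last admissible step, and
   [truncn] sends negative times to step 0: all times can be treated alike. *)
Definition time_idx h n t : nat := minn (Num.truncn (t / h)) n.

Lemma time_idx_le h n t : (time_idx h n t <= n)%N.
Proof. exact: geq_minr. Qed.

Lemma time_idx_mono h n t t' : 0 < h -> t <= t' -> (time_idx h n t <= time_idx h n t')%N.
Proof.
move=> h0 tt'; rewrite /time_idx;
have : (Num.truncn (t / h) <= Num.truncn (t' / h))%N.
  by apply: le_truncn; rewrite ler_pM2r// invr_gt0.
lia.
Qed.

(** The extra [h] is due to rounding: two close times may be separated by a step. *)
Lemma time_idx_close h n t t' : 0 < h -> t <= t' ->
  (time_idx h n t' - time_idx h n t)%:R * h <= t' - t + h.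
Proof.
move=> h0 tt'; set a := Num.truncn (t / h); set b := Num.truncn (t' / h).
have le1 : (time_idx h n t' - time_idx h n t <= b - a)%N by rewrite /time_idx; lia.
apply: (@le_trans _ _ ((b - a)%N%:R * h)).
  by rewrite ler_wpM2r ?ler_nat// ltW.
have [ba|ab] := leqP b a.
  by rewrite (eqP ba) mul0r addr_ge0 ?subr_ge0// ltW.
have ta : t / h < a.+1%:R by exact: truncnS_gt.
have t'0 : 0 <= t' / h.
  rewrite leNgt; apply/negP => t'0; suff : b = 0%N by lia.
  by apply/eqP; rewrite -leqn0 truncn_le_nat (lt_trans t'0).
have bt : b%:R <= t' / h by rewrite truncn_le.
rewrite natrB 1?ltnW// -ler_pdivlMr// mulrDl mulfV ?gt_eqF// mulrBl.
rewrite -natr1 in ta; lra.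
Qed.

Lemma measurable_time_idx h n i : 0 < h -> measurable (time_idx h n @^-1` [set i]).
Proof.
move=> h0.
have mT k : measurable [set t : R | (time_idx h n t <= k)%N].
  have [nk|kn] := leqP n k.
    rewrite (_ : [set _ | _] = setT)//; apply/seteqP; split => // t _ /=.
    exact: leq_trans (time_idx_le _ _ _) nk.
  rewrite (_ : [set _ | _] = `]-oo, (k.+1%:R * h)[%classic); first exact: measurable_itv.
  apply/seteqP; split => t /=; rewrite in_itv /= -ltr_pdivrMr// -truncn_le_nat /time_idx
    geq_min (leqNgt n k) kn orbF; exact: id.
have [i0|i0] := posnP i.
  have E : [set t : R | (time_idx h n t <= 0)%N] = time_idx h n @^-1` [set i].
    by apply/seteqP; split => x /=; lia.
  by have := mT 0%N; rewrite E.
have E : [set t : R | (time_idx h n t <= i)%N] `\` [set t | (time_idx h n t <= i.-1)%N] =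
    time_idx h n @^-1` [set i].
  by apply/seteqP; split => x /=; lia.
by have := measurableD (mT i) (mT i.-1); rewrite E.
Qed.

End TimeIndex.

Section Approximation.
Context {R : realType}.

Lemma cvgn_of_approx (x : nat -> R) :
  (forall e, 0 < e -> exists y : nat -> R, cvgn y /\ \forall n \near \oo, `|x n - y n| <= e) ->
  cvgn x.
Proof.
move=> ap; apply: cauchy_cvg; apply: cauchy_exP => e e0.
have e30 : 0 < e / 3 by rewrite divr_gt0.
have [y [cy xy]] := ap _ e30; exists (limn y).
move/cvgrPdist_le: cy => /(_ _ e30) cy.
change (\forall n \near \oo, ball (limn y) e (x n)).
near=> n; rewrite /ball/=.
have h1 : `|x n - y n| <= e / 3 by near: n.
have h2 : `|limn y - y n| <= e / 3 by near: n.
rewrite (_ : limn y - x n = (limn y - y n) - (x n - y n)); last by ring.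
rewrite (le_lt_trans (ler_normB _ _))//; lra.
Unshelve. all: by end_near. Qed.

End Approximation.

Section Subsequence.
Context {R : realType}.

Lemma increasing_seq_ge (sub : nat -> nat) n : increasing_seq sub -> (n <= sub n)%N.
Proof.
move=> inc; elim: n => // n ih; apply: (leq_ltn_trans ih).
by have /= := leqW_mono inc n n.+1; rewrite ltnSn => ->.
Qed.

Lemma cvg_increasing_seq (sub : nat -> nat) (u : nat -> R) (l : R) :
  increasing_seq sub -> u @ \oo --> l -> (fun n => u (sub n)) @ \oo --> l.
Proof.
move=> inc ul; apply: (cvg_comp sub u) ul => A [n _ nA]; exists n => // k /= nk.
by apply: nA => /=; exact: leq_trans nk (increasing_seq_ge _ inc).
Qed.

End Subsequence.

Section Clamp.
Context {R : realType}.

Definition clamp (B x : R) : R := Num.max (- B) (Num.min B x).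

Lemma clamp_bound B x : 0 <= B -> `|clamp B x| <= B.
Proof.
move=> B0; rewrite /clamp ler_norml le_max lexx /= ge_max ge_min lexx /=.
by rewrite andbT (le_trans _ B0)// oppr_le0.
Qed.

Lemma clamp_id B x : `|x| <= B -> clamp B x = x.
Proof. by rewrite ler_norml /clamp => /andP[h1 h2]; rewrite min_r// max_r. Qed.

Lemma measurable_clamp d (X : measurableType d) B (f : X -> R) : measurable_fun setT f ->
  measurable_fun setT (fun x => clamp B (f x)).
Proof.
move=> mf; apply: measurable_maxr; first exact: measurable_cst.
by apply: measurable_minr => //; exact: measurable_cst.
Qed.

End Clamp.

Section Compactness.
Context {R : realType} {N : nat}.
Local Notation mu := (@lebesgue_measure R).
Local Notation T2 := (measurableTypeR R * measurableTypeR R)%type.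
Variables (U : nat -> nat -> 'I_N -> int -> R) (dx dt : nat -> R) (nst : nat -> nat).
Variables (B k1 k2 : R).
Hypotheses (dx0 : forall i, 0 < dx i) (dt0 : forall i, 0 < dt i) (dtc : dt @ \oo --> 0).
Hypotheses (B0 : 0 < B) (k10 : 0 <= k1) (k20 : 0 <= k2).
Hypothesis UB : forall i n k j, (n <= nst i)%N -> `|U i n k j| <= B.
Hypothesis UV : forall i n k a b, (n < nst i)%N -> a <= b ->
  `|pairing (dx i) (U i n.+1 k) (\1_`]a, b]) - pairing (dx i) (U i n k) (\1_`]a, b])| <=
  dt i * (k1 + k2 * (b - a)).

Definition step_fun i k (p : R * R) : R :=
  pc (dx i) (U i (time_idx (dt i) (nst i) p.1) k) p.2.

Definition mass i k t a b : R := \int[mu]_x (step_fun i k (t, x) * \1_`]a, b] x).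

Lemma step_fun_bound i k p : `|step_fun i k p| <= B.
Proof. by apply: UB; exact: time_idx_le. Qed.

Lemma step_fun_measurable_section i k t : measurable_fun setT (fun x => step_fun i k (t, x)).
Proof. exact: (measurable_pc (dx0 i) (U i (time_idx (dt i) (nst i) t) k)). Qed.

Lemma measurable_time_family i (G : nat -> R -> R) : (forall q, measurable_fun setT (G q)) ->
  measurable_fun [set: T2] (fun p => G (time_idx (dt i) (nst i) p.1) p.2).
Proof.
move=> mG.
apply: (@measurable_countable_family _ T2 R nat
  (fun p => time_idx (dt i) (nst i) p.1) (fun q p => G q p.2)).
- move=> q; have := @measurable_fst _ _ (measurableTypeR R) (measurableTypeR R).
  move=> /(_ measurableT _ (measurable_time_idx (nst i) q (dt0 i))); rewrite setTI.
  exact.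
- move=> q; apply: (measurableT_comp (mG q)).
  exact: (@measurable_snd _ _ (measurableTypeR R) (measurableTypeR R)).
Qed.

Lemma step_fun_measurable i k : measurable_fun [set: T2] (step_fun i k).
Proof.
apply: (@measurable_time_family i (fun q => pc (dx i) (U i q k))) => q.
exact: (measurable_pc (dx0 i)).
Qed.

Lemma pairing_itv_le i (u : int -> R) a b : (forall j, `|u j| <= B) -> a <= b ->
  `|pairing (dx i) u (\1_`]a, b])| <= B * (b - a).
Proof.
move=> uB ab; rewrite -(Rintegral_indic_itv ab).
apply: le_trans (pairing_le (dx0 i) uB (Rintegrable_itv a b)) _.
rewrite le_eqVlt; apply/orP; left; apply/eqP; congr (_ * _).
by apply: eq_Rintegral => x _; rewrite indicE ger0_norm.
Qed.

Lemma pairing_itv_split i (u : int -> R) a b c : bounded_seq u -> a <= b -> b <= c ->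
  pairing (dx i) u (\1_`]a, c]) =
  pairing (dx i) u (\1_`]a, b]) + pairing (dx i) u (\1_`]b, c]).
Proof.
move=> bu ab bc; rewrite -pairingDr//; [|exact: Rintegrable_itv|exact: Rintegrable_itv].
by apply: eq_Rintegral => x _; rewrite (indic_oc_split x ab bc).
Qed.

Let bseq i q k : (q <= nst i)%N -> bounded_seq (U i q k).
Proof. by move=> qn; exists B => j; exact: UB. Qed.

Lemma mass_space i k t a b a' b' : a' <= a -> a <= b -> b <= b' ->
  `|mass i k t a' b' - mass i k t a b| <= B * ((a - a') + (b' - b)).
Proof.
move=> h1 h2 h3; rewrite /mass.
change (`|pairing (dx i) (U i (time_idx (dt i) (nst i) t) k) (\1_`]a', b']) -
  pairing (dx i) (U i (time_idx (dt i) (nst i) t) k) (\1_`]a, b])| <=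
  B * ((a - a') + (b' - b))).
set q := time_idx _ _ _; have bu := bseq k (time_idx_le (dt i) (nst i) t).
rewrite (pairing_itv_split _ bu h1 (le_trans h2 h3)) (pairing_itv_split _ bu h2 h3).
rewrite (_ : _ + (_ + _) - _ = pairing (dx i) (U i q k) (\1_`]a', a]) +
  pairing (dx i) (U i q k) (\1_`]b, b'])); last by rewrite addrCA [X in X - _]addrC addrK addrC.
rewrite (le_trans (ler_normD _ _))// mulrDr lerD//.
all: by apply: pairing_itv_le => // j; apply: UB; exact: time_idx_le.
Qed.

Lemma pairing_time i k q d a b : (q + d <= nst i)%N -> a <= b ->
  `|pairing (dx i) (U i (q + d) k) (\1_`]a, b]) - pairing (dx i) (U i q k) (\1_`]a, b])| <=
  d%:R * (dt i * (k1 + k2 * (b - a))).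
Proof.
move=> qd ab; elim: d qd => [|d ih] qd.
  by rewrite addn0 subrr normr0 mul0r.
rewrite addnS -natr1 mulrDl mul1r [leRHS]addrC.
rewrite (_ : _ - _ = (pairing (dx i) (U i (q + d).+1 k) (\1_`]a, b]) -
   pairing (dx i) (U i (q + d) k) (\1_`]a, b])) +
   (pairing (dx i) (U i (q + d) k) (\1_`]a, b]) - pairing (dx i) (U i q k) (\1_`]a, b]))).
  rewrite (le_trans (ler_normD _ _))// lerD//; first by apply: UV => //; lia.
  by apply: ih; lia.
by rewrite addrA subrK.
Qed.

(** The masses are step functions of time, hence Lipschitz only up to the term [dt i], which
    disappears in the limit. *)
Lemma mass_time i k t t' a b : t <= t' -> a <= b ->
  `|mass i k t' a b - mass i k t a b| <= (t' - t + dt i) * (k1 + k2 * (b - a)).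
Proof.
move=> tt' ab; have mono := time_idx_mono (nst i) (dt0 i) tt'.
have cl := time_idx_close (nst i) (dt0 i) tt'.
have le2 := time_idx_le (dt i) (nst i) t'.
set q := time_idx (dt i) (nst i) t in mono cl *.
set q' := time_idx (dt i) (nst i) t' in mono cl le2 *.
have := @pairing_time i k q (q' - q) a b; rewrite subnKC// => /(_ le2 ab) h.
apply: le_trans h _; rewrite mulrA; apply: ler_wpM2r; last exact: cl.
by rewrite addr_ge0// mulr_ge0// subr_ge0.
Qed.

Lemma mass_bound i k t a b : `|mass i k t a b| <= B * \int[mu]_x `|(\1_`]a, b] : R -> R) x|.
Proof.
apply: (@pairing_le _ _ (dx0 i) (U i (time_idx (dt i) (nst i) t) k)); last exact: Rintegrable_itv.
by move=> j; apply: UB; exact: time_idx_le.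
Qed.

Lemma mass_subsequence : exists2 sub, increasing_seq sub &
  forall k t a b, a <= b -> cvgn (fun i => mass (sub i) k t a b).
Proof.
(* Quadruples of a component, a rational time and two rational endpoints are coded by natural
   numbers; a number that is no code gets the constant sequence 0. *)
pose dec p : option ('I_N * rat * rat * rat)%type := unpickle p.
pose al i p := if dec p is Some (k, t, a, b) then mass i k (ratr t) (ratr a) (ratr b) else 0.
pose M p := if dec p is Some (k, t, a, b)
  then B * \int[mu]_x `|(\1_`]ratr a, ratr b] : R -> R) x| else 0.
have [sub inc cv] : exists2 sub, increasing_seq sub & forall p, cvgn (fun i => al (sub i) p).
  apply: (diagonal_subsequence (M := M)) => i p; rewrite /al /M.
  case: (dec p) => [[[[k t] a] b]|]; [exact: mass_bound|by rewrite normr0].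
exists sub => // k t a b ab; apply: cvgn_of_approx => e e0.
(* A rate bound for all intervals that exceed []a, b]] by at most 1 on either side. The rational
   time is chosen within [e1] after [t] and the rational endpoints within [e2] outside []a, b]];
   time and space each cost at most [e / 2]. *)
pose Kp := k1 + k2 * (b - a + 2).
have Kp0 : 0 <= Kp by rewrite addr_ge0// mulr_ge0// addr_ge0// subr_ge0.
pose e1 := e / (4 * (Kp + 1)).
have e10 : 0 < e1 by rewrite divr_gt0// mulr_gt0// ltr_wpDl.
pose e2 := Num.min 1 (e / (4 * B)).
have e20 : 0 < e2 by rewrite lt_min ltr01 /= divr_gt0// mulr_gt0.
have e21 : e2 <= 1 by rewrite ge_min lexx.
have e22 : e2 <= e / (4 * B) by rewrite ge_min lexx orbT.
have [|q] := @rat_in_itvoo R t (t + e1); first by rewrite ltrDl.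
rewrite in_itv /= => /andP[q1 q2].
have [|a'] := @rat_in_itvoo R (a - e2) a; first by rewrite ltrBlDr ltrDl.
rewrite in_itv /= => /andP[a1 a2].
have [|b'] := @rat_in_itvoo R b (b + e2); first by rewrite ltrDl.
rewrite in_itv /= => /andP[b1 b2].
exists (fun i => mass (sub i) k (ratr q) (ratr a') (ratr b')); split.
  by have := cv (pickle (k, q, a', b')); rewrite /al /dec pickleK.
have := cvg_increasing_seq inc dtc => /cvgrPdist_le /(_ _ e10); apply: filterS => i.
rewrite sub0r normrN gtr0_norm// => dte.
have ms := mass_space (sub i) k t (ltW a2) ab (ltW b1).
have ab' : ratr a' <= ratr b' :> R by rewrite (le_trans (ltW a2))// (le_trans ab)// ltW.
have mt := mass_time (sub i) k (ltW q1) ab'.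
rewrite (_ : mass (sub i) k t a b - _ =
  - (mass (sub i) k t (ratr a') (ratr b') - mass (sub i) k t a b) -
  (mass (sub i) k (ratr q) (ratr a') (ratr b') - mass (sub i) k t (ratr a') (ratr b')));
  last by ring.
apply: le_trans (ler_normB _ _) _; rewrite normrN.
have h1 : B * (a - ratr a' + (ratr b' - b)) <= e / 2.
  apply: (@le_trans _ _ (B * (2 * (e / (4 * B))))).
    by rewrite ler_pM2l//; move: a1 b2 e22; lra.
  by rewrite le_eqVlt; apply/orP; left; apply/eqP; field; rewrite gt_eqF.
have h2 : (ratr q - t + dt (sub i)) * (k1 + k2 * (ratr b' - ratr a')) <= e / 2.
  apply: (@le_trans _ _ ((2 * e1) * (Kp + 1))).
    apply: ler_pM.
    - by rewrite addr_ge0// ?subr_ge0 ltW.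
    - by rewrite addr_ge0// mulr_ge0// subr_ge0.
    - by move: q2 dte; lra.
    - rewrite /Kp -addrA lerD2l ler_wpDr// ler_wpM2l//.
      by move: a1 b2 e21; lra.
  rewrite /e1 le_eqVlt; apply/orP; left; apply/eqP; field.
  by rewrite gt_eqF// ltr_wpDl.
move: (lerD ms mt); lra.
Qed.

Section Limit.
Variable sub : nat -> nat.
Hypothesis mass_cvg : forall k t a b, a <= b -> cvgn (fun i => mass (sub i) k t a b).

Let nu k t a b : R := limn (fun i => mass (sub i) k t a b).

Let nu_cvg k t a b : a <= b -> (fun i => mass (sub i) k t a b) @ \oo --> nu k t a b.
Proof. exact: mass_cvg. Qed.

Let quot k n (p : R * R) : R := n.+1%:R * nu k p.1 p.2 (p.2 + n.+1%:R^-1).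

Let quot_bound k n p : `|quot k n p| <= B.
Proof.
have le : p.2 <= p.2 + n.+1%:R^-1 by rewrite lerDl.
rewrite /quot normrM ger0_norm// mulrC -ler_pdivlMr//.
have h := @seq_norm_le R (fun i => mass (sub i) k p.1 p.2 (p.2 + n.+1%:R^-1))
  _ (B / n.+1%:R) (@nu_cvg k p.1 _ _ le).
apply: h => i.
have := @pairing_itv_le (sub i) (U (sub i) (time_idx (dt (sub i)) (nst (sub i)) p.1) k) _ _
  (fun j => UB k j (time_idx_le (dt (sub i)) (nst (sub i)) p.1)) le.
by rewrite addrAC subrr add0r.
Qed.

(** In [t] the mass is constant on steps; in [x] it is Lipschitz, since moving the interval adds and
    removes pieces as long as the displacement. Together this gives joint measurability. *)
Let mass_measurable i k c : 0 <= c ->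
  measurable_fun [set: T2] (fun p => mass i k p.1 p.2 (p.2 + c)).
Proof.
move=> c0.
(* The cap by [nst i] makes the bound [UB] available for every [q]. *)
pose G q x := pairing (dx i) (U i (minn q (nst i)) k) (\1_`]x, x + c]).
have mG q : measurable_fun setT (G q).
  apply: continuous_measurable_fun; apply: (@lipschitz_continuous_line _ _ (2 * B)) => x y xy.
  have ub j : `|U i (minn q (nst i)) k j| <= B by apply: UB; exact: geq_minr.
  have bu : bounded_seq (U i (minn q (nst i)) k) by exists B.
  have h1 : x <= x + c by rewrite lerDl.
  have h2 : y <= y + c by rewrite lerDl.
  have h3 : x + c <= y + c by rewrite lerD2r.
  have e := pairing_itv_split i bu xy h2.
  rewrite (pairing_itv_split i bu h1 h3) in e.
  have b1 := pairing_itv_le i ub xy; have b2 := pairing_itv_le i ub h3.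
  rewrite /G (_ : _ - _ = pairing (dx i) (U i (minn q (nst i)) k) (\1_`]x + c, y + c]) -
    pairing (dx i) (U i (minn q (nst i)) k) (\1_`]x, y])); last by move: e; lra.
  by apply: le_trans (ler_normB _ _) _; move: b1 b2; lra.
have := @measurable_time_family i G mG.
apply: eq_measurable_fun => p _; rewrite /G /mass /pairing /step_fun /=.
by rewrite (minn_idPl (time_idx_le _ _ _)).
Qed.

Let quot_measurable k n : measurable_fun [set: T2] (quot k n).
Proof.
apply: measurable_funM; first exact: measurable_cst.
apply: (@measurable_fun_cvg _ _ _ _
  (fun i p => mass (sub i) k p.1 p.2 (p.2 + n.+1%:R^-1))) => [i|p _].
  by apply: mass_measurable.
by apply: nu_cvg; rewrite lerDl.
Qed.

(** The upper limit is measurable in [(t, x)] and equals the limit wherever the quotients converge;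
    the clamp provides the bound [B] at every point. *)
Let D k (p : R * R) : R := clamp B (limn_sup (quot k ^~ p)).

Let D_measurable k : measurable_fun [set: T2] (D k).
Proof.
apply: measurable_clamp; apply: (@measurable_fun_limn_sup _ T2 R setT (quot k)).
- move=> p _; exists B => _ [n _ <-].
  by rewrite (le_trans (ler_norm _))//; exact: quot_bound.
- move=> p _; exists (- B) => _ [n _ <-].
  by have := quot_bound k n p; rewrite ler_norml => /andP[].
- exact: quot_measurable.
Qed.

Let D_bound k p : `|D k p| <= B. Proof. by apply: clamp_bound; exact: ltW. Qed.

Let D_section k t : measurable_fun setT (fun x => D k (t, x)).
Proof. exact: (measurableT_comp (D_measurable k) (pair1_measurable (t : measurableTypeR R))). Qed.

Let D_mass k t a b : a <= b -> \int[mu]_x (D k (t, x) * \1_`]a, b] x) = nu k t a b.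
Proof.
apply: (@weak_limit_density R (fun i x => step_fun (sub i) k (t, x)) B) => //.
- by move=> i; exact: step_fun_measurable_section.
- by move=> i x; exact: step_fun_bound.
- by move=> c d; exact: nu_cvg.
- move=> x l ql; have qb := seq_norm_le ql (fun n => quot_bound k n (t, x)).
  by rewrite /D (cvg_limn_inf_sup ql).2 clamp_id.
Qed.

Lemma weak_limit_exists : exists rho : 'I_N -> R * R -> R,
  [/\ forall k, measurable_fun [set: T2] (rho k), forall k p, `|rho k p| <= B &
      forall k t g, L1 g -> (fun i => \int[mu]_x (step_fun (sub i) k (t, x) * g x)) @ \oo -->
        \int[mu]_x (rho k (t, x) * g x)].
Proof.
exists D; split => // k t g gi.
have si i (h : R -> R) : L1 h -> L1 (fun x => step_fun (sub i) k (t, x) * h x).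
  apply: (@L1_M _ B); first exact: step_fun_measurable_section.
  by move=> x; exact: step_fun_bound.
have Di (h : R -> R) : L1 h -> L1 (fun x => D k (t, x) * h x).
  by apply: (@L1_M _ B) => // x; exact: D_bound.
have E (h : R -> R) : L1 h ->
    (fun i => \int[mu]_x ((step_fun (sub i) k (t, x) - D k (t, x)) * h x)) =
    (fun i => \int[mu]_x (step_fun (sub i) k (t, x) * h x) - \int[mu]_x (D k (t, x) * h x)).
  move=> hi; apply/funext => i; rewrite -RintegralB//; [|exact: si|exact: Di].
  by apply: eq_Rintegral => x _; rewrite mulrBl.
(* The difference to the limit density is bounded by [B + B] and its masses tend to 0, so
   convergence extends from intervals to all integrable test functions. *)
have : weakly_null (fun i x => step_fun (sub i) k (t, x) - D k (t, x)) g.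
  apply: (@weakly_null_L1 _ _ (B + B)) => //.
  - move=> i; apply: measurable_funB; [exact: step_fun_measurable_section|exact: D_section].
  - move=> i x; rewrite (le_trans (ler_normB _ _))// lerD//; exact: step_fun_bound.
  - move=> a b ab; rewrite /weakly_null E; last exact: Rintegrable_itv.
    rewrite D_mass// -(subrr (nu k t a b)).
    by apply: cvgB; [exact: nu_cvg|exact: cvg_cst].
rewrite /weakly_null E// => h0.
set c := (X in _ --> X); have : (fun i => \int[mu]_x (step_fun (sub i) k (t, x) * g x) - c + c)
    @ \oo --> 0 + c by apply: cvgD => //; exact: cvg_cst.
by rewrite add0r; under eq_fun do rewrite subrK.
Qed.

End Limit.

Theorem weak_compactness : exists (sub : nat -> nat) (rho : 'I_N -> R * R -> R),
  [/\ increasing_seq sub,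
    forall k, measurable_fun [set: T2] (rho k), forall k p, `|rho k p| <= B &
      forall k t g, L1 g -> (fun i => \int[mu]_x (step_fun (sub i) k (t, x) * g x)) @ \oo -->
        \int[mu]_x (rho k (t, x) * g x)].
Proof.
have [sub inc cv] := mass_subsequence.
by have [rho [h1 h2 h3]] := weak_limit_exists cv; exists sub, rho.
Qed.

End Compactness.

(** * Test functions at a fixed time *)

Section TestSlice.
Context {R : realType}.
Local Notation mu := (@lebesgue_measure R).
Variables (T : R) (phi : R * R -> R) (X L : R).
Hypotheses (hphi : C1_compact T phi) (X0 : 0 < X) (L0 : 0 < L).
Hypothesis phiX : forall p : R * R, X <= `|p.2| \/ T <= p.1 ->
  [/\ phi p = 0, dt_ phi p = 0 & dx_ phi p = 0].
Hypothesis phiL : forall p, `|dt_ phi p| <= L /\ `|dx_ phi p| <= L.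

(* One unit wider than the support of [phi], to dominate also its differences with
   steps at most 1. *)
Definition window : R -> R := \1_`]- (X + 1), X + 1].

Lemma windowE x : window x = ((- (X + 1) < x <= X + 1)%R : bool)%:R.
Proof. exact: indic_ocE. Qed.

Lemma L1_window : L1 window. Proof. exact: Rintegrable_itv. Qed.

Lemma integral_window : \int[mu]_x window x = 2 * (X + 1).
Proof. rewrite Rintegral_indic_itv; first by ring. by move: X0; lra. Qed.

Lemma window_bound (x y K : R) : (X + 1 <= `|x| -> y = 0) -> `|y| <= K ->
  `|y| <= K * window x.
Proof.
move=> y0 yK; rewrite windowE; have [_|xout] := boolP (_ < x <= _); first by rewrite mulr1.
rewrite y0 ?normr0 ?mulr0//.
move: xout; rewrite negb_and -leNgt -ltNge => /orP[h|h].
  by rewrite ler0_norm; move: X0 h; lra.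
by rewrite ger0_norm; move: X0 h; lra.
Qed.

Lemma L1_of_window (f : R -> R) K : measurable_fun setT f ->
  (forall x, `|f x| <= K * window x) -> L1 f.
Proof. by move=> mf fK; apply: (L1_le mf fK); exact/L1_Z/L1_window. Qed.

Let far (x : R) : X + 1 <= `|x| -> X <= `|x|. Proof. by lra. Qed.

(** [phi] vanishes at [x = X], and a point of [[-X, X]] is at most [2 * X] away from it. *)
Lemma test_bound p : `|phi p| <= 2 * X * L.
Proof.
have [xX|Xx] := lerP `|p.2| X; last first.
  have [->] := phiX (or_introl (ltW Xx)).
  by rewrite normr0 !mulr_ge0// ltW.
have h : phi (p.1, X) = 0 by have [] := @phiX (p.1, X) (or_introl (ler_norm X)).
have := test_lipschitz hphi phiL p (p.1, X); rewrite h subr0 /= subrr normr0 mulr0 add0r.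
move=> h1; apply: le_trans h1 _; rewrite mulrC ler_wpM2r ?(ltW L0)//.
by rewrite (le_trans (ler_normB _ _))// (gtr0_norm X0); lra.
Qed.

Lemma test_window t x : `|phi (t, x)| <= 2 * X * L * window x.
Proof.
apply: window_bound; last exact: test_bound.
by move=> /far xX; have [] := @phiX (t, x) (or_introl xX).
Qed.

Lemma L1_test t : L1 (fun x => phi (t, x)).
Proof.
apply: (@L1_of_window _ (2 * X * L)).
  exact: (ucont_measurable_section t (test_ucont hphi)).
exact: test_window.
Qed.

Lemma dt_window t x : `|dt_ phi (t, x)| <= L * window x.
Proof.
apply: window_bound; last by have [] := phiL (t, x).
by move=> /far xX; have [] := @phiX (t, x) (or_introl xX).
Qed.

Lemma dx_window t x : `|dx_ phi (t, x)| <= L * window x.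
Proof.
apply: window_bound; last by have [] := phiL (t, x).
by move=> /far xX; have [] := @phiX (t, x) (or_introl xX).
Qed.

Lemma L1_dt t : L1 (fun x => dt_ phi (t, x)).
Proof.
apply: (@L1_of_window _ L); last exact: dt_window.
exact: (ucont_measurable_section t (test_ucont_dt hphi)).
Qed.

Lemma L1_dx t : L1 (fun x => dx_ phi (t, x)).
Proof.
apply: (@L1_of_window _ L); last exact: dx_window.
exact: (ucont_measurable_section t (test_ucont_dx hphi)).
Qed.

Let zero_near t x y (h : R) : `|y - x| <= h -> h <= 1 -> X + 1 <= `|x| -> phi (t, y) = 0.
Proof.
move=> yx h1 xX; have [] // := @phiX (t, y); left => /=.
have := lerB_dist x y; rewrite distrC => h2; move: yx h1 xX; lra.
Qed.

Let dx_zero t x : X + 1 <= `|x| -> dx_ phi (t, x) = 0.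
Proof. by move=> /far xX; have [] := @phiX (t, x) (or_introl xX). Qed.

Lemma test_differences e : 0 < e -> exists2 d, 0 < d & forall t h, 0 < h -> h < d -> h <= 1 ->
  [/\ forall x, `|phi (t, x + h) - 2 * phi (t, x) + phi (t, x - h)| <= e * h * window x,
      forall x, `|phi (t, x + h) - phi (t, x)| <= L * h * window x,
      forall x, `|phi (t, x + h) - phi (t, x - h)| <= 2 * L * h * window x &
      forall x, `|phi (t, x + h) - phi (t, x - h) - 2 * h * dx_ phi (t, x)| <=
        2 * h * e * window x].
Proof.
move=> e0; have [d d0 hd] := test_ucont_dx hphi e0.
(* Two mean value points may be [2 * h] apart, hence [d / 2]. *)
exists (d / 2) => [|t h h0 hd' h1]; first by rewrite divr_gt0.
have hp x : `|x + h - x| <= h by rewrite addrAC subrr add0r gtr0_norm.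
have hm x : `|x - h - x| <= h by rewrite addrAC subrr add0r normrN gtr0_norm.
have h00 x : `|x - x| <= h by rewrite subrr normr0 ltW.
have close (x y : R) : `|x - y| <= 2 * h -> `|dx_ phi (t, x) - dx_ phi (t, y)| <= e.
  by move=> xy; apply: hd; rewrite /= ?subrr ?normr0//; lra.
split=> x.
- apply: window_bound.
    by move=> xX; rewrite !(@zero_near t x _ h)//; ring.
  have [|c1 [/andP[c1l c1r] e1]] := @test_MVT_x _ _ _ hphi t x (x + h); first by rewrite lerDl ltW.
  have [|c2 [/andP[c2l c2r] e2]] := @test_MVT_x _ _ _ hphi t (x - h) x.
    by rewrite gerBl ltW.
  rewrite (_ : _ + _ = (dx_ phi (t, c1) - dx_ phi (t, c2)) * h); last by move: e1 e2; nra.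
  rewrite normrM (gtr0_norm h0) ler_wpM2r ?(ltW h0)//; apply: close.
  by rewrite ger0_norm; lra.
- apply: window_bound.
    by move=> xX; rewrite !(@zero_near t x _ h)//; ring.
  have := test_lipschitz hphi phiL (t, x + h) (t, x).
  by rewrite /= subrr normr0 mulr0 add0r addrAC subrr add0r (gtr0_norm h0).
- apply: window_bound.
    by move=> xX; rewrite !(@zero_near t x _ h)//; ring.
  have := test_lipschitz hphi phiL (t, x + h) (t, x - h).
  rewrite /= subrr normr0 mulr0 add0r (_ : x + h - (x - h) = 2 * h); last by ring.
  by rewrite normrM (gtr0_norm h0) ger0_norm// mulrA (mulrC L).
- apply: window_bound.
    by move=> xX; rewrite !(@zero_near t x _ h)// dx_zero//; ring.
  have [|c [/andP[cl cr] ec]] := @test_MVT_x _ _ _ hphi t (x - h) (x + h); first by lra.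
  rewrite ec (_ : _ - _ = 2 * h * (dx_ phi (t, c) - dx_ phi (t, x))); last by ring.
  rewrite normrM (ger0_norm (_ : 0 <= 2 * h)); last by lra.
  rewrite ler_wpM2l//; first by lra.
  by apply: close; rewrite ler_norml; apply/andP; split; lra.
Qed.

(** The derivative is taken at the later time, because the discrete rate pairs step [n] with the
    test function at step [n + 1]. *)
Lemma test_time_difference e : 0 < e -> exists2 d, 0 < d & forall t h, 0 < h -> h < d ->
  forall x, `|phi (t + h, x) - phi (t, x) - h * dt_ phi (t + h, x)| <= h * e * window x.
Proof.
move=> e0; have [d d0 hd] := test_ucont_dt hphi e0.
exists d => // t h h0 hd' x; apply: window_bound.
  move=> /far xX; have [-> _ _] := @phiX (t, x) (or_introl xX).
  by have [-> -> _] := @phiX (t + h, x) (or_introl xX); ring.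
have [|c [/andP[cl cr] ec]] := @test_MVT_t _ _ _ hphi t (t + h) x; first by rewrite lerDl ltW.
rewrite ec (_ : _ - _ = h * (dt_ phi (c, x) - dt_ phi (t + h, x))); last by ring.
rewrite normrM (gtr0_norm h0) ler_wpM2l ?(ltW h0)//; apply: hd => /=.
  by rewrite ltr_norml; apply/andP; split; lra.
by rewrite subrr normr0.
Qed.

End TestSlice.

(** * The discrete weak formulation *)

Section DiscreteWeakForm.
Context {R : realType}.
Local Notation mu := (@lebesgue_measure R).
Variables (T : R) (phi : R * R -> R) (X L : R).
Hypotheses (hphi : C1_compact T phi) (X0 : 0 < X) (L0 : 0 < L).
Hypothesis phiX : forall p : R * R, X <= `|p.2| \/ T <= p.1 ->
  [/\ phi p = 0, dt_ phi p = 0 & dx_ phi p = 0].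
Hypothesis phiL : forall p, `|dt_ phi p| <= L /\ `|dx_ phi p| <= L.
Variables (r G H f g : nat -> nat -> int -> R) (dx dt c : nat -> R) (nst : nat -> nat).
Variables (Br Bf Bg lam0 : R).
Hypotheses (dx0 : forall i, 0 < dx i) (dt0 : forall i, 0 < dt i) (dt1 : forall i, dt i <= 1)
  (dx1 : forall i, dx i <= 1).
Hypotheses (dxc : dx @ \oo --> 0) (dtc : dt @ \oo --> 0) (cc : c @ \oo --> 0).
Hypotheses (lam00 : 0 < lam0) (lamP : forall i, lam0 <= dt i / dx i).
Hypotheses (nstl : forall i, (nst i)%:R * dt i <= T)
  (nstr : forall i, T <= (nst i).+1%:R * dt i).
Hypothesis rB : forall i n j, (n <= nst i)%N -> `|r i n j| <= Br.
Hypothesis GB : forall i n j, (n <= nst i)%N -> `|G i n j| <= c i.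
Hypothesis HB : forall i n j, (n <= nst i)%N -> `|H i n j| <= c i.
Hypothesis fB : forall i n j, (n <= nst i)%N -> `|f i n j| <= Bf.
Hypothesis gB : forall i n j, (n <= nst i)%N -> `|g i n j| <= Bg.
Hypothesis step : forall i n, (n <= nst i)%N ->
  r i n.+1 = projected (dt i / dx i) (dt i) (r i n) (G i n) (H i n) (f i n) (g i n).

Local Notation tm i n := (n%:R * dt i : R).

(** Summation by parts in time: in the increment of [test_pairing] the update of the scheme meets
    [phi] at the new time, and the old values meet the time difference of [phi]. All test functions
    are therefore taken at step [n + 1]. *)
Definition weak_rate i n : R :=
  pairing (dx i) (r i n) (fun x => dt_ phi (tm i n.+1, x)) +
  (pairing (dx i) (f i n) (fun x => dx_ phi (tm i n.+1, x)) +
   pairing (dx i) (g i n) (fun x => phi (tm i n.+1, x))).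

Definition test_pairing i n := pairing (dx i) (r i n) (fun x => phi (tm i n, x)).

Local Notation M := test_pairing.

Let I := \int[mu]_x window X x.
Let IE : I = 2 * (X + 1). Proof. exact: integral_window. Qed.
Let L1t t := L1_test hphi X0 L0 phiX phiL t.

Let Br0 : 0 <= Br. Proof. by have := rB 0 (leq0n (nst 0)); exact: le_trans. Qed.
Let Bf0 : 0 <= Bf. Proof. by have := fB 0 (leq0n (nst 0)); exact: le_trans. Qed.
Let Bg0 : 0 <= Bg. Proof. by have := gB 0 (leq0n (nst 0)); exact: le_trans. Qed.
Let c0 i : 0 <= c i. Proof. by have := GB 0 (leq0n (nst i)); exact: le_trans. Qed.

(** The errors of averaging and of slopes are of order [dx] per step; this makes them of order [dt],
    so that they can be summed over all steps. *)
Let dx_dt i : dx i <= lam0^-1 * dt i.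
Proof.
have := lamP i; rewrite ler_pdivlMr// => h.
by rewrite ler_pdivlMl// mulrC mulrC.
Qed.

Let E1 := I * (Br * lam0^-1 / 4 + (Bf + Bg) + Br).
Let E2 := I * (L * lam0^-1 / 4).

Let split1 (m1 m0 t b f' a : R) :
  m1 - m0 - t * (b + f') = (m1 - a - t * f') + (a - m0 - t * b).
Proof. by ring. Qed.

Let split2 (a b x d e : R) : a - b - (x + d) = (e - b - x) + (a - e - d).
Proof. by ring. Qed.

(** [E1] collects what is proportional to the tolerance [e]: second differences, consistency of flux
    and source, and the time difference. [E2] belongs to the slopes, whose size is controlled by
    [c i]. *)
Lemma weak_step e : 0 < e -> \forall i \near \oo, forall n, (n <= nst i)%N ->
  `|M i n.+1 - M i n - dt i * weak_rate i n| <= dt i * (E1 * e + E2 * c i).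
Proof.
move=> e0.
have [d d0 hd] := test_differences hphi X0 phiX phiL e0.
have [d' d'0 hd'] := test_time_difference hphi X0 phiX e0.
have ev1 : \forall i \near \oo, dx i < d.
  have /cvgrPdist_lt /(_ _ d0) := dxc; apply: filterS => i.
  by rewrite sub0r normrN gtr0_norm.
have ev2 : \forall i \near \oo, dt i < d'.
  have /cvgrPdist_lt /(_ _ d'0) := dtc; apply: filterS => i.
  by rewrite sub0r normrN gtr0_norm.
apply: filterS2 ev1 ev2 => i h1 h2 n ni.
have [k1 k2 k3 k4] := hd (tm i n.+1) (dx i) (dx0 i) h1 (dx1 i).
have bd (u : nat -> nat -> int -> R) K : (forall j, `|u i n j| <= K) -> bounded_seq (u i n).
  by move=> uK; exists K.
have K := @projected_consistency R (dx i) (dx0 i) (dt i / dx i) (dt i) (r i n) (G i n) (H i n)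
  (f i n) (g i n) (bd r _ (fun j => rB j ni)) (bd G _ (fun j => GB j ni))
  (bd H _ (fun j => HB j ni)) (bd f _ (fun j => fB j ni)) (bd g _ (fun j => gB j ni))
  Br (c i) Bf Bg (fun j => rB j ni) (fun j => GB j ni) (fun j => HB j ni)
  (fun j => fB j ni) (fun j => gB j ni) erefl (ltW (dt0 i))
  (fun x => phi (tm i n.+1, x)) (fun x => dx_ phi (tm i n.+1, x)) (window X) e L
  (L1t _) (L1_dx hphi X0 phiX phiL _) (L1_window X) k1 k2 k3 k4.
have tE : tm i n.+1 = tm i n + dt i by rewrite -natr1 mulrDl mul1r.
have P2 : `|pairing (dx i) (r i n) (fun x => phi (tm i n.+1, x)) - M i n -
    dt i * pairing (dx i) (r i n) (fun x => dt_ phi (tm i n.+1, x))| <= Br * (dt i * e * I).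
  have bs : bounded_seq (r i n) by exists Br => j; exact: rB.
  have Ld := L1_dt hphi X0 phiX phiL (tm i n.+1).
  rewrite /M -(pairingBr (dx0 i) bs (L1t _) (L1t _)) -(pairingZr (dx0 i) _ bs Ld).
  rewrite -(pairingBr (dx0 i) bs); [|apply: L1_B; exact: L1t|exact: L1_Z].
  have i3 : L1 (fun x => phi (tm i n.+1, x) - phi (tm i n, x) - dt i * dt_ phi (tm i n.+1, x)).
    by apply: L1_B; [apply: L1_B; exact: L1t|exact: L1_Z].
  apply: le_trans (pairing_le (dx0 i) (fun j => rB j ni) i3) _.
  rewrite ler_wpM2l// /I -RintegralZl//; last exact: L1_window.
  apply: le_Rintegral => //; [exact: L1_norm|exact/L1_Z/L1_window|].
  by move=> x _; rewrite tE; exact: hd'.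
rewrite -step// in K.
change (is_true (`|M i n.+1 - pairing (dx i) (r i n) (fun x => phi (tm i n.+1, x)) -
  dt i * (pairing (dx i) (f i n) (fun x => dx_ phi (tm i n.+1, x)) +
          pairing (dx i) (g i n) (fun x => phi (tm i n.+1, x)))| <=
  I * (Br * e * dx i / 4 + c i * L * dx i / 4 + dt i * e * (Bf + Bg * dx i / 4)))) in K.
rewrite /weak_rate; move: K P2.
move: (pairing (dx i) (r i n) (fun x => phi (tm i n.+1, x))) => a.
move: (pairing (dx i) (r i n) (fun x => dt_ phi (tm i n.+1, x))) => b.
move: (pairing (dx i) (f i n) (fun x => dx_ phi (tm i n.+1, x)) +
       pairing (dx i) (g i n) (fun x => phi (tm i n.+1, x))) => fg.
move: (M i n.+1) (M i n) => m1 m0 K P2.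
rewrite (split1 _ _ _ _ _ a).
apply: le_trans (ler_normD _ _) _; apply: le_trans (lerD K P2) _.
have I0 : 0 <= I by rewrite IE; move: X0; lra.
have := dx_dt i; have := dx1 i; have := dx0 i; have := dt0 i; have := c0 i.
move=> ci0 dti0 dxi0 dxi1 dxt.
have q1 : Br * e * dx i / 4 <= Br * e * (lam0^-1 * dt i) / 4.
  by rewrite ler_pM2r// ler_wpM2l// mulr_ge0// ltW.
have q2 : c i * L * dx i / 4 <= c i * L * (lam0^-1 * dt i) / 4.
  by rewrite ler_pM2r// ler_wpM2l// mulr_ge0// ltW.
have q3 : dt i * e * (Bf + Bg * dx i / 4) <= dt i * e * (Bf + Bg).
  rewrite ler_wpM2l ?mulr_ge0 ?(ltW dti0) ?(ltW e0)//.
  by have : Bg * dx i <= Bg * 1; [rewrite ler_wpM2l|move: Bg0; lra].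
apply: (@le_trans _ _ (I * (Br * e * (lam0^-1 * dt i) / 4 + c i * L * (lam0^-1 * dt i) / 4 +
  dt i * e * (Bf + Bg)) + Br * (dt i * e * I))).
  by rewrite lerD2r ler_wpM2l//; move: q1 q2 q3; lra.
by rewrite le_eqVlt /E1 /E2; apply/orP; left; apply/eqP; ring.
Qed.

Lemma discrete_weak_form :
  (fun i => pairing (dx i) (r i 0) (fun x => phi (0, x)) +
    \sum_(n < (nst i).+1) dt i * weak_rate i n) @ \oo --> 0.
Proof.
have I0 : 0 <= I by rewrite IE; move: X0; lra.
have E10 : 0 <= E1.
  rewrite /E1 mulr_ge0// !addr_ge0// !mulr_ge0// invr_ge0 ltW//.
have E20 : 0 <= E2 by rewrite /E2 !mulr_ge0 ?invr_ge0// ltW.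
have T0 : 0 <= T by apply: le_trans (nstl 0); rewrite mulr_ge0// ltW.
apply/cvgrPdist_le => e e0.
(* The error rate is multiplied by the total time, which is at most [T + 1]. The added 1 in [E1 + 1]
   and [E2 + 1] avoids division by 0. *)
pose e1 := e / (2 * ((T + 1) * (E1 + 1))).
pose e2 := e / (2 * ((T + 1) * (E2 + 1))).
have e10 : 0 < e1 by rewrite divr_gt0// !mulr_gt0// ltr_wpDl.
have e20 : 0 < e2 by rewrite divr_gt0// !mulr_gt0// ltr_wpDl.
have ec : \forall i \near \oo, c i <= e2.
  have /cvgrPdist_le /(_ _ e20) := cc; apply: filterS => i.
  by rewrite sub0r normrN ger0_norm.
apply: filterS2 ec (weak_step e10) => i ci hs.
have tele n : (n <= (nst i).+1)%N ->
    `|M i n - M i 0 - \sum_(q < n) dt i * weak_rate i q| <=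
    n%:R * (dt i * (E1 * e1 + E2 * c i)).
  elim: n => [|n ih] hn; first by rewrite big_ord0 !subrr normr0 mul0r.
  have h2 := hs n hn; have h1 := ih (ltnW hn).
  rewrite big_ord_recr/= -natr1 mulrDl mul1r; move: h1 h2.
  move: (\sum_(q < n) _) (dt i * weak_rate i n) => s1 s2.
  move: (M i n) (M i 0) (M i n.+1) => m1 m0 m2 h1 h2.
  by rewrite (split2 _ _ _ _ m1) (le_trans (ler_normD _ _))// lerD.
(* No bound on the values at step [nst i + 1] is available, but [phi] already vanishes at that
   time. *)
have M0 : M i (nst i).+1 = 0.
  rewrite /M /pairing (_ : (fun x => _) = cst 0) ?Rintegral_cst//= ?mul0r//.
  apply/funext => x; have [->] := @phiX (tm i (nst i).+1, x) (or_intror (nstr i)).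
  by rewrite mulr0.
have := tele _ (leqnn _); rewrite M0 sub0r -opprD normrN sub0r normrN => h.
rewrite /M mul0r in h.
apply: le_trans h _; rewrite mulrA.
have b1 : (nst i).+1%:R * dt i <= T + 1.
  by have := nstl i; have := dt1 i; rewrite -natr1 mulrDl mul1r; lra.
apply: (@le_trans _ _ ((T + 1) * (E1 * e1 + E2 * e2))).
  apply: ler_pM => //; first by rewrite mulr_ge0// ltW.
    by apply: addr_ge0; apply: mulr_ge0; rewrite ?E10 ?E20 ?c0// ltW.
  by rewrite lerD2l ler_wpM2l.
have T1 : 0 < T + 1 by rewrite ltr_wpDl.
have f1 : E1 * e1 <= e / (2 * (T + 1)).
  rewrite /e1 [leRHS](_ : _ = (E1 + 1) * (e / (2 * ((T + 1) * (E1 + 1))))).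
    by rewrite ler_pM2r// lerDl.
  by field; rewrite !gt_eqF// ltr_wpDl.
have f2 : E2 * e2 <= e / (2 * (T + 1)).
  rewrite /e2 [leRHS](_ : _ = (E2 + 1) * (e / (2 * ((T + 1) * (E2 + 1))))).
    by rewrite ler_pM2r// lerDl.
  by field; rewrite !gt_eqF// ltr_wpDl.
apply: (@le_trans _ _ ((T + 1) * (e / (2 * (T + 1)) + e / (2 * (T + 1))))).
  by rewrite ler_pM2l// lerD.
by rewrite le_eqVlt; apply/orP; left; apply/eqP; field; rewrite gt_eqF.
Qed.

End DiscreteWeakForm.

(** * Riemann sums in time *)

Section TimeSum.
Context {R : realType}.
Local Notation mu := (@lebesgue_measure R).
Variables (T K : R) (dt : nat -> R) (nst : nat -> nat) (D : nat -> nat -> R) (X : R -> R).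
Hypotheses (T0 : 0 < T) (dt0 : forall i, 0 < dt i) (dt1 : forall i, dt i <= 1)
  (dtc : dt @ \oo --> 0).
Hypotheses (nstl : forall i, (nst i)%:R * dt i <= T)
  (nstr : forall i, T < (nst i).+1%:R * dt i).
Hypothesis DK : forall i n, (n <= nst i)%N -> `|D i n| <= K.
Hypothesis DX : forall t, 0 <= t <= T ->
  (fun i => D i (time_idx (dt i) (nst i) t)) @ \oo --> X t.

Let integrable_indic_co (a b : R) : L1 (\1_`[a, b[ : R -> R).
Proof. exact: integrable_indic_itv. Qed.

Let Rintegral_indic_co (a b : R) : a <= b -> \int[mu]_x (\1_`[a, b[ : R -> R) x = b - a.
Proof. exact: Rintegral_indic_bnd. Qed.

(** A step function of time whose integral is the sum in question; its last slab sticks out beyond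
    [T]. *)
Let u i (t : R) : R :=
  \sum_(n < (nst i).+1) D i n * \1_`[(n : nat)%:R * dt i, n.+1%:R * dt i[ t.

Let sliceE i n t : (\1_`[n%:R * dt i, n.+1%:R * dt i[ : R -> R) t =
  ((0 <= t) && (Num.truncn (t / dt i) == n))%:R.
Proof.
rewrite indicE mem_setE in_itv /=.
have [t0|t0] := leP 0 t.
  rewrite truncn_eq; last by rewrite divr_ge0// ltW.
  by rewrite ler_pdivlMr// ltr_pdivrMr.
rewrite (_ : _ && _ = false)//; apply/negbTE; rewrite negb_and -ltNge.
by rewrite (lt_le_trans t0)// mulr_ge0// ltW.
Qed.

Let uE i t : u i t =
  if 0 <= t < (nst i).+1%:R * dt i then D i (time_idx (dt i) (nst i) t) else 0.
Proof.
rewrite /u; under eq_bigr do rewrite sliceE.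
have [t0|t0] := leP 0 t => /=; last by rewrite big1// => n _; rewrite mulr0.
rewrite -ltr_pdivrMr//; case: ifPn => [tn|tn].
  have lt : (Num.truncn (t / dt i) < (nst i).+1)%N.
    by rewrite truncn_lt_nat// divr_ge0// ltW.
  rewrite (bigD1 (Ordinal lt))//= eqxx mulr1 big1 ?addr0.
    by rewrite /time_idx (minn_idPl _).
  move=> n nq; case: eqP => [e|]; last by rewrite mulr0.
  by move/eqP: nq => []; exact: val_inj.
rewrite big1// => n _; case: eqP => [e|]; last by rewrite mulr0.
have : (nst i < Num.truncn (t / dt i))%N by rewrite truncn_gt_nat leNgt.
by rewrite e; have := ltn_ord n; lia.
Qed.

Let L1_slice i n : L1 (fun t => D i n * \1_`[n%:R * dt i, n.+1%:R * dt i[ t).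
Proof. by apply: L1_Z; exact: integrable_indic_co. Qed.

Let int_u i : \int[mu]_t u i t = \sum_(n < (nst i).+1) dt i * D i n.
Proof.
rewrite /u Rintegral_sum; [|exact: measurableT|by move=> n; exact: L1_slice].
apply: eq_bigr => n _; rewrite RintegralZl//; last exact: integrable_indic_co.
rewrite Rintegral_indic_co; last by rewrite ler_pM2r// ler_nat.
by rewrite -natr1 mulrDl mul1r addrAC subrr add0r mulrC.
Qed.

Let X' := X \_ `[0, T].

Let X'E t : X' t = if 0 <= t <= T then X t else 0.
Proof. by rewrite /X' patchE mem_setE in_itv. Qed.

Let K0 : 0 <= K. Proof. by have := DK (leq0n (nst 0)); exact: le_trans. Qed.

Let u_cvg t : u^~ t @ \oo --> X' t.
Proof.
rewrite X'E; case: ifPn => [/[dup] tT /andP[t0 tT']|].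
  apply: near_cvg_to (DX tT); apply: nearW => i.
  by rewrite uE t0 (le_lt_trans tT').
rewrite negb_and -!ltNge => /orP[t0|Tt].
  apply: near_cvg_to (@cvg_cst _ (0 : R) _ \oo _); apply: nearW => i.
  by rewrite uE (leNgt 0) t0.
apply: near_cvg_to (@cvg_cst _ (0 : R) _ \oo _).
have tT0 : 0 < t - T by rewrite subr_gt0.
have /cvgrPdist_lt /(_ _ tT0) := dtc; apply: filterS => i.
rewrite sub0r normrN gtr0_norm// => dti; rewrite uE ifF//.
apply/negbTE; rewrite negb_and -!ltNge -leNgt; apply/orP; right.
by have := nstl i; rewrite -natr1 mulrDl mul1r; lra.
Qed.

Let u_measurable i : measurable_fun setT (u i).
Proof.
have : L1 (u i) by apply: Rintegrable_sum => // n _; exact: L1_slice.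
exact: L1_measurable.
Qed.

Let X'_measurable : measurable_fun setT X'.
Proof. by apply: (measurable_fun_cvg (h := u)) => // x _; exact: u_cvg. Qed.

(** Dominated convergence for [u]: each point beyond [T] eventually leaves its support, which ends
    no later than [T + dt i], and [K] on [[0, T + 1[] dominates. *)
Lemma time_sum_cvg :
  (fun i => \sum_(n < (nst i).+1) dt i * D i n) @ \oo --> \int[mu]_(t in `]0, T[) X t.
Proof.
have e : \int[mu]_(t in `]0, T[) X t = \int[mu]_t X' t.
  rewrite -Rintegral_mkcond /Rintegral; congr fine.
  rewrite (@integral_itv_bndoo R 0 T (EFin \o X) true false)//.
  apply/measurable_EFinP.
  have := measurable_funS measurableT (@subsetT _ `]0, T[) X'_measurable.
  apply: eq_measurable_fun => t; rewrite inE /= in_itv /= => /andP[t0 tT].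
  by rewrite X'E !ltW.
rewrite e; under eq_fun do rewrite -int_u.
apply: (@L1_dominated_cvg _ u X' (fun t => K * \1_`[0, T + 1[ t)) => //.
  by apply: L1_Z; exact: integrable_indic_co.
move=> i t; rewrite uE indicE mem_setE in_itv /=.
case: ifPn => [/andP[t0 tn]|_]; last by rewrite normr0 mulr_ge0.
rewrite t0 /= (_ : t < T + 1) ?mulr1; first by apply: DK; exact: time_idx_le.
by apply: lt_le_trans tn _; rewrite -natr1 mulrDl mul1r; apply: lerD.
Qed.

End TimeSum.

(** * Averages of the initial data *)

Section CellAverage.
Context {R : realType}.
Local Notation mu := (@lebesgue_measure R).
Variables (f : R -> R) (lo hi : R).
Hypothesis mf : measurable_fun setT f.
Hypothesis lohi : lo <= hi.
Hypothesis fr : {ae mu, forall x, lo <= f x < hi}.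

Definition cell_avg (h : R) (j : int) : R := h^-1 * \int[mu]_(x in cell h j) f x.

(** [f] takes values in the range only almost everywhere; [g] is a representative that does so
    everywhere. *)
Let g x := Num.max lo (Num.min hi (f x)).

Let mg : measurable_fun setT g.
Proof.
apply: measurable_maxr; first exact: measurable_cst.
by apply: measurable_minr => //; exact: measurable_cst.
Qed.

Let g_range x : lo <= g x <= hi.
Proof. by rewrite /g le_max lexx /= ge_max lohi ge_min lexx. Qed.

Let fg : {ae mu, forall x, f x = g x}.
Proof.
apply: filterS fr; first exact: (ae_filter_ringOfSetsType mu).
by move=> x /andP[h1 h2]; rewrite /g (min_r (ltW h2)) max_r.
Qed.

Let B := `|lo| + `|hi|.

Let g_bound x : `|g x| <= B.
Proof.
have /andP[h1 h2] := g_range x; rewrite ler_norml /B.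
have := ler_norm hi; have := ler_norm (- lo); rewrite normrN => h3 h4.
have := normr_ge0 lo; have := normr_ge0 hi; move=> h5 h6.
by apply/andP; split; lra.
Qed.

Let int_fg (D : set R) : measurable D ->
  \int[mu]_(x in D) f x = \int[mu]_(x in D) g x.
Proof.
move=> mD; rewrite /Rintegral; congr fine; apply: ae_eq_integral => //.
- by apply/measurable_EFinP; exact: measurable_funS mf.
- by apply/measurable_EFinP; exact: measurable_funS mg.
- apply: filterS fg; first exact: (ae_filter_ringOfSetsType mu).
  by move=> x /= -> _.
Qed.

Let L1_g_cell h j : 0 < h -> L1 (fun x => g x * \1_(cell h j) x).
Proof.
move=> h0; apply: (L1_M mg g_bound).
apply: (@L1_le _ _ (\1_`](j%:~R - 2^-1) * h - 1, (j%:~R + 2^-1) * h] : R -> R)).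
- by apply: measurable_indic; exact: measurable_cell.
- move=> x; rewrite indicE indic_ocE mem_setE in_itv /= ger0_norm// ler_nat.
  by have [/andP[h1 h2]|] := boolP (_ <= x < _) => //; rewrite (ltW h2) andbT (lt_le_trans _ h1)// ltrBlDr ltrDl.
- exact: Rintegrable_itv.
Qed.

Let cell_avgE h j : cell_avg h j = h^-1 * \int[mu]_x (g x * \1_(cell h j) x).
Proof.
by rewrite /cell_avg Rintegral_mul_indic int_fg//; exact: measurable_cell.
Qed.

Let L1_cell_indic h j : 0 < h -> L1 (\1_(cell h j) : R -> R).
Proof. by move=> h0; exact: L1_cell. Qed.

Lemma cell_avg_range h j : 0 < h -> lo <= cell_avg h j <= hi.
Proof.
move=> h0; rewrite cell_avgE ler_pdivlMl// ler_pdivrMl//.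
have c1 := L1_cell_indic j h0.
have E c : h * c = \int[mu]_x (c * \1_(cell h j) x).
  by rewrite RintegralZl// Rintegral_cell// mulrC.
rewrite !E; have c2 := L1_g_cell j h0; apply/andP; split.
  apply: le_Rintegral => //; first exact: L1_Z.
  by move=> x _; rewrite ler_wpM2r//; have /andP[] := g_range x.
apply: le_Rintegral => //; first exact: L1_Z.
by move=> x _; rewrite ler_wpM2r//; have /andP[] := g_range x.
Qed.

Variable dx : nat -> R.
Hypotheses (dx0 : forall i, 0 < dx i) (dxc : dx @ \oo --> 0).

Let local_g : locally_integrable setT g.
Proof.
split => //; first exact: openT.
move=> K _ cK.
have mK : measurable K by exact: compact_measurable.
have fK : (mu K < +oo)%E by exact: compact_finite_measure.
apply: (@le_lt_trans _ _ (\int[mu]_(x in K) (cst B%:E) x)%E).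
  apply: ge0_le_integral => //.
  - by apply/measurable_EFinP; apply: measurableT_comp => //; exact: measurable_funS mg.
  all: try by move=> x _; rewrite /= lee_fin ?normr_ge0 ?g_bound// (le_trans _ (g_bound 0)).
by rewrite integral_cst// lte_mul_pinfty// lee_fin (le_trans _ (g_bound 0)).
Qed.

(** The cell need not be centred at [x], but it lies in the ball of radius [dx i] and has half of
    its measure: this is the constant 2. *)
Let shrink x : nicely_shrinking x (fun i => cell (dx i) (cell_idx (dx i) x)).
Proof.
split; first by move=> i; exact: measurable_cell.
exists (2, fun i => PosNum (dx0 i)); split => //=.
- move=> i y; rewrite /cell /= in_itv /= => /andP[y1 y2].
  have /andP[x1 x2] := cell_idx_bounds (dx0 i) x.
  by rewrite /ball /= ltr_norml; apply/andP; split; move: x1 x2 y1 y2 (dx0 i); nra.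
- move=> i; rewrite lebesgue_measure_ball; last exact: ltW.
  rewrite /cell lebesgue_measure_itv/= lte_fin.
  rewrite ltr_pM2r// ltrD2l (_ : - 2^-1 < 2^-1 :> R) /=; last by lra.
  rewrite -EFinB -EFinM lee_fin mulr2n; move: (dx0 i); nra.
Qed.

Let avg_cvg : {ae mu, forall x, (fun i => pc (dx i) (cell_avg (dx i)) x) @ \oo --> f x}.
Proof.
have := lebesgue_differentiation local_g; have := fg.
apply: filterS2; first exact: (ae_filter_ringOfSetsType mu).
move=> x fgx lx; rewrite fgx.
have := nice_lebesgue_differentiation shrink local_g lx.
move=> /fine_cvgP[_]; apply: cvg_trans.
apply: near_eq_cvg; apply: nearW => i /=.
set c := cell (dx i) (cell_idx (dx i) x).
have mc : measurable (c : set (measurableTypeR R)) by exact: measurable_cell.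
have muc : mu c = (dx i)%:E.
  rewrite /c /cell lebesgue_measure_itv/= lte_fin ltr_pM2r// ltrD2l.
  rewrite (_ : - 2^-1 < 2^-1 :> R) /=; last by lra.
  by rewrite -EFinD; congr EFin; field.
have gc : Rintegrable mu c g.
  have := @integrableS _ _ R mu setT _ _ measurableT mc (@subsetT _ _)
    (L1_g_cell (cell_idx (dx i) x) (dx0 i)).
  apply: eq_integrable => // y yc /=.
  by rewrite indicE yc mulr1.
rewrite /pc /cell_avg int_fg// -(EFin_Rintegral mc gc) muc inver gt_eqF//.
Qed.

(** The averages converge almost everywhere by Lebesgue differentiation, and their range provides
    the majorant. *)
Lemma cell_avg_weak_cvg (k : R -> R) : L1 k ->
  (fun i => pairing (dx i) (cell_avg (dx i)) k) @ \oo --> \int[mu]_x (f x * k x).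
Proof.
move=> ki.
apply: (@Rintegral_dominated_cvg _ _ R mu setT measurableT _ _ (fun x => B * `|k x|)).
- move=> i; apply: measurable_funM; [exact: measurable_pc|exact: L1_measurable].
- by apply: measurable_funM => //; exact: L1_measurable.
- apply: filterS avg_cvg; first exact: (ae_filter_ringOfSetsType mu).
  by move=> x h _; apply: cvgM => //; exact: cvg_cst.
- exact/L1_Z/L1_norm.
- apply: aeW => x _ i; rewrite normrM ler_wpM2r//.
  have /andP[h1 h2] := cell_avg_range (cell_idx (dx i) x) (dx0 i).
  rewrite /pc ler_norml /B.
  have := ler_norm hi; have := ler_norm (- lo); rewrite normrN => h3 h4.
  have := normr_ge0 lo; have := normr_ge0 hi; move=> h5 h6.
by apply/andP; split; lra.
Qed.

End CellAverage.

(** * Passage to the limit *)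

Section WeakStrong.
Context {R : realType}.
Local Notation mu := (@lebesgue_measure R).

Lemma cvg_of_close (x y e : nat -> R) (l : R) :
  (forall i, `|x i - y i| <= e i) -> e @ \oo --> 0 -> y @ \oo --> l -> x @ \oo --> l.
Proof.
move=> xy e0 yl; rewrite -(addr0 l); apply: near_cvg_to (cvgD yl (_ : (x - y) @ \oo --> 0)).
  by apply: nearW => i; rewrite /= addrC subrK.
apply/norm_cvg0P; apply: (squeeze_cvgr _ (cvg_cst 0) e0).
by apply: nearW => i; rewrite normr_ge0 xy.
Qed.

Lemma cvg_norm0 (x : nat -> R) : x @ \oo --> 0 -> (fun i => `|x i|) @ \oo --> 0.
Proof. by move=> x0; rewrite -[X in _ --> X](normr0 R); exact: cvg_norm. Qed.

Lemma seq_cvg_sum n (x : 'I_n -> nat -> R) (l : 'I_n -> R) :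
  (forall k, x k @ \oo --> l k) -> (fun i => \sum_k x k i) @ \oo --> \sum_k l k.
Proof.
move=> xl; elim: n x l xl => [|n ih] x l xl.
  by under eq_fun do rewrite big_ord0; rewrite big_ord0; exact: cvg_cst.
under eq_fun do rewrite big_ord_recr; rewrite big_ord_recr /=.
by apply: cvgD; [apply: (ih (fun k => x (widen_ord (leqnSn n) k)))|].
Qed.

(** Replacing [psi i] by its limit costs [B] times an L1 distance, which tends to 0 by domination;
    afterwards the test function is fixed. *)
Lemma cvg_weak_strong (B : R) (u psi : nat -> R -> R) (r p g : R -> R) :
  (forall i, measurable_fun setT (u i)) -> (forall i x, `|u i x| <= B) ->
  (forall k, L1 k -> (fun i => \int[mu]_x (u i x * k x)) @ \oo --> \int[mu]_x (r x * k x)) ->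
  (forall i, measurable_fun setT (psi i)) -> L1 g -> (forall i x, `|psi i x| <= g x) ->
  (forall x, psi^~ x @ \oo --> p x) ->
  (fun i => \int[mu]_x (u i x * psi i x)) @ \oo --> \int[mu]_x (r x * p x).
Proof.
move=> mu_ uB ur mpsi gi pg pp.
have mp : measurable_fun setT p by apply: (measurable_fun_cvg (h := psi)) => // x _; exact: pp.
have ppg x : `|p x| <= g x by exact: seq_norm_le (pp x) (fun i => pg i x).
have pi : L1 p by exact: L1_le mp ppg gi.
have psii i : L1 (psi i) by exact: L1_le (mpsi i) (pg i) gi.
have B0 : 0 <= B by exact: le_trans (uB 0 0).
apply: (@cvg_of_close _ (fun i => \int[mu]_x (u i x * p x))
  (fun i => B * \int[mu]_x `|psi i x - p x|)); last exact: ur.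
  move=> i; rewrite -RintegralB//; [|exact: (L1_M (mu_ i) (uB i))|exact: (L1_M (mu_ i) (uB i))].
  have di : L1 (fun x => psi i x - p x) by exact: L1_B.
  rewrite -RintegralZl//; last exact: L1_norm.
  apply: L1_norm_le.
  - by apply: L1_B; exact: (L1_M (mu_ i) (uB i)).
  - exact/L1_Z/L1_norm.
  - by move=> x; rewrite -mulrBr normrM ler_wpM2r.
rewrite -(mulr0 B); apply: cvgM; first exact: cvg_cst.
rewrite (_ : 0 = \int[mu]_x (cst 0 x)); last by rewrite Rintegral_cst// mul0r.
apply: (@L1_dominated_cvg _ _ _ (fun x => 2 * g x)).
- move=> i; apply: measurableT_comp => //; apply: measurable_funB => //.
- exact: measurable_cst.
- move=> x /=; have h : (fun i => psi i x - p x) @ \oo --> 0.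
    by rewrite -(subrr (p x)); apply: cvgB => //; exact: cvg_cst.
  exact: cvg_norm0 h.
- exact: L1_Z.
- move=> i x; rewrite normr_id (le_trans (ler_normB _ _))//.
  by rewrite mulr_natl mulr2n lerD.
Qed.

End WeakStrong.

Section LimitPassage.
Context {R : realType} {N m : nat}.
Local Notation mu := (@lebesgue_measure R).
Local Notation T2 := (measurableTypeR R * measurableTypeR R)%type.
Variables (w : 'I_m -> 'I_N -> R -> R) (a b M B : R).
Hypothesis kw : forall l k, is_kernel (w l k).
Hypothesis wM : forall l k (a b : R), a <= b -> (total_variation a b (w l k) <= M%:E)%E.
Variables (U Uh : nat -> nat -> 'I_N -> int -> R) (Rh : nat -> nat -> 'I_m -> int -> R).
Variables (dx dt e1 e2 : nat -> R) (nst : nat -> nat) (rho : 'I_N -> R * R -> R).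
Hypotheses (dx0 : forall i, 0 < dx i) (dt0 : forall i, 0 < dt i).
Hypotheses (dxc : dx @ \oo --> 0) (dtc : dt @ \oo --> 0) (e1c : e1 @ \oo --> 0)
  (e2c : e2 @ \oo --> 0).
Hypothesis UB : forall i n k j, (n <= nst i)%N -> `|U i n k j| <= B.
Hypothesis Uh_close : forall i n k j, (n <= nst i)%N -> `|Uh i n k j - U i n k j| <= e1 i.
Hypothesis UhB : forall i n k j, (n <= nst i)%N -> `|Uh i n k j| <= B.
Hypothesis Rh_box : forall i n j, (n <= nst i)%N -> in_box a b (vec (Rh i n) j).
Hypothesis Rh_close : forall i n l j, (n <= nst i)%N ->
  `|Rh i n l j - \sum_k \int[mu]_y (w l k (y - j%:~R * dx i) * pc (dx i) (U i n k) y)| <= e2 i.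
Hypothesis U_rho : forall k t g, L1 g ->
  (fun i => \int[mu]_x (step_fun U dx dt nst i k (t, x) * g x)) @ \oo -->
  \int[mu]_x (rho k (t, x) * g x).

Local Notation tidx i t := (time_idx (dt i) (nst i) t).
Local Notation nl := (nonlocal w rho).

(** For fixed [x] the translated kernel is an integrable test function, so weak convergence in space
    at the single time [t] suffices. The shift from the node to [x] is paid for by the translation
    bound of the kernel. *)
Lemma nonlocal_cvg t x l :
  (fun i => Rh i (tidx i t) l (cell_idx (dx i) x)) @ \oo --> nl (t, x) 0 l.
Proof.
pose A i := \sum_k \int[mu]_y (w l k (y - x) * step_fun U dx dt nst i k (t, y)).
have N0 : 0 <= N%:R :> R by [].
apply: (@cvg_of_close _ _ A (fun i => e2 i + N%:R * (2 * M * B * dx i))).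
- move=> i; set j := cell_idx _ _; have nn := time_idx_le (dt i) (nst i) t.
  rewrite -(subrK (\sum_k \int[mu]_y (w l k (y - j%:~R * dx i) *
    pc (dx i) (U i (tidx i t) k) y)) (Rh i (tidx i t) l j)) -addrA.
  apply: le_trans (ler_normD _ _) _; apply: lerD; first exact: Rh_close.
  rewrite /A -sumrB; apply: norm_sum_le => k; rewrite distrC.
  apply: le_trans (kconv_near (kw l k) (wM l k) (dx0 i) x (j%:~R * dx i) (fun q => UB k q nn)) _.
  have B0 : 0 <= B by exact: le_trans (UB k 0 nn).
  rewrite ler_wpM2l//; first by rewrite !mulr_ge0// (kernel_M_ge0 (wM l k)).
  have /andP[x1 x2] := cell_idx_bounds (dx0 i) x; rewrite -/j in x1 x2.
  rewrite mulrBl in x1; rewrite mulrDl in x2; have d0 := dx0 i.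
  by rewrite ler_norml; apply/andP; split; move: x1 x2 d0; lra.
- rewrite -(addr0 0); apply: cvgD => //.
  rewrite -(mulr0 N%:R); apply: cvgM; first exact: cvg_cst.
  by rewrite -(mulr0 (2 * M * B)); apply: cvgM => //; exact: cvg_cst.
- rewrite /nonlocal mxE /=; apply: seq_cvg_sum => k.
  have gi : L1 (fun y => w l k (y - x)) by exact: (Rintegrable_shift (- x) (kernel_L1 (kw l k))).
  have := @U_rho k t _ gi.
  under eq_fun do under eq_Rintegral do rewrite mulrC.
  by under [X in _ --> X -> _]eq_Rintegral do rewrite mulrC.
Qed.

(** The box is closed and hence contains the limit; the Lipschitz bounds of the coefficients are
    available only there. *)
Lemma nonlocal_box p : in_box a b (nl p).
Proof.
case: p => t x l; have c := nonlocal_cvg (t := t) (x := x) (l := l).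
have bx i : a <= Rh i (tidx i t) l (cell_idx (dx i) x) <= b.
  by have := @Rh_box i _ (cell_idx (dx i) x) (time_idx_le (dt i) (nst i) t) l; rewrite mxE.
apply/andP; split.
  by apply: (cvgr_to_ge c); apply: nearW => i; have /andP[] := bx i.
by apply: (cvgr_to_le c); apply: nearW => i; have /andP[] := bx i.
Qed.

Section LipschitzFun.
Variables (f : 'rV[R]_m -> R) (L : R).
Hypothesis fL : forall q q', in_box a b q -> in_box a b q' -> `|f q - f q'| <= L * dist1 q q'.

Lemma lipschitz_nonlocal_cvg t x :
  (fun i => f (vec (Rh i (tidx i t)) (cell_idx (dx i) x))) @ \oo --> f (nl (t, x)).
Proof.
apply: (@cvg_of_close _ _ (cst (f (nl (t, x))))
  (fun i => L * dist1 (vec (Rh i (tidx i t)) (cell_idx (dx i) x)) (nl (t, x)))).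
- by move=> i; apply: fL; [exact/Rh_box/time_idx_le|exact: nonlocal_box].
- rewrite -(mulr0 L); apply: cvgM; first exact: cvg_cst.
  suff h l : (fun i => `|vec (Rh i (tidx i t)) (cell_idx (dx i) x) 0 l - nl (t, x) 0 l|) @ \oo
      --> (0 : R).
    by have := seq_cvg_sum h; rewrite big1.
  have h : (fun i => vec (Rh i (tidx i t)) (cell_idx (dx i) x) 0 l - nl (t, x) 0 l) @ \oo --> 0.
    rewrite -(subrr (nl (t, x) 0 l)); apply: cvgB; last exact: cvg_cst.
    under eq_fun do rewrite mxE; exact: nonlocal_cvg.
  exact: cvg_norm0 h.
- exact: cvg_cst.
Qed.

(** Obtained as a pointwise limit of step functions in [(t, x)]. *)
Lemma lipschitz_nonlocal_measurable : measurable_fun [set: T2] (fun p => f (nl p)).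
Proof.
apply: (@measurable_fun_cvg _ T2 R setT
  (fun i p => f (vec (Rh i (tidx i p.1)) (cell_idx (dx i) p.2)))) => [i|[t x] _].
  pose Gf q := pc (dx i) (fun j => f (vec (Rh i q) j)).
  apply: (@measurable_time_family R dt nst dt0 i Gf) => q.
  exact: (measurable_pc (dx0 i)).
exact: lipschitz_nonlocal_cvg.
Qed.

End LipschitzFun.

Hypothesis mrho : forall k, measurable_fun [set: T2] (rho k).
Hypothesis rhoB : forall k p, `|rho k p| <= B.

Let rho_section k t : measurable_fun setT (fun x => rho k (t, x)).
Proof. exact: (measurableT_comp (mrho k) (pair1_measurable (t : measurableTypeR R))). Qed.

Lemma L1_rho k t g : L1 g -> L1 (fun x => rho k (t, x) * g x).
Proof. by apply: L1_M => // x; exact: rhoB. Qed.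

Local Notation sU k i t x := (step_fun U dx dt nst i k (t, x)).
Local Notation sUh k i t x := (step_fun Uh dx dt nst i k (t, x)).

Let sU_m k i t : measurable_fun setT (fun x => sU k i t x).
Proof. exact: (step_fun_measurable_section U dt nst dx0). Qed.

Let sUh_m k i t : measurable_fun setT (fun x => sUh k i t x).
Proof. exact: (step_fun_measurable_section Uh dt nst dx0). Qed.

Let sU_b k i t x : `|sU k i t x| <= B.
Proof. by apply: UB; exact: time_idx_le. Qed.

Let sUh_b k i t x : `|sUh k i t x| <= B.
Proof. by apply: UhB; exact: time_idx_le. Qed.

(** The half step moves the values by at most [e1 i], so both sequences have the same weak limit. *)
Lemma half_weak_cvg k t g : L1 g ->
  (fun i => \int[mu]_x (sUh k i t x * g x)) @ \oo --> \int[mu]_x (rho k (t, x) * g x).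
Proof.
move=> gi; apply: (@cvg_of_close _ _ _ (fun i => e1 i * \int[mu]_x `|g x|) _ _ _
  (@U_rho k t _ gi)); last first.
  by rewrite -(mul0r (\int[mu]_x `|g x|)); apply: cvgM => //; exact: cvg_cst.
move=> i; have i1 : L1 (fun x => sUh k i t x * g x) by exact: L1_M (sUh_m k i t) (sUh_b k i t) gi.
have i2 : L1 (fun x => sU k i t x * g x) by exact: L1_M (sU_m k i t) (sU_b k i t) gi.
rewrite -RintegralB// -RintegralZl//; last exact: L1_norm.
apply: L1_norm_le; [exact: L1_B|exact/L1_Z/L1_norm|].
move=> x; rewrite -mulrBl normrM ler_wpM2r//.
by apply: Uh_close; exact: time_idx_le.
Qed.

Lemma half_shift_weak_cvg k t c g : L1 g ->
  (fun i => \int[mu]_x ((sUh k i t x - c) * g x)) @ \oo -->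
  \int[mu]_x ((rho k (t, x) - c) * g x).
Proof.
move=> gi; have ci : L1 (fun x => c * g x) by exact: L1_Z.
have -> : \int[mu]_x ((rho k (t, x) - c) * g x) =
    \int[mu]_x (rho k (t, x) * g x) - \int[mu]_x (c * g x).
  rewrite -RintegralB//; last exact: L1_rho.
  by apply: eq_Rintegral => x _; rewrite mulrBl.
have -> : (fun i => \int[mu]_x ((sUh k i t x - c) * g x)) =
    (fun i => \int[mu]_x (sUh k i t x * g x) - \int[mu]_x (c * g x)).
  apply/funext => i; rewrite -RintegralB//; last exact: L1_M (sUh_m k i t) (sUh_b k i t) gi.
  by apply: eq_Rintegral => x _; rewrite mulrBl.
by apply: cvgB; [exact: half_weak_cvg|exact: cvg_cst].
Qed.

Section Rates.
Variables (F : 'I_N -> R -> 'rV[R]_m -> R) (V : 'I_N -> 'rV[R]_m -> R).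
Variables (S : 'I_N -> 'rV[R]_N -> 'rV[R]_m -> R) (rm rM LF LV LS : R).
Hypotheses (rmM : rm < rM) (fv : forall k (r : R) q, F k r q = r * V k q).
Hypothesis VB : forall k q, in_box a b q -> `|V k q| <= LF.
Hypothesis vL : forall k, speed_lipschitz LV a b (V k).
Hypothesis s0 : forall k q, S k (const_mx rm) q = 0.
Hypothesis sL : forall k, source_lipschitz LS rm rM a b (S k).
Hypothesis slin : forall k, linear_in_density (S k).
Variables (T : R) (phi : R * R -> R) (X L : R).
Hypotheses (hphi : C1_compact T phi) (X0 : 0 < X) (L0 : 0 < L).
Hypothesis phiX : forall p : R * R, X <= `|p.2| \/ T <= p.1 ->
  [/\ phi p = 0, dt_ phi p = 0 & dx_ phi p = 0].
Hypothesis phiL : forall p, `|dt_ phi p| <= L /\ `|dx_ phi p| <= L.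
Hypothesis nstr : forall i, T < (nst i).+1%:R * dt i.
Variable k : 'I_N.

Let coef j q := source_coef rm rM (S k) j q.
Let tn i t := (tidx i t).+1%:R * dt i.

(** [tn i t] is the right end of the time slab of [t], within [dt i] of it; by [nstr] the cap in the
    time index is not active up to [T]. *)
Lemma time_node_cvg (f : R * R -> R) t x : ucont f -> 0 <= t <= T ->
  (fun i => f (tn i t, x)) @ \oo --> f (t, x).
Proof.
move=> uf /andP[t0 tT]; apply/cvgrPdist_le => e e0.
have [d d0 hd] := uf e e0.
have /cvgrPdist_lt /(_ _ d0) := dtc; apply: filterS => i.
rewrite sub0r normrN gtr0_norm// => dti; apply: hd => /=; last by rewrite subrr normr0.
have q0 : 0 <= t / dt i by rewrite divr_ge0// ltW.
have tl : t / dt i < (nst i).+1%:R by rewrite ltr_pdivrMr// (le_lt_trans tT).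
have lt : (Num.truncn (t / dt i) <= nst i)%N by rewrite -ltnS truncn_lt_nat.
have /andP[h1 h2] := truncn_itv q0.
rewrite /tn /time_idx (minn_idPl lt).
rewrite ler_pdivlMr// in h1; rewrite ltr_pdivrMr// in h2.
have h3 : (Num.truncn (t / dt i)).+1%:R * dt i <= t + dt i.
  by rewrite -natr1 mulrDl mul1r lerD2r.
by rewrite ltr_norml; apply/andP; split; move: h2 h3 dti; lra.
Qed.

Let ff i n j := F k (Uh i n k j) (vec (Rh i n) j).
Let gg i n j := S k (vec (Uh i n) j) (vec (Rh i n) j).
Let Vs i t x := V k (vec (Rh i (tidx i t)) (cell_idx (dx i) x)).
Let cs q i t x := coef q (vec (Rh i (tidx i t)) (cell_idx (dx i) x)).

Definition limit_rate t : R :=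
  \int[mu]_x (rho k (t, x) * dt_ phi (t, x)) +
  (\int[mu]_x (F k (rho k (t, x)) (nl (t, x)) * dx_ phi (t, x)) +
   \int[mu]_x (S k (\row_q rho q (t, x)) (nl (t, x)) * phi (t, x))).

Let wn : L1 (window X) := L1_window X.

Lemma dt_rate_cvg t : 0 <= t <= T ->
  (fun i => pairing (dx i) (U i (tidx i t) k) (fun x => dt_ phi (tn i t, x))) @ \oo -->
  \int[mu]_x (rho k (t, x) * dt_ phi (t, x)).
Proof.
move=> tT.
apply: (@cvg_weak_strong _ B (fun i x => sU k i t x) (fun i x => dt_ phi (tn i t, x))
  (fun x => rho k (t, x)) (fun x => dt_ phi (t, x)) (fun x => L * window X x)).
- by move=> i; exact: sU_m.
- by move=> i x; exact: sU_b.
- by move=> g gi; exact: U_rho.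
- by move=> i; exact: (ucont_measurable_section _ (test_ucont_dt hphi)).
- exact: L1_Z.
- by move=> i x; exact: (dt_window X0 phiX phiL).
- by move=> x; apply: time_node_cvg => //; exact: test_ucont_dt hphi.
Qed.

Lemma flux_rate_cvg t : 0 <= t <= T ->
  (fun i => pairing (dx i) (ff i (tidx i t)) (fun x => dx_ phi (tn i t, x))) @ \oo -->
  \int[mu]_x (F k (rho k (t, x)) (nl (t, x)) * dx_ phi (t, x)).
Proof.
move=> tT.
(* The density is the weakly convergent factor; speed times test function is the strongly convergent
   one. *)
have -> : (fun i => pairing (dx i) (ff i (tidx i t)) (fun x => dx_ phi (tn i t, x))) =
    (fun i => \int[mu]_x (sUh k i t x * (Vs i t x * dx_ phi (tn i t, x)))).
  by apply/funext => i; apply: eq_Rintegral => x _; rewrite /pc /ff fv mulrA.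
have -> : \int[mu]_x (F k (rho k (t, x)) (nl (t, x)) * dx_ phi (t, x)) =
    \int[mu]_x (rho k (t, x) * (V k (nl (t, x)) * dx_ phi (t, x))).
  by apply: eq_Rintegral => x _; rewrite fv mulrA.
apply: (@cvg_weak_strong _ B (fun i x => sUh k i t x)
  (fun i x => Vs i t x * dx_ phi (tn i t, x))
  (fun x => rho k (t, x)) (fun x => V k (nl (t, x)) * dx_ phi (t, x))
  (fun x => LF * (L * window X x))).
- by move=> i; exact: sUh_m.
- by move=> i x; exact: sUh_b.
- by move=> g gi; exact: half_weak_cvg.
- move=> i; apply: measurable_funM; first
    exact: (measurable_pc (dx0 i) (fun j => V k (vec (Rh i (tidx i t)) j))).
  exact: (ucont_measurable_section _ (test_ucont_dx hphi)).
- exact/L1_Z/L1_Z.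
- move=> i x; rewrite normrM; apply: ler_pM => //.
    by apply: VB; apply: Rh_box; exact: time_idx_le.
  exact: (dx_window X0 phiX phiL).
- move=> x; apply: cvgM; first exact: (lipschitz_nonlocal_cvg (vL k)).
  by apply: time_node_cvg => //; exact: test_ucont_dx hphi.
Qed.

Lemma source_rate_cvg t : 0 <= t <= T ->
  (fun i => pairing (dx i) (gg i (tidx i t)) (fun x => phi (tn i t, x))) @ \oo -->
  \int[mu]_x (S k (\row_q rho q (t, x)) (nl (t, x)) * phi (t, x)).
Proof.
move=> tT.
have LSc j := source_coef_lip rmM (sL k) j.
have csb q i t' x : `|cs q i t' x| <= LS.
  apply: (source_coef_bound rmM (s0 k) (sL k)); apply: Rh_box; exact: time_idx_le.
have clb q p : `|coef q (nl p)| <= LS.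
  by apply: (source_coef_bound rmM (s0 k) (sL k)); exact: nonlocal_box.
have Li t' := L1_test hphi X0 L0 phiX phiL t'.
(* Expanding the source into its coefficients leaves finitely many products of the same kind, with
   the density minus [rm] as weak factor. *)
have e1' : (fun i => pairing (dx i) (gg i (tidx i t)) (fun x => phi (tn i t, x))) =
    (fun i => \sum_q \int[mu]_x ((sUh q i t x - rm) * (cs q i t x * phi (tn i t, x)))).
  apply/funext => i; rewrite -Rintegral_sum//.
    apply: eq_Rintegral => x _; rewrite /pc /gg (source_affine rmM (s0 k) (slin k)) mulr_suml.
    by apply: eq_bigr => q _; rewrite mxE mulrA; congr (_ * _); rewrite mulrC.
  move=> q; apply: (@L1_M _ (B + `|rm|)).
  - by apply: measurable_funB => //; exact: sUh_m.
  - by move=> x; rewrite (le_trans (ler_normB _ _))// lerD2r; exact: sUh_b.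
  - apply: (@L1_M _ LS) => //.
    exact: (measurable_pc (dx0 i) (fun j => coef q (vec (Rh i (tidx i t)) j))).
have e2' : \int[mu]_x (S k (\row_q rho q (t, x)) (nl (t, x)) * phi (t, x)) =
    \sum_q \int[mu]_x ((rho q (t, x) - rm) * (coef q (nl (t, x)) * phi (t, x))).
  rewrite -Rintegral_sum//.
    apply: eq_Rintegral => x _; rewrite (source_affine rmM (s0 k) (slin k)) mulr_suml.
    by apply: eq_bigr => q _; rewrite mxE mulrA; congr (_ * _); rewrite mulrC.
  move=> q; apply: (@L1_M _ (B + `|rm|)).
  - by apply: measurable_funB.
  - by move=> x; rewrite (le_trans (ler_normB _ _))// lerD2r.
  - apply: (@L1_M _ LS) => //.
    exact: (measurableT_comp (lipschitz_nonlocal_measurable (@LSc q))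
      (pair1_measurable (t : measurableTypeR R))).
rewrite e1' e2'; apply: (@seq_cvg_sum _ _ (fun q i =>
  \int[mu]_x ((sUh q i t x - rm) * (cs q i t x * phi (tn i t, x))))) => q.
apply: (@cvg_weak_strong _ (B + `|rm|) (fun i x => sUh q i t x - rm)
  (fun i x => cs q i t x * phi (tn i t, x))
  (fun x => rho q (t, x) - rm) (fun x => coef q (nl (t, x)) * phi (t, x))
  (fun x => LS * ((2 * X * L) * window X x))).
- by move=> i; apply: measurable_funB => //; exact: sUh_m.
- by move=> i x; rewrite (le_trans (ler_normB _ _))// lerD2r; exact: sUh_b.
- by move=> g gi; exact: half_shift_weak_cvg.
- move=> i; apply: measurable_funM; first
    exact: (measurable_pc (dx0 i) (fun j => coef q (vec (Rh i (tidx i t)) j))).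
  exact: (ucont_measurable_section _ (test_ucont hphi)).
- exact/L1_Z/L1_Z.
- move=> i x; rewrite normrM; apply: ler_pM => //.
  exact: (test_window hphi X0 L0 phiX phiL).
- move=> x; apply: cvgM; first exact: (lipschitz_nonlocal_cvg (@LSc q)).
  by apply: time_node_cvg => //; exact: test_ucont hphi.
Qed.

Lemma weak_rate_cvg t : 0 <= t <= T ->
  (fun i => weak_rate phi (fun i n => U i n k) ff gg dx dt i (tidx i t)) @ \oo --> limit_rate t.
Proof.
move=> tT; apply: cvgD; first exact: dt_rate_cvg.
by apply: cvgD; [exact: flux_rate_cvg|exact: source_rate_cvg].
Qed.

End Rates.

End LimitPassage.

Section StripWindow.
Context {R : realType}.
Local Notation mu := (@lebesgue_measure R).
Local Notation T2 := (measurableTypeR R * measurableTypeR R)%type.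

Lemma strip_window_integrable (T X K : R) (g : R * R -> R) : 0 <= K ->
  measurable_fun [set: T2] g -> (forall p, `|g p| <= K * window X p.2) ->
  mu2.-integrable (strip T) (EFin \o g).
Proof.
move=> K0 mg gK.
have mA : measurable (`]0, T[%classic : set (measurableTypeR R)) by exact: measurable_itv.
have mB : measurable (`]- (X + 1), X + 1]%classic : set (measurableTypeR R)).
  exact: measurable_itv.
have mstrip : measurable (strip T : set T2) by exact: measurableX.
pose A : set (measurableTypeR R) := `]0, T[%classic.
pose A' : set (measurableTypeR R) := `]- (X + 1), X + 1]%classic.
pose W : set T2 := `]0, T[%classic `*` `]- (X + 1), X + 1]%classic.
have mW : measurable W by exact: measurableX.
have Wfin : (mu2 W < +oo)%E.
  have fA : mu (`]0, T[%classic : set (measurableTypeR R)) \is a fin_num.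
    by rewrite ge0_fin_numE// lebesgue_measure_itv /=; case: ifP => _; rewrite -?EFinD ltry.
  have fB : mu (`]- (X + 1), X + 1]%classic : set (measurableTypeR R)) \is a fin_num.
    by rewrite ge0_fin_numE// lebesgue_measure_itv /=; case: ifP => _; rewrite -?EFinD ltry.
  rewrite -ge0_fin_numE//; rewrite (_ : mu2 W = (mu A * mu A')%E); last exact: product_measure1E.
  exact: fin_numM.
have Wi : mu2.-integrable (strip T) (EFin \o (fun p => K * \1_W p)).
  apply: (RintegrableZ mstrip K).
  apply: (@integrableS _ _ R mu2 setT _ _ measurableT mstrip (@subsetT _ _)).
  apply/integrableP; split; first by apply/measurable_EFinP; exact: measurable_indic.
  under eq_integral => p _ do rewrite /= indicE ger0_norm// -indicE.
  by rewrite integral_indic// setIT.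
apply: le_integrable Wi => //.
  by apply/measurable_EFinP; exact: measurable_funS mg.
move=> [t x] [tT _]; rewrite /= lee_fin; apply: le_trans (gK _) _.
rewrite ger0_norm ?mulr_ge0// ler_wpM2l// /window !indicE ler_nat /=.
have [xW|//] := boolP (x \in _); rewrite (_ : (t, x) \in W)//.
by rewrite inE; split => //=; rewrite inE in xW.
Qed.

End StripWindow.

Section WeakSolutionLimit.
Context {R : realType} {N m : nat}.
Local Notation mu := (@lebesgue_measure R).
Local Notation T2 := (measurableTypeR R * measurableTypeR R)%type.
Variables (w : 'I_m -> 'I_N -> R -> R) (a b M B : R).
Hypothesis kw : forall l k, is_kernel (w l k).
Hypothesis wM : forall l k (a b : R), a <= b -> (total_variation a b (w l k) <= M%:E)%E.
Variables (U Uh : nat -> nat -> 'I_N -> int -> R) (Rh : nat -> nat -> 'I_m -> int -> R).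
Variables (dx dt e1 e2 : nat -> R) (nst : nat -> nat) (rho : 'I_N -> R * R -> R).
Hypotheses (dx0 : forall i, 0 < dx i) (dt0 : forall i, 0 < dt i).
Hypotheses (dxc : dx @ \oo --> 0) (dtc : dt @ \oo --> 0) (e1c : e1 @ \oo --> 0)
  (e2c : e2 @ \oo --> 0).
Hypothesis UB : forall i n k j, (n <= nst i)%N -> `|U i n k j| <= B.
Hypothesis Uh_close : forall i n k j, (n <= nst i)%N -> `|Uh i n k j - U i n k j| <= e1 i.
Hypothesis UhB : forall i n k j, (n <= nst i)%N -> `|Uh i n k j| <= B.
Hypothesis Rh_box : forall i n j, (n <= nst i)%N -> in_box a b (vec (Rh i n) j).
Hypothesis Rh_close : forall i n l j, (n <= nst i)%N ->
  `|Rh i n l j - \sum_k \int[mu]_y (w l k (y - j%:~R * dx i) * pc (dx i) (U i n k) y)| <= e2 i.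
Hypothesis U_rho : forall k t g, L1 g ->
  (fun i => \int[mu]_x (step_fun U dx dt nst i k (t, x) * g x)) @ \oo -->
  \int[mu]_x (rho k (t, x) * g x).
Hypothesis mrho : forall k, measurable_fun [set: T2] (rho k).
Hypothesis rhoB : forall k p, `|rho k p| <= B.
Variables (F : 'I_N -> R -> 'rV[R]_m -> R) (V : 'I_N -> 'rV[R]_m -> R).
Variables (S : 'I_N -> 'rV[R]_N -> 'rV[R]_m -> R) (rm rM LF LV LS : R).
Hypotheses (rmM : rm < rM) (fv : forall k (r : R) q, F k r q = r * V k q).
Hypothesis VB : forall k q, in_box a b q -> `|V k q| <= LF.
Hypothesis vL : forall k, speed_lipschitz LV a b (V k).
Hypothesis s0 : forall k q, S k (const_mx rm) q = 0.
Hypothesis sL : forall k, source_lipschitz LS rm rM a b (S k).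
Hypothesis slin : forall k, linear_in_density (S k).
Variables (T lam0 Bf Bg : R) (G H : nat -> nat -> 'I_N -> int -> R) (c : nat -> R).
Variable rho0 : 'I_N -> R -> R.
Hypotheses (T0 : 0 < T) (dt1 : forall i, dt i <= 1) (dx1 : forall i, dx i <= 1).
Hypotheses (cc : c @ \oo --> 0) (lam00 : 0 < lam0) (lamP : forall i, lam0 <= dt i / dx i).
Hypotheses (nstl : forall i, (nst i)%:R * dt i <= T)
  (nstr : forall i, T < (nst i).+1%:R * dt i).
Local Notation ff k := (fun i n j => F k (Uh i n k j) (vec (Rh i n) j)).
Local Notation gg k := (fun i n j => S k (vec (Uh i n) j) (vec (Rh i n) j)).
Hypothesis GB : forall i n k j, (n <= nst i)%N -> `|G i n k j| <= c i.
Hypothesis HB : forall i n k j, (n <= nst i)%N -> `|H i n k j| <= c i.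
Hypothesis fB : forall i n k j, (n <= nst i)%N -> `|ff k i n j| <= Bf.
Hypothesis gB : forall i n k j, (n <= nst i)%N -> `|gg k i n j| <= Bg.
Hypothesis step : forall i n k, (n <= nst i)%N -> U i n.+1 k =
  projected (dt i / dx i) (dt i) (U i n k) (G i n k) (H i n k) (ff k i n) (gg k i n).
Hypothesis init : forall k g, L1 g ->
  (fun i => pairing (dx i) (U i 0%N k) g) @ \oo --> \int[mu]_x (rho0 k x * g x).
Local Notation nl := (nonlocal w rho).

Section OneTest.
Variables (phi : R * R -> R) (X L : R) (k : 'I_N).
Hypotheses (hphi : C1_compact T phi) (X0 : 0 < X) (L0 : 0 < L).
Hypothesis phiX : forall p : R * R, X <= `|p.2| \/ T <= p.1 ->
  [/\ phi p = 0, dt_ phi p = 0 & dx_ phi p = 0].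
Hypothesis phiL : forall p, `|dt_ phi p| <= L /\ `|dx_ phi p| <= L.

Let nlb p : in_box a b (nl p).
Proof. exact: (nonlocal_box kw wM dx0 dxc e2c UB Rh_box Rh_close U_rho). Qed.

Let mlip (f : 'rV[R]_m -> R) K :
  (forall q q', in_box a b q -> in_box a b q' -> `|f q - f q'| <= K * dist1 q q') ->
  measurable_fun [set: T2] (fun p => f (nl p)).
Proof.
exact: (lipschitz_nonlocal_measurable kw wM dx0 dt0 dxc e2c UB Rh_box Rh_close U_rho).
Qed.

Let mphi : measurable_fun [set: T2] phi. Proof. exact: ucont_measurable (test_ucont hphi). Qed.
Let mdt : measurable_fun [set: T2] (dt_ phi).
Proof. exact: ucont_measurable (test_ucont_dt hphi). Qed.
Let mdx : measurable_fun [set: T2] (dx_ phi).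
Proof. exact: ucont_measurable (test_ucont_dx hphi). Qed.

Let B0 : 0 <= B. Proof. exact: le_trans (rhoB k (0, 0)). Qed.
Let LF0 : 0 <= LF. Proof. exact: le_trans (VB k (nlb (0, 0))). Qed.
Let coefb q p : `|source_coef rm rM (S k) q (nl p)| <= LS.
Proof. by apply: (source_coef_bound rmM (s0 k) (sL k)); exact: nlb. Qed.
Let LS0 : 0 <= LS. Proof. exact: le_trans (coefb k (0, 0)). Qed.

Let dtw p : `|dt_ phi p| <= L * window X p.2.
Proof. by case: p => t x; exact: (dt_window X0 phiX phiL). Qed.
Let dxw p : `|dx_ phi p| <= L * window X p.2.
Proof. by case: p => t x; exact: (dx_window X0 phiX phiL). Qed.
Let phw p : `|phi p| <= 2 * X * L * window X p.2.
Proof. by case: p => t x; exact: (test_window hphi X0 L0 phiX phiL). Qed.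

Lemma density_integrable : mu2.-integrable (strip T) (EFin \o (fun p => rho k p * dt_ phi p)).
Proof.
apply: (@strip_window_integrable _ T X (B * L)).
- by rewrite mulr_ge0// ltW.
- exact: measurable_funM.
- by move=> p; rewrite normrM -mulrA; apply: ler_pM.
Qed.

Lemma flux_integrable :
  mu2.-integrable (strip T) (EFin \o (fun p => F k (rho k p) (nl p) * dx_ phi p)).
Proof.
apply: (@strip_window_integrable _ T X (B * LF * L)).
- by rewrite !mulr_ge0// ltW.
- apply: measurable_funM => //; under eq_fun do rewrite fv.
  by apply: measurable_funM => //; exact: (mlip (vL k)).
- move=> p; rewrite fv normrM -mulrA; apply: ler_pM => //; rewrite normrM.
  by apply: ler_pM => //; exact: VB.
Qed.

Lemma source_integrable :
  mu2.-integrable (strip T) (EFin \o (fun p => S k (\row_q rho q p) (nl p) * phi p)).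
Proof.
have B0r : 0 <= B + `|rm| by rewrite addr_ge0.
apply: (@strip_window_integrable _ T X ((N%:R * (LS * (B + `|rm|))) * (2 * X * L))).
- by rewrite !mulr_ge0// ltW.
- apply: measurable_funM => //.
  under eq_fun do rewrite (source_affine rmM (s0 k) (slin k)).
  apply: measurable_sum => q; apply: measurable_funM.
    exact: (mlip (source_coef_lip rmM (sL k) q)).
  by under eq_fun do rewrite mxE; apply: measurable_funB.
- move=> p; rewrite (source_affine rmM (s0 k) (slin k)) normrM -[leRHS]mulrA; apply: ler_pM => //.
  apply: norm_sum_le => q; rewrite normrM mxE; apply: ler_pM => //.
  by rewrite (le_trans (ler_normB _ _))// lerD2r.
Qed.

Let rate_bound i n : (n <= nst i)%N ->
  `|weak_rate phi (fun i n => U i n k) (ff k) (gg k) dx dt i n| <=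
  B * (L * (2 * (X + 1))) + (Bf * (L * (2 * (X + 1))) + Bg * (2 * X * L * (2 * (X + 1)))).
Proof.
move=> nn; have P (u : int -> R) Bu (psi : R -> R) K : (forall j, `|u j| <= Bu) ->
    L1 psi -> (forall x, `|psi x| <= K * window X x) ->
    `|pairing (dx i) u psi| <= Bu * (K * (2 * (X + 1))).
  move=> uB pi pK; apply: le_trans (pairing_le (dx0 i) uB pi) _.
  rewrite ler_wpM2l ?(le_trans _ (uB 0))//.
  rewrite -(integral_window X0) -RintegralZl//; last exact: L1_window.
  apply: le_Rintegral => //; [exact: L1_norm|exact/L1_Z/L1_window].
rewrite /weak_rate; apply: le_trans (ler_normD _ _) _; apply: lerD.
  apply: P; [by move=> j; exact: UB|exact: (L1_dt hphi X0 phiX phiL)|].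
  by move=> x; exact: dtw (_, x).
apply: le_trans (ler_normD _ _) _; apply: lerD.
  apply: P; [by move=> j; exact: fB|exact: (L1_dx hphi X0 phiX phiL)|].
  by move=> x; exact: dxw (_, x).
apply: P; [by move=> j; exact: gB|exact: (L1_test hphi X0 L0 phiX phiL)|].
by move=> x; exact: phw (_, x).
Qed.

(** The discrete weak form converges to the left-hand side and also to 0. *)
Lemma limit_identity : \int[mu]_x (rho0 k x * phi (0, x)) +
  \int[mu]_(t in `]0, T[) limit_rate w rho F S phi k t = 0.
Proof.
have dwf := discrete_weak_form hphi X0 L0 phiX phiL dx0 dt0 dt1 dx1 dxc dtc cc lam00 lamP nstl
  (fun i => ltW (nstr i)) (fun i n j => @UB i n k j) (fun i n j => @GB i n k j)
  (fun i n j => @HB i n k j) (fun i n j => @fB i n k j) (fun i n j => @gB i n k j)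
  (fun i n => @step i n k).
have ini := @init k _ (L1_test hphi X0 L0 phiX phiL 0).
have wr t (tT : 0 <= t <= T) := weak_rate_cvg kw wM dx0 dt0 dxc dtc e1c e2c UB Uh_close UhB Rh_box
  Rh_close U_rho mrho rhoB rmM fv VB vL s0 sL slin hphi X0 L0 phiX phiL nstr (k := k) tT.
have ts := time_sum_cvg T0 dt0 dt1 dtc nstl nstr rate_bound wr.
exact: seq_unique (cvgD ini ts) dwf.
Qed.

Lemma weak_identity :
  \int[mu]_x (rho0 k x * phi (0, x))
  + \int[mu2]_(p in strip T) (rho k p * dt_ phi p)
  + \int[mu2]_(p in strip T) (F k (rho k p) (nl p) * dx_ phi p)
  + \int[mu2]_(p in strip T) (S k (\row_q rho q p) (nl p) * phi p) = 0.
Proof.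
have mA : measurable (`]0, T[%classic : set (measurableTypeR R)) by exact: measurable_itv.
have i1 := strip_section_integrable density_integrable.
have i2 := strip_section_integrable flux_integrable.
have i3 := strip_section_integrable source_integrable.
have D23 := RintegralD mA i2 i3.
have D123 := RintegralD mA i1 (RintegrableD mA i2 i3).
apply: etrans (congr2 +%R (congr2 +%R (congr2 +%R erefl (strip_fubini density_integrable))
  (strip_fubini flux_integrable)) (strip_fubini source_integrable)) _.
rewrite -!addrA; apply: etrans limit_identity; congr (_ + _).
exact: (esym (etrans D123 (congr1 _ D23))).
Qed.

End OneTest.

Theorem limit_weak_solution : weak_solution F S w T rho0 rho.
Proof.
split=> [k|k phi hphi].
  split; first exact: measurable_funS (mrho k).
  by exists B; apply: aeW => p _; exact: rhoB.
have [[X L] /= [X0 L0 phiX phiL]] := test_bounds hphi.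
split; [exact: (flux_integrable k hphi X0 L0 phiX phiL)|exact: (source_integrable k hphi X0 L0 phiX phiL)|].
exact: (weak_identity k hphi X0 L0 phiX phiL).
Qed.

End WeakSolutionLimit.

(** * From step functions to the reconstruction with slopes *)

Section WeakStarPerturbation.
Context {R : realType}.
Local Notation T2 := (measurableTypeR R * measurableTypeR R)%type.
Variables (T B : R) (u v : nat -> R * R -> R) (r : R * R -> R) (c : nat -> R).
Hypotheses (mu_ : forall i, measurable_fun [set: T2] (u i)) (uB : forall i p, `|u i p| <= B).
Hypotheses (mv : forall i, measurable_fun (strip T : set T2) (v i)) (cc : c @ \oo --> 0).
Hypothesis uv : forall i p, strip T p -> `|v i p - u i p| <= c i.

Lemma weak_star_perturbation : weak_star_cvg T u r -> weak_star_cvg T v r.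
Proof.
move=> ur g gi.
have mstrip : measurable (strip T : set T2).
  by apply: measurableX => //; exact: measurable_itv.
have gm := Rintegrable_measurable gi.
have dB i p : strip T p -> `|(v i p - u i p) * g p| <= c i * `|g p|.
  by move=> Tp; rewrite normrM ler_wpM2r// uv.
have ngi : Rintegrable mu2 (strip T) (fun p => `|g p|) by exact: integrable_norm.
have mus i : measurable_fun (strip T : set T2) (u i) by exact: measurable_funS (mu_ i).
have iu i : Rintegrable mu2 (strip T) (fun p => u i p * g p).
  by apply: (@RintegrableM _ _ _ _ _ mstrip B).
have id i : Rintegrable mu2 (strip T) (fun p => (v i p - u i p) * g p).
  apply: (Rintegrable_le mstrip _ (dB i) (RintegrableZ mstrip (c i) ngi)).
  by apply: measurable_funM => //; exact: measurable_funB.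
apply: (@cvg_of_close _ _ (fun i => \int[mu2]_(p in strip T) (u i p * g p))
  (fun i => c i * \int[mu2]_(p in strip T) `|g p|)); last exact: ur.
- move=> i.
  have -> : \int[mu2]_(p in strip T) (v i p * g p) =
      \int[mu2]_(p in strip T) (u i p * g p + (v i p - u i p) * g p).
    by apply: eq_Rintegral => p _; rewrite -mulrDl addrC subrK.
  rewrite (RintegralD mstrip (iu i) (id i)) addrAC subrr add0r.
  rewrite -RintegralZl//.
  exact: (Rintegral_norm_le mstrip (id i) (RintegrableZ mstrip (c i) ngi) (dB i)).
- rewrite -(mul0r (\int[mu2]_(p in strip T) `|g p|)).
  by apply: cvgM => //; exact: cvg_cst.
Qed.

End WeakStarPerturbation.

Section ApproximateSolution.
Context {R : realType} {N m : nat}.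
Local Notation T2 := (measurableTypeR R * measurableTypeR R)%type.
Variables (F : 'I_N -> R -> 'rV[R]_m -> R) (S : 'I_N -> 'rV[R]_N -> 'rV[R]_m -> R).
Variables (w : 'I_m -> 'I_N -> R -> R) (C delta : R) (rho0 : 'I_N -> R -> R).
Variables (dx dt : nat -> R) (nst : nat -> nat) (T B : R) (k : 'I_N).
Hypotheses (C0 : 0 <= C) (dx0 : forall i, 0 < dx i) (dt0 : forall i, 0 < dt i).
Hypothesis nstr : forall i, T <= (nst i).+1%:R * dt i.
Local Notation U i n := (NT F S w C delta (dx i) (dt i) rho0 n).
Local Notation rD i := (rho_Delta F S w C delta (dx i) (dt i) rho0 (nst i) k).
Local Notation tidx i t := (time_idx (dt i) (nst i) t).
Local Notation uU := (step_fun (fun i n => U i n) dx dt nst).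
Local Notation sl i n j := (slope C delta (dx i) (U i n k) j).

Let corr i (p : R * R) : R :=
  sl i (tidx i p.1) (cell_idx (dx i) p.2) * (p.2 - (cell_idx (dx i) p.2)%:~R * dx i).

(** On the strip exactly one cell and one time slab contain [p]; [nstr] makes the slabs reach [T],
    so the capped time index is the true one. *)
Let rho_DeltaE i p : strip T p -> rD i p = uU i k p + corr i p.
Proof.
case: p => t x [/=]; rewrite in_itv /= => /andP[t0 tT] _.
set j0 := cell_idx (dx i) x; set n0 := tidx i t.
have tn : Num.truncn (t / dt i) = n0 /\ (n0 <= nst i)%N.
  have lt : (Num.truncn (t / dt i) <= nst i)%N.
    by rewrite truncn_le_nat ltr_pdivrMr// (lt_le_trans tT).
  by rewrite /n0 /time_idx (minn_idPl lt).
pose f j := \sum_(0 <= n < (nst i).+1) (U i n k j + sl i n j * (x - j%:~R * dx i))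
    * \1_(cell (dx i) j) x * \1_(`[n%:R * dt i, n.+1%:R * dt i[%classic) t.
have f0 j : j != j0 -> f j = 0.
  move=> jj; rewrite /f big1// => n _.
  have : x \notin cell (dx i) j.
    apply/negP; rewrite inE -(cell_preimage (dx0 i)) /= => e.
    by rewrite /j0 e eqxx in jj.
  by rewrite indicE => /negbTE ->; rewrite mulr0 mul0r.
transitivity (f j0).
  rewrite /rho_Delta -[LHS]/(\sum_(j \in [set: int]) f j).
  rewrite -(@fsbig_widen _ _ _ _ [set j0] setT f) ?fsbig_set1//.
  by move=> j [_ /= jj]; apply: f0; exact/eqP.
rewrite /f big_mkord (bigD1 (Ordinal (tn.2 : (n0 < (nst i).+1)%N)))//= big1 ?addr0.
  have xc : x \in cell (dx i) j0 by rewrite inE -(cell_preimage (dx0 i)).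
  rewrite !indicE xc mem_setE in_itv /= -ler_pdivlMr// -ltr_pdivrMr//.
  have q0 : 0 <= t / dt i by rewrite divr_ge0// ltW.
  by have := truncn_itv q0; rewrite tn.1 => ->; rewrite !mulr1.
move=> n nn; rewrite [X in _ * X](_ : _ = 0) ?mulr0//.
rewrite indicE mem_setE in_itv /= -ler_pdivlMr// -ltr_pdivrMr//.
rewrite -truncn_eq ?divr_ge0 ?ltW// tn.1; case: eqP => // e.
by move/eqP: nn => []; apply: val_inj.
Qed.

(** The distance to the node is at most half a cell, and the slope times [dx i] is at most its
    cap. *)
Let corr_bound i p : `|corr i p| <= C * dx i `^ delta.
Proof.
case: p => t x; rewrite /corr /=; set j := cell_idx _ _; set n := tidx i t.
have [_ _ h] := slope_le delta C0 (dx0 i) (U i n k) j.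
have /andP[x1 x2] := cell_idx_bounds (dx0 i) x; rewrite -/j in x1 x2.
rewrite mulrBl in x1; rewrite mulrDl in x2.
rewrite normrM (gtr0_norm (dx0 i)) in h; apply: le_trans h.
rewrite normrM mulrC ler_wpM2r// ler_norml; have := dx0 i => h0.
by apply/andP; split; move: x1 x2 h0; lra.
Qed.

Let corr_measurable i : measurable_fun [set: T2] (corr i).
Proof.
pose G q x : R := sl i q (cell_idx (dx i) x) * (x - (cell_idx (dx i) x)%:~R * dx i).
have mG q : measurable_fun setT (G q).
  apply: measurable_funM; first exact: (measurable_pc (dx0 i) (fun j => sl i q j)).
  apply: measurable_funB; first exact: measurable_id.
  exact: (measurable_pc (dx0 i) (fun j => j%:~R * dx i)).
exact: (@measurable_time_family R dt nst dt0 i G mG).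
Qed.

Hypothesis UB : forall i n k j, (n <= nst i)%N -> `|U i n k j| <= B.
Hypothesis cc : (fun i => C * dx i `^ delta) @ \oo --> 0.

Lemma rho_Delta_weak_star (r : R * R -> R) :
  measurable_fun [set: T2] r -> (forall p, `|r p| <= B) ->
  (forall t g, L1 g ->
    (fun i => \int[@lebesgue_measure R]_x (uU i k (t, x) * g x)) @ \oo -->
    \int[@lebesgue_measure R]_x (r (t, x) * g x)) ->
  weak_star_cvg T (fun i => rD i) r.
Proof.
move=> mr rB ur.
have muU i : measurable_fun [set: T2] (uU i k) by exact: step_fun_measurable.
have uUB i p : `|uU i k p| <= B by apply: UB; exact: time_idx_le.
apply: (weak_star_perturbation muU uUB (c := fun i => C * dx i `^ delta)) => //.
- move=> i; have : measurable_fun (strip T : set T2) (fun p => uU i k p + corr i p).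
    apply: (@measurable_funS _ _ T2 R setT) => //.
    by apply: measurable_funD.
  by apply: eq_measurable_fun => p; rewrite inE => /rho_DeltaE ->.
- by move=> i p Tp; rewrite rho_DeltaE// addrAC subrr add0r.
- exact: (weak_star_of_sections muU mr uUB rB).
Qed.

End ApproximateSolution.

(** * The family of approximations *)

Section IndicatorShift.
Context {R : realType}.
Local Notation mu := (@lebesgue_measure R).

(** The interval and its translate differ at most on []a - h, a]] and []b - h, b]]. *)
Lemma indic_oc_shift (a b h : R) : a <= b -> 0 <= h ->
  \int[mu]_x `|(\1_`]a, b] : R -> R) (x + h) - (\1_`]a, b] : R -> R) x| <= 2 * h.
Proof.
move=> ab h0.
have i1 c : L1 (\1_`]c - h, c] : R -> R) by exact: Rintegrable_itv.
have j1 c : \int[mu]_x (\1_`]c - h, c] : R -> R) x = h.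
  by rewrite Rintegral_indic_itv; [ring|rewrite gerBl].
rewrite (_ : 2 * h = \int[mu]_x ((\1_`]a - h, a] : R -> R) x + (\1_`]b - h, b] : R -> R) x)).
  apply: le_Rintegral => //.
  - apply: L1_norm; apply: L1_B; last exact: Rintegrable_itv.
    exact: (Rintegrable_shift h (Rintegrable_itv a b)).
  - exact: L1_D.
  - move=> x _; rewrite !indic_ocE.
    have [h1|h1] := ltP a (x + h); have [h2|h2] := leP (x + h) b;
    have [h3|h3] := ltP a x; have [h4|h4] := leP x b;
    have [h5|h5] := ltP (a - h) x; have [h6|h6] := leP x a;
    have [h7|h7] := ltP (b - h) x => /=;
    rewrite ?subrr ?subr0 ?sub0r ?normrN ?normr0 ?normr1 ?addr0 ?add0r ?ler01 ?lexx //; lra.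
rewrite RintegralD; [|exact: measurableT|exact: i1|exact: i1].
by rewrite !j1; ring.
Qed.

Lemma indic_oc_shiftN (a b h : R) : a <= b -> 0 <= h ->
  \int[mu]_x `|(\1_`]a, b] : R -> R) (x - h) - (\1_`]a, b] : R -> R) x| <= 2 * h.
Proof.
move=> ab h0; have := indic_oc_shift ab h0.
set f := fun x => `|(\1_`]a, b] : R -> R) (x - h) - (\1_`]a, b] : R -> R) x|.
have fi : L1 f.
  apply: L1_norm; apply: L1_B; last exact: Rintegrable_itv.
  exact: (Rintegrable_shift (- h) (Rintegrable_itv a b)).
rewrite -(Rintegral_shift h fi).
rewrite (_ : \int[mu]_x f (x + h) =
  \int[mu]_x `|(\1_`]a, b] : R -> R) (x + h) - (\1_`]a, b] : R -> R) x|)//.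
by apply: eq_Rintegral => x _; rewrite /f addrK distrC.
Qed.

End IndicatorShift.

Section SchemeFamily.
Context {R : realType} {N m : nat}.
Local Notation mu := (@lebesgue_measure R).
Variables (F : 'I_N -> R -> 'rV[R]_m -> R) (V : 'I_N -> 'rV[R]_m -> R).
Variables (S : 'I_N -> 'rV[R]_N -> 'rV[R]_m -> R) (w : 'I_m -> 'I_N -> R -> R).
Variables (C delta rm rM eps LF LV LS M : R).
Hypotheses (hN : (1 <= N)%N) (rm0 : 0 <= rm) (rmM : rm < rM) (eps0 : 0 < eps).
Let a0 : R := rm - eps.
Let b0 : R := N%:R * rM + eps.
Hypothesis fL : forall k, flux_lipschitz LF rm rM a0 b0 (F k).
Hypothesis fv : forall k (r : R) q, F k r q = r * V k q.
Hypotheses (LV0 : 0 <= LV) (vL : forall k, speed_lipschitz LV a0 b0 (V k)).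
Hypothesis s0 : forall k q, S k (const_mx rm) q = 0.
Hypotheses (LS0 : 0 <= LS) (sL : forall k, source_lipschitz LS rm rM a0 b0 (S k)).
Hypothesis slin : forall k, linear_in_density (S k).
Hypothesis kw : forall l k, is_kernel (w l k).
Hypothesis wM : forall l k (a b : R), a <= b -> (total_variation a b (w l k) <= M%:E)%E.
Hypotheses (M0 : 0 <= M) (C0 : 0 <= C) (d0 : 0 <= delta).
Variables (dx dt : nat -> R) (nst : nat -> nat) (Lam eta lam0 : R).
Hypotheses (dx0 : forall i, 0 < dx i) (dt0 : forall i, 0 < dt i).
Hypotheses (dx1 : forall i, dx i <= 1).
Hypothesis fits : forall i l k, grid_fits (dx i) (w l k).
Hypothesis CFL : forall i, (dt i / dx i * LF) ^+ 2 + dt i / dx i * LF <= 4^-1.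
Hypotheses (Lam0 : 0 <= Lam) (hLam : forall i, LF = 0 \/ dt i / dx i <= Lam).
Hypotheses (eta0 : 0 <= eta) (eta1' : eta <= 1).
Local Notation q0 i := (rate_bound (N:=N) C delta rm rM LS (dx i) (dt i) Lam).
Local Notation K := (growth_cst (N:=N) (m:=m) rm rM LV LS M).
Hypothesis small1 : forall i, N%:R * (quadrature_cst rM M * dx i) + N%:R * eta <= eps / 2.
Hypothesis small2 : forall i, q0 i <= 1.
Hypothesis small3 : forall i, N%:R * (q0 i * (1 + 4 * (M + 1) * dx i)) <= eps.
Variable rho0 : 'I_N -> R -> R.
Hypothesis mrho0 : forall k, measurable_fun setT (rho0 k).
Hypothesis rho0_range : forall k, {ae mu, forall x, rm <= rho0 k x < rM}.
Hypothesis growth : forall i, K * ((nst i)%:R * dt i) <= eta.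
Hypotheses (lam00 : 0 < lam0) (lamP : forall i, lam0 <= dt i / dx i).

Local Notation U i n := (NT F S w C delta (dx i) (dt i) rho0 n).
Local Notation Uh i n := (rho_half F S w C delta (dx i) (dt i) (U i n)).
Local Notation Rh i n := (R_half F S w C delta (dx i) (dt i) (U i n)).
Local Notation Fh i n k j := (F k (Uh i n k j) (vec (Rh i n) j)).
Local Notation Sh i n k j := (S k (vec (Uh i n) j) (vec (Rh i n) j)).
Local Notation B := (density_bound rM).

Let K0 : 0 <= K. Proof. exact: growth_cst_ge0. Qed.

(** The induction carries the amount [K * (n * dt)] by which the range may have widened so far;
    [growth] keeps it below the fixed [eta] under which the one-step estimate holds. *)
Lemma family_range i n : (n <= nst i)%N -> forall k j, rm - eta <= U i n k j <= rM + eta.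
Proof.
have wide q : (q <= nst i)%N -> K * (q%:R * dt i) <= eta.
  move=> qn; apply: le_trans (growth i); rewrite ler_wpM2l// ler_wpM2r ?ler_nat//.
  exact: ltW.
suff H : (n <= nst i)%N -> forall k j,
    rm - K * (n%:R * dt i) <= U i n k j <= rM + K * (n%:R * dt i).
  move=> nn k j; have /andP[h1 h2] := H nn k j; have := wide _ nn => h3.
  by apply/andP; split; move: h1 h2 h3; lra.
elim: n => [|n ih] nn k j.
  rewrite mul0r mulr0 subr0 addr0.
  exact: (cell_avg_range (mrho0 k) (ltW rmM) (rho0_range k) j (dx0 i)).
have ih' := ih (ltnW nn).
have rng k' j' : rm - eta <= U i n k' j' <= rM + eta.
  have /andP[h1 h2] := ih' k' j'; have := wide _ (ltnW nn) => h3.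
  by apply/andP; split; move: h1 h2 h3; lra.
have := NT_step_range hN rm0 rmM eps0 fL fv LV0 vL s0 LS0 sL slin kw wM M0 C0 (dx0 i) (dt0 i)
  (fits i) (CFL i) Lam0 (hLam i) eta0 eta1' (small1 i) (small2 i) (small3 i) rng ih' k j.
rewrite -natr1 => /andP[h1 h2]; apply/andP; split.
  apply: le_trans h1; rewrite le_eqVlt; apply/orP; left; apply/eqP; ring.
apply: le_trans h2 _; rewrite le_eqVlt; apply/orP; left; apply/eqP; ring.
Qed.

Section OneStep.
Variables (i n : nat).
Hypothesis nn : (n <= nst i)%N.
Let rng := family_range nn.

Lemma family_in_range : R_in_range F S w C delta (dx i) (dt i) rho0 a0 b0 n.
Proof.
move=> j; split.
  exact: (Rn_box delta hN rm0 rmM eps0 kw wM C0 (dx0 i) (fits i) eta0 eta1' (small1 i) rng).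
exact: (R_half_box hN rm0 rmM eps0 fL fv s0 sL slin kw wM C0 (dx0 i) (dt0 i) (fits i) Lam0
  (hLam i) eta0 eta1' (small1 i) (small3 i) rng).
Qed.

Lemma family_bound k j : `|U i n k j| <= B.
Proof. exact: (state_bound rm0 rmM eta0 eta1' rng). Qed.

Lemma family_half_close k j : `|Uh i n k j - U i n k j| <= q0 i / 2.
Proof.
exact: (rho_half_close delta hN rm0 rmM eps0 fL fv s0 sL slin kw wM C0 (dx0 i) (dt0 i) (fits i)
  Lam0 (hLam i) eta0 eta1' (small1 i) rng).
Qed.

Definition nonlocal_error i : R :=
  N%:R * (q0 i * (1 + 4 * (M + 1) * dx i) / 2) + N%:R * (quadrature_cst rM M * dx i).

Lemma family_nonlocal l j :
  `|Rh i n l j - \sum_k \int[mu]_y (w l k (y - j%:~R * dx i) * pc (dx i) (U i n k) y)| <=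
  nonlocal_error i.
Proof.
have h1 := R_half_close delta hN rm0 rmM eps0 fL fv s0 sL slin kw wM C0 (dx0 i) (dt0 i) (fits i)
  Lam0 (hLam i) eta0 eta1' (small1 i) rng l j.
have h2 : `|Rn w C delta (dx i) (U i n) l j -
    \sum_k \int[mu]_y (w l k (y - j%:~R * dx i) * pc (dx i) (U i n k) y)| <=
    N%:R * (quadrature_cst rM M * dx i).
  rewrite /Rn -sumrB; apply: norm_sum_le => k.
  rewrite -(kconv_shiftE (kw l k) (dx0 i) j (family_bound k)).
  exact: (Rlk_conv delta rm0 rmM kw wM C0 (dx0 i) (fits i) eta0 eta1' rng).
rewrite -(subrK (Rn w C delta (dx i) (U i n) l j) (Rh i n l j)) -addrA.
by apply: le_trans (ler_normD _ _) _; exact: lerD.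
Qed.

Lemma family_flux_bound k j : `|Fh i n k j| <= (B + 1) * LF.
Proof.
exact: (flux_half_bound hN rm0 rmM eps0 fL fv s0 sL slin kw wM C0 (dx0 i) (dt0 i) (fits i)
  Lam0 (hLam i) eta0 eta1' (small1 i) (small2 i) (small3 i) rng).
Qed.

Lemma family_source_bound k j : `|Sh i n k j| <= source_bound (N:=N) rm LS (B + 1).
Proof.
exact: (source_half_bound hN rm0 rmM eps0 fL fv s0 sL slin kw wM C0 (dx0 i) (dt0 i) (fits i)
  Lam0 (hLam i) eta0 eta1' (small1 i) (small2 i) (small3 i) rng).
Qed.

End OneStep.

Local Notation G i n k := (fun j => dx i * slope C delta (dx i) (U i n k) j).
Local Notation H i n k :=
  (fun j => dx i * slope C delta (dx i) (rho_stag F S w C delta (dx i) (dt i) (U i n) k) j).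

Lemma family_slope_bound i (u : int -> R) j :
  `|dx i * slope C delta (dx i) u j| <= C * dx i `^ delta.
Proof. by have [] := slope_le delta C0 (dx0 i) u j. Qed.

Let scale8 (h a b : R) : h / 8 * (a - b) = (h * a - h * b) / 8.
Proof. by ring. Qed.

Lemma family_step i n k : U i n.+1 k = projected (dt i / dx i) (dt i) (U i n k)
  (G i n k) (H i n k) (fun j => Fh i n k j) (fun j => Sh i n k j).
Proof.
apply/funext => j.
have E q : rho_stag F S w C delta (dx i) (dt i) (U i n) k q =
    staggered (dt i / dx i) (dt i) (U i n k) (G i n k) (fun j => Fh i n k j)
      (fun j => Sh i n k j) q.
  by rewrite /rho_stag /staggered -mulrBr mulrAC.
change (U i n.+1 k j) with (NT_step F S w C delta (dx i) (dt i) (U i n) k j).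
rewrite /NT_step /projected; congr (_ - _); first by rewrite (E j) (E (j - 1)).
exact: scale8.
Qed.

(** Interval indicators have the translation constant 2, the scaled slopes are at most [C] since
    [dx <= 1], and [dx] is at most [dt / lam0]. The constants therefore do not depend on the step
    sizes. *)
Lemma family_variation : exists k12 : R * R, [/\ 0 <= k12.1, 0 <= k12.2 &
  forall i n k a b, (n < nst i)%N -> a <= b ->
  `|pairing (dx i) (U i n.+1 k) (\1_`]a, b]) - pairing (dx i) (U i n k) (\1_`]a, b])| <=
  dt i * (k12.1 + k12.2 * (b - a))].
Proof.
have B0 : 0 <= B by rewrite /density_bound; move: rm0 rmM; lra.
have LF0 : 0 <= (B + 1) * LF by exact: le_trans (family_flux_bound (leq0n (nst 0)) (Ordinal hN) 0).
have S0 : 0 <= source_bound (N:=N) rm LS (B + 1).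
  exact: le_trans (family_source_bound (leq0n (nst 0)) (Ordinal hN) 0).
exists (2 * lam0^-1 * (B / 2 + C / 4) + (B + 1) * LF * 2, source_bound (N:=N) rm LS (B + 1)).
split; [rewrite /=|exact: S0|].
  apply: addr_ge0; last by rewrite mulr_ge0.
  by rewrite mulr_ge0 ?mulr_ge0 ?invr_ge0 ?(ltW lam00)// addr_ge0 ?divr_ge0.
move=> i n k a b /ltnW nn ab; rewrite (family_step i n k).
have pw : dx i `^ delta <= 1.
  have -> : 1 = 1 `^ delta :> R by rewrite powR1.
  by rewrite ge0_ler_powR// ?nnegrE ?ler01// ltW.
have cC : C * dx i `^ delta <= C by rewrite ler_piMr.
have Kh : 2 * dx i <= 2 * (lam0^-1 * dt i).
  rewrite ler_pM2l// ler_pdivlMl//.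
  by have := lamP i; rewrite ler_pdivlMr.
have bd (u : int -> R) Bu : (forall j, `|u j| <= Bu) -> bounded_seq u by move=> h; exists Bu.
have := @projected_variation R (dx i) (dx0 i) (dt i / dx i) (dt i) (U i n k) (G i n k) (H i n k)
  (fun j => Fh i n k j) (fun j => Sh i n k j)
  (bd _ _ (family_bound nn k)) (bd _ _ (fun j => family_slope_bound i _ j))
  (bd _ _ (fun j => family_slope_bound i _ j)) (bd _ _ (family_flux_bound nn k))
  (bd _ _ (family_source_bound nn k)) B (C * dx i `^ delta) ((B + 1) * LF)
  (source_bound (N:=N) rm LS (B + 1)) (family_bound nn k)
  (fun j => family_slope_bound i _ j) (fun j => family_slope_bound i _ j)
  (family_flux_bound nn k) (family_source_bound nn k) erefl (ltW (dt0 i)) (\1_`]a, b]) 2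
  (Rintegrable_itv a b) (indic_oc_shift ab (ltW (dx0 i))) (indic_oc_shiftN ab (ltW (dx0 i))).
move=> h; apply: le_trans h _.
have -> : \int[mu]_x `|(\1_`]a, b] : R -> R) x| = b - a.
  rewrite -(Rintegral_indic_itv ab); apply: eq_Rintegral => x _.
  by rewrite indicE ger0_norm.
apply: (@le_trans _ _ (2 * (lam0^-1 * dt i) * (B / 2 + C / 4) +
   dt i * ((B + 1) * LF * 2 + source_bound (N:=N) rm LS (B + 1) * (b - a)))).
  rewrite lerD2r; apply: ler_pM => //.
  - by rewrite mulr_ge0// ltW.
  - by rewrite addr_ge0 ?divr_ge0// mulr_ge0// powR_ge0.
  - by rewrite lerD2l ler_pM2r.
rewrite le_eqVlt; apply/orP; left; apply/eqP; rewrite /=; ring.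
Qed.

Variable T : R.
Hypotheses (T0 : 0 < T) (dt1 : forall i, dt i <= 1).
Hypotheses (dxc : dx @ \oo --> 0) (dtc : dt @ \oo --> 0).
Hypothesis q0c : (fun i => q0 i) @ \oo --> 0.
Hypothesis cc : (fun i => C * dx i `^ delta) @ \oo --> 0.
Hypotheses (nstl : forall i, (nst i)%:R * dt i <= T)
  (nstr : forall i, T < (nst i).+1%:R * dt i).

Lemma nonlocal_error_cvg : nonlocal_error @ \oo --> 0.
Proof.
rewrite -(addr0 0); apply: cvgD.
  rewrite -(mulr0 N%:R); apply: cvgM; first exact: cvg_cst.
  rewrite -(mul0r 2^-1); apply: cvgM; last exact: cvg_cst.
  rewrite -(mul0r (1 + 4 * (M + 1) * 0)); apply: cvgM => //.
  by apply: cvgD; [exact: cvg_cst|apply: cvgM => //; exact: cvg_cst].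
rewrite -(mulr0 N%:R); apply: cvgM; first exact: cvg_cst.
by rewrite -(mulr0 (quadrature_cst rM M)); apply: cvgM => //; exact: cvg_cst.
Qed.

Let VB k q : in_box a0 b0 q -> `|V k q| <= LF.
Proof. by move=> qb; apply: (@speed_bound _ _ rm rM a0 b0 LF _ (F k)). Qed.

Theorem family_limit : exists (sub : nat -> nat) (rho : 'I_N -> R * R -> R),
  [/\ increasing_seq sub,
    forall k, weak_star_cvg T (fun i => rho_Delta F S w C delta (dx (sub i)) (dt (sub i)) rho0
      (nst (sub i)) k) (rho k) &
    weak_solution F S w T rho0 rho].
Proof.
have B0 : 0 < B by rewrite /density_bound; move: rm0 rmM; lra.
have [[k1 k2] /= [k10 k20 UV]] := family_variation.
have [sub [rho [inc mr rB Ur]]] := weak_compactness dx0 dt0 dtc B0 k10 k20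
  (fun i n k j nn => family_bound nn k j) UV.
have scvg (u : nat -> R) (l : R) : u @ \oo --> l -> (fun i => u (sub i)) @ \oo --> l.
  by move=> ul; exact: (cvg_increasing_seq inc ul).
exists sub, rho; split => //.
  move=> k; apply: (@rho_Delta_weak_star R N m F S w C delta rho0 (fun i => dx (sub i))
    (fun i => dt (sub i)) (fun i => nst (sub i)) T B k C0) => //.
  - by move=> i; exact: ltW.
  - by move=> i n k' j nn; exact: (family_bound nn).
  - exact: (scvg _ _ cc).
  - exact: (Ur k).
(* One bound has to serve both the values and the half-step values; the latter may exceed [B] by
   [q0 / 2], hence [B + 1]. *)
apply: (@limit_weak_solution R N m w a0 b0 M (B + 1) kw wM (fun i n => U (sub i) n)
  (fun i n => Uh (sub i) n) (fun i n => Rh (sub i) n) (fun i => dx (sub i)) (fun i => dt (sub i))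
  (fun i => q0 (sub i) / 2) (fun i => nonlocal_error (sub i)) (fun i => nst (sub i)) rho
  (fun i => dx0 (sub i)) (fun i => dt0 (sub i)) (scvg _ _ dxc) (scvg _ _ dtc) _
  (scvg _ _ nonlocal_error_cvg) _ _ _ _ _ _ mr _ F V S rm rM LF LV LS rmM fv VB vL s0 sL slin
  T lam0 ((B + 1) * LF) (source_bound (N:=N) rm LS (B + 1))
  (fun i n k => G (sub i) n k) (fun i n k => H (sub i) n k) (fun i => C * dx (sub i) `^ delta)
  rho0 T0 (fun i => dt1 (sub i)) (fun i => dx1 (sub i)) (scvg _ _ cc) lam00
  (fun i => lamP (sub i)) (fun i => nstl (sub i)) (fun i => nstr (sub i))).
- rewrite -(mul0r 2^-1); apply: cvgM; [exact: (scvg _ _ q0c)|exact: cvg_cst].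
- by move=> i n k j nn; apply: le_trans (family_bound nn k j) _; rewrite lerDl.
- by move=> i n k j nn; exact: (family_half_close nn).
- move=> i n k j nn; have := family_half_close nn k j; have := family_bound nn k j.
  have := small2 (sub i); rewrite !ler_norml => h /andP[h1 h2] /andP[h3 h4].
  by apply/andP; split; lra.
- by move=> i n j nn; have [] := family_in_range nn j.
- by move=> i n l j nn; exact: (family_nonlocal nn).
- exact: Ur.
- by move=> k p; apply: le_trans (rB k p) _; rewrite lerDl.
- by move=> i n k j nn; exact: family_slope_bound.
- by move=> i n k j nn; exact: family_slope_bound.
- by move=> i n k j nn; exact: (family_flux_bound nn).
- by move=> i n k j nn; exact: (family_source_bound nn).
- by move=> i n k nn; exact: family_step.
- move=> k g gi.
  exact: (cell_avg_weak_cvg (mrho0 k) (ltW rmM) (rho0_range k) (fun i => dx0 (sub i))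
    (scvg _ _ dxc) gi).
Qed.

End SchemeFamily.

Lemma powR_cvg0 (R : realType) (x : nat -> R) (p : R) : 0 < p -> (forall i, 0 < x i) ->
  x @ \oo --> 0 -> (fun i => x i `^ p) @ \oo --> 0.
Proof.
move=> p0 x0 xc; apply/cvgrPdist_le => e e0.
have d0 : 0 < e `^ p^-1 by exact: powR_gt0.
have /cvgrPdist_lt /(_ _ d0) := xc; apply: filterS => i.
rewrite !sub0r !normrN gtr0_norm// ger0_norm ?powR_ge0// => xe.
have -> : e = (e `^ p^-1) `^ p by rewrite -powRrM mulVf ?lt0r_neq0// powRr1// ltW.
by rewrite ge0_ler_powR// ?nnegrE ?powR_ge0// ltW.
Qed.

(** There are finitely many kernels; the sum of the absolute values of their bounds dominates each
    of them. *)
Lemma common_variation_bound (R : realType) (N m : nat) (w : 'I_m -> 'I_N -> R -> R) :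
  (forall l k, is_kernel (w l k)) -> exists2 M : R, 0 <= M &
  forall l k (a b : R), a <= b -> (total_variation a b (w l k) <= M%:E)%E.
Proof.
move=> kw.
have bv (lk : 'I_m * 'I_N) : exists M : R, forall a b : R, a <= b ->
    (total_variation a b (w lk.1 lk.2) <= M%:E)%E by have [_ _ + _ _] := kw lk.1 lk.2.
have [f hf] := choice bv.
exists (\sum_lk `|f lk|); first by apply: sumr_ge0.
move=> l k a b ab; apply: le_trans (hf (l, k) a b ab) _; rewrite lee_fin.
by rewrite (bigD1 (l, k))//= (le_trans (ler_norm _))// lerDl sumr_ge0.
Qed.

Lemma near_le_of_cvg0 (R : realType) (x : nat -> R) (e : R) : 0 < e -> x @ \oo --> 0 ->
  \forall i \near \oo, x i <= e.
Proof.
move=> e0 xc; have /cvgrPdist_le /(_ _ e0) := xc; apply: filterS => i.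
by rewrite sub0r normrN; exact: le_trans (ler_norm _).
Qed.

Lemma CFL_square (R : realType) (x : R) : 0 <= x -> x <= (Num.sqrt 2 - 1) / 2 ->
  x ^+ 2 + x <= 4^-1.
Proof.
move=> x0 xle; have s2 : Num.sqrt (2 : R) ^+ 2 = 2 by rewrite sqr_sqrtr.
have : x ^+ 2 <= ((Num.sqrt 2 - 1) / 2) ^+ 2 by rewrite ler_sqr// nnegrE// (le_trans x0).
have -> : ((Num.sqrt 2 - 1) / 2) ^+ 2 = (2 - 2 * Num.sqrt 2 + 1) / 4 :> R.
  transitivity ((Num.sqrt 2 ^+ 2 - 2 * Num.sqrt 2 + 1) / 4 : R); first by field.
  by rewrite s2.
by move: xle; lra.
Qed.

Theorem theorem2p4 (R : realType) (N m : nat) (hN : (1 <= N)%N) (hm : (1 <= m)%N)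
    (T : R) (hT : 0 < T)
    (F : 'I_N -> R -> 'rV[R]_m -> R)
    (V : 'I_N -> 'rV[R]_m -> R)
    (S : 'I_N -> 'rV[R]_N -> 'rV[R]_m -> R)
    (w : 'I_m -> 'I_N -> R -> R)
    (rho0 : 'I_N -> R -> R)
    (rm rM : R) (hrm : 0 <= rm) (hrM : rm < rM)
    (eps : R) (heps : 0 < eps)
    (LF LV LS : R)
    (hF0 : forall k q, F k rm q = 0)
    (hFL : forall k, flux_lipschitz LF rm rM (rm - eps) (N%:R * rM + eps) (F k))
    (hFV : forall k r q, F k r q = r * V k q)
    (hVL : forall k, speed_lipschitz LV (rm - eps) (N%:R * rM + eps) (V k))
    (hS0 : forall k q, S k (const_mx rm) q = 0)
    (hSL : forall k, source_lipschitz LS rm rM (rm - eps) (N%:R * rM + eps) (S k))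
    (hSlin : forall k, linear_in_density (S k))
    (hrho0 : forall k, measurable_fun setT (rho0 k))
    (hrho0_range : forall k,
        {ae @lebesgue_measure R, forall x, rm <= rho0 k x < rM})
    (hw : forall l k, is_kernel (w l k))
    (C delta : R) (hC : 0 < C) (hdelta : 0 < delta < 1)
    (dx dt : nat -> R)
    (hdx : forall i, 0 < dx i) (hdt : forall i, 0 < dt i)
    (hdx0 : dx @ \oo --> 0) (hdt0 : dt @ \oo --> 0)
    (hgrid : forall i l k, grid_fits (dx i) (w l k))
    (lam0 : R) (hlam0 : 0 < lam0) (hlam : forall i, lam0 <= dt i / dx i)
    (hCFL : forall i, dt i / dx i * LF <= (Num.sqrt 2 - 1) / 2) :
  exists (Tstar : R) (nstar : nat -> nat) (rho : 'I_N -> R * R -> R)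
         (sub : nat -> nat),
    [/\ 0 < Tstar <= T,
        (\forall i \near \oo, Tstar <= (nstar i).+1%:R * dt i /\
           forall n, (n <= nstar i)%N ->
             R_in_range F S w C delta (dx i) (dt i) rho0
               (rm - eps) (N%:R * rM + eps) n),
        increasing_seq sub,
        (forall k, weak_star_cvg Tstar
           (fun i => rho_Delta F S w C delta (dx (sub i)) (dt (sub i)) rho0
                       (nstar (sub i)) k)
           (rho k)) &
        weak_solution F S w Tstar rho0 rho].

Proof.
have [M M0 wM] := common_variation_bound hw.
have N0 : 0 < N%:R :> R by rewrite ltr0n.
(* [LV] and [LS] come without a sign; their absolute values are Lipschitz constants as well. *)
have vL k : speed_lipschitz `|LV| (rm - eps) (N%:R * rM + eps) (V k).
  move=> q q' qb qb'; apply: le_trans (hVL k q q' qb qb') _.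
  by rewrite ler_wpM2r ?dist1_ge0// ler_norm.
have sL k : source_lipschitz `|LS| rm rM (rm - eps) (N%:R * rM + eps) (S k).
  move=> r r' q q' rb rb' qb qb'; apply: le_trans (hSL k r r' q q' rb rb' qb qb') _.
  by rewrite ler_wpM2r ?addr_ge0 ?dist1_ge0// ler_norm.
have LF0 : 0 <= LF.
  exact: (flux_lip_ge0 hrM (box_rm_low rm heps) (box_rm_high hN hrm hrM heps)
    (hFL (Ordinal hN)) (hFV (Ordinal hN))).
have CFL i : (dt i / dx i * LF) ^+ 2 + dt i / dx i * LF <= 4^-1.
  by apply: CFL_square => //; rewrite mulr_ge0// divr_ge0// ltW.
(* The CFL condition bounds [dt / dx] by this quotient if [LF] is nonzero. If [LF = 0] the quotient
   is 0 by convention, and the first alternative of [hLam] holds. *)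
pose Lam := (Num.sqrt 2 - 1) / 2 / LF.
have sq2 : 1 <= Num.sqrt (2 : R) by rewrite -{1}sqrtr1 ler_sqrt// ler1n.
have Lam0 : 0 <= Lam by rewrite /Lam !divr_ge0// subr_ge0.
have hLam i : LF = 0 \/ dt i / dx i <= Lam.
  have [->|LFn] := eqVneq LF 0; [by left|right].
  by rewrite /Lam ler_pdivlMr// lt_neqAle eq_sym LFn.
(* The 1 keeps the densities below [density_bound]; the other bound makes [N * eta] at most a
   quarter of the margin. *)
pose eta := Num.min 1 (eps / (4 * N%:R)).
have eta0 : 0 < eta by rewrite lt_min ltr01 divr_gt0// mulr_gt0.
have eta1 : eta <= 1 by rewrite ge_min lexx.
have Neta : N%:R * eta <= eps / 4.
  apply: (@le_trans _ _ (N%:R * (eps / (4 * N%:R)))).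
    by rewrite ler_pM2l// ge_min lexx orbT.
  by rewrite le_eqVlt; apply/orP; left; apply/eqP; field; rewrite gt_eqF.
pose K := growth_cst (N:=N) (m:=m) rm rM `|LV| `|LS| M.
have K0 : 0 <= K by exact: growth_cst_ge0.
have K1 : 0 < K + 1 by rewrite ltr_wpDl.
(* At rate [K] the range widens by at most [eta] until this time, which depends on the data but not
   on the step sizes. [K + 1] avoids division by 0. *)
pose Ts := Num.min T (eta / (K + 1)).
have Ts0 : 0 < Ts by rewrite lt_min hT divr_gt0.
have KTs : K * Ts <= eta.
  apply: (@le_trans _ _ ((K + 1) * (eta / (K + 1)))).
    by apply: ler_pM => //; [exact: ltW|rewrite lerDl|rewrite ge_min lexx orbT].
  by rewrite mulrC divfK// gt_eqF.
(* The slab of step [nst i] contains [Ts], so the approximate solution covers all of []0, Ts[]. *)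
pose nst i := Num.truncn (Ts / dt i).
have q0 i : 0 <= Ts / dt i by rewrite divr_ge0// ltW.
have nstl i : (nst i)%:R * dt i <= Ts.
  by have /andP[h _] := truncn_itv (q0 i); rewrite -ler_pdivlMr.
have nstr i : Ts < (nst i).+1%:R * dt i.
  by have /andP[_ h] := truncn_itv (q0 i); rewrite -ltr_pdivrMr.
have growth i : K * ((nst i)%:R * dt i) <= eta.
  by apply: le_trans KTs; rewrite ler_wpM2l.
have /andP[del0 del1] := hdelta.
have powc : (fun i => C * dx i `^ delta) @ \oo --> 0.
  by rewrite -(mulr0 C); apply: cvgM; [exact: cvg_cst|exact: powR_cvg0].
pose q i := rate_bound (N:=N) C delta rm rM `|LS| (dx i) (dt i) Lam.
have qc : q @ \oo --> 0.
  rewrite -(addr0 0); apply: cvgD.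
    by rewrite -(mul0r (source_bound (N:=N) rm `|LS| (density_bound rM))); apply: cvgM => //;
      exact: cvg_cst.
  by rewrite -(mulr0 Lam); apply: cvgM => //; exact: cvg_cst.
have ev1 : \forall i \near \oo, dx i <= 1 by exact: near_le_of_cvg0.
have ev2 : \forall i \near \oo, dt i <= 1 by exact: near_le_of_cvg0.
have ev3 : \forall i \near \oo, N%:R * (quadrature_cst rM M * dx i) <= eps / 4.
  apply: near_le_of_cvg0; first by rewrite divr_gt0.
  rewrite -(mulr0 N%:R); apply: cvgM; first exact: cvg_cst.
  by rewrite -(mulr0 (quadrature_cst rM M)); apply: cvgM => //; exact: cvg_cst.
have ev4 : \forall i \near \oo, q i <= 1 by exact: near_le_of_cvg0.
have ev5 : \forall i \near \oo, N%:R * (q i * (1 + 4 * (M + 1) * dx i)) <= eps.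
  apply: near_le_of_cvg0 => //.
  rewrite -(mulr0 N%:R); apply: cvgM; first exact: cvg_cst.
  rewrite -(mul0r (1 + 4 * (M + 1) * 0)); apply: cvgM => //.
  by apply: cvgD; [exact: cvg_cst|apply: cvgM => //; exact: cvg_cst].
(* The smallness conditions hold from some [i0] on. The family is re-indexed to start there, and the
   shift reappears in the final subsequence. *)
have [i0 _ hi0] : \forall i \near \oo, [/\ dx i <= 1, dt i <= 1,
    N%:R * (quadrature_cst rM M * dx i) <= eps / 4, q i <= 1 &
    N%:R * (q i * (1 + 4 * (M + 1) * dx i)) <= eps].
  by near=> i; split; near: i.
have sm i : [/\ dx (i + i0)%N <= 1, dt (i + i0)%N <= 1,
    N%:R * (quadrature_cst rM M * dx (i + i0)%N) <= eps / 4, q (i + i0)%N <= 1 &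
    N%:R * (q (i + i0)%N * (1 + 4 * (M + 1) * dx (i + i0)%N)) <= eps].
  by apply: hi0; rewrite /= leq_addl.
have sh (u : nat -> R) (l : R) : u @ \oo --> l -> (fun i => u (i + i0)%N) @ \oo --> l.
  by apply: (@cvg_increasing_seq _ (fun i => (i + i0)%N)) => i j; rewrite leEnat leq_add2r.
have small1 i : N%:R * (quadrature_cst rM M * dx (i + i0)%N) + N%:R * eta <= eps / 2.
  by have [_ _ h _ _] := sm i; move: Neta; lra.
have small2 i : q (i + i0)%N <= 1 by have [] := sm i.
have small3 i : N%:R * (q (i + i0)%N * (1 + 4 * (M + 1) * dx (i + i0)%N)) <= eps.
  by have [] := sm i.
have dx1 i : dx (i + i0)%N <= 1 by have [] := sm i.
have dt1 i : dt (i + i0)%N <= 1 by have [] := sm i.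
have [sub [rho [inc ws weak]]] := family_limit hN hrm hrM heps hFL hFV (normr_ge0 LV) vL hS0
  (normr_ge0 LS) sL hSlin hw wM M0 (ltW hC) (ltW del0) (fun i => hdx (i + i0)%N)
  (fun i => hdt (i + i0)%N) dx1 (fun i => hgrid (i + i0)%N) (fun i => CFL (i + i0)%N) Lam0
  (fun i => hLam (i + i0)%N) (ltW eta0) eta1 small1 small2 small3 hrho0 hrho0_range
  (fun i => growth (i + i0)%N) hlam0 (fun i => hlam (i + i0)%N) Ts0 dt1 (sh _ _ hdx0)
  (sh _ _ hdt0) (sh _ _ qc) (sh _ _ powc) (fun i => nstl (i + i0)%N) (fun i => nstr (i + i0)%N).
exists Ts, nst, rho, (fun i => (sub i + i0)%N); split => //.
- by rewrite Ts0 ge_min lexx.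
- exists i0 => // i /= ii; split; first exact: ltW.
  move=> n nn; have e : i = (i - i0 + i0)%N by rewrite subnK.
  rewrite e in nn *.
  exact: (family_in_range hN hrm hrM heps hFL hFV (normr_ge0 LV) vL hS0
    (normr_ge0 LS) sL hSlin hw wM M0 (ltW hC) (fun i => hdx (i + i0)%N)
    (fun i => hdt (i + i0)%N) (fun i => hgrid (i + i0)%N) (fun i => CFL (i + i0)%N) Lam0
    (fun i => hLam (i + i0)%N) (ltW eta0) eta1 small1 small2 small3 hrho0 hrho0_range
    (fun i => growth (i + i0)%N) nn).
- by move=> i j; rewrite !leEnat leq_add2r -!leEnat; exact: inc.
Unshelve. all: by end_near. Qed.
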